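(* Let $\varphi$ be the traveling wave, with solutions $u_i$, forms $\omega$ and $\Omega$, reference time $\tau$, and Maslov index $\mathrm{Maslov}(\varphi)$ as described in the context, and suppose that all crossings in $(-\infty,\tau]$ are regular. Then $$(-1)^{\mathrm{Maslov}(\varphi)}=\operatorname{sign}\,\Omega(u_1,u_4),$$ where $\Omega(u_1,u_4)=e^{cz}\omega(u_1(0,z),u_4(0,z))$ (which is independent of $z$).
   Context: Setting. Let $f,g\in C^2(\mathbb R)$ and $\alpha,\sigma>0$, and consider $u_t=u_{xx}+f(u)-\sigma v$, $v_t=v_{xx}+g(v)+\alpha u$. Here $(0,0)$ is an equilibrium with $f'(0)+g'(0)<0$ and $f'(0)g'(0)+\sigma\alpha>0$. The system has a traveling wave $\varphi=(\hat u,\hat v)$ of speed $c$, a nonconstant solution depending only on $z=x-ct$ and decaying exponentially to $(0,0)$ as $z\to\pm\infty$. Thus, also writing $\varphi=(\hat u,\hat v,\hat u'/\sigma,\hat v'/\alpha)$, $\varphi$ is an orbit homoclinic to $0\in\mathbb R^4$ of the system (TW): $u'=\sigma w$, $v'=\alpha y$, $w'=-cw-f(u)/\sigma+v$, $y'=-cy-u-g(v)/\alpha$. Let $\nu_1,\nu_2$ be the eigenvalues of $\begin{pmatrix}f'(0)&-\sigma\\ \alpha&g'(0)\end{pmatrix}$. Standing assumptions: (A1) $c<0$. (A2) $\nu_1,\nu_2$ are real and simple, with $\nu_1<\nu_2<0$. Set $\mu_{1}=-\frac c2-\frac12\sqrt{c^2-4\nu_1}$, $\mu_{2}=-\frac c2-\frac12\sqrt{c^2-4\nu_2}$,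 $\mu_{3}=-\frac c2+\frac12\sqrt{c^2-4\nu_2}$, $\mu_{4}=-\frac c2+\frac12\sqrt{c^2-4\nu_1}$, so $\mu_1<\mu_2<0<\mu_3<\mu_4$. (A3) The exponential decay rate of $\varphi$ is exactly $\mu_2$ as $z\to+\infty$ and exactly $\mu_3$ as $z\to-\infty$. (A4) $\varphi$ is transversely constructed: for (TW) augmented with $c'=0$ (in $\mathbb R^5$), the curve $(\varphi(z),c)$ is given by the transverse intersection of the center-unstable and center-stable manifolds of the fixed point $(0,0,0,0,c)$. Linearized system at $\lambda=0$. Consider $Y'=A(0,z)Y$ on $\mathbb R^4$ with $$A(0,z)=\begin{pmatrix}0&0&\sigma&0\\0&0&0&\alpha\\ -\frac{f'(\hat u(z))}{\sigma}&1&-c&0\\-1&-\frac{g'(\hat v(z))}{\alpha}&0&-c\end{pmatrix},\qquad A_\infty(0)=\lim_{z\to\pm\infty}A(0,z).$$ The eigenvalues of $A_\infty(0)$ are $\mu_1,\dots,\mu_4$. Let $u_i(0,z)$ be solutions with $\lim_{z\to+\infty}e^{-\mu_iz}u_i(0,z)=\eta_i$ for $i=1,2$ and $\lim_{z\to-\infty}e^{-\mu_iz}u_i(0,z)=\eta_i$ for $i=3,4$, where $\eta_i$ is a nonzero eigenvector of $A_\infty(0)$ for $\mu_i$, normalized so that $u_2(0,z)=u_3(0,z)=\varphi'(z)=(\hat u',\hat v',\hat u''/\sigma,\hat v''/\alpha)$ and $\det[\eta_1,\eta_2,\eta_3,\eta_4]>0$. Set $E^s(0,z)=\mathrm{span}\{u_1(0,z),u_2(0,z)\}$,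 $E^u(0,z)=\mathrm{span}\{u_3(0,z),u_4(0,z)\}$, and $V^u(0)=\mathrm{span}\{\eta_3,\eta_4\}$. Symplectic forms on $\mathbb R^4$: $\omega(a,b)=(a_1b_3-a_3b_1)-(a_2b_4-a_4b_2)$, $\Omega=e^{cz}\omega$. For two solutions of the linear system, $\Omega$ is independent of $z$. The planes $E^{s}(0,z)$ and $E^u(0,z)$ are $\omega$-Lagrangian for all $z$. Maslov index. Fix $\tau\gg1$ large enough that $V^u(0)\cap E^s(0,\tau')=\{0\}$ for all $\tau'\ge\tau$. A crossing is a $z^*\in\mathbb R$ with $E^u(0,z^* )\cap E^s(0,\tau)\ne\{0\}$. The crossing form at $z^*$ is the quadratic form $\Gamma(E^u,E^s(0,\tau);z^* )(\xi)=\omega(\xi,A(0,z^* )\xi)$ on $E^u(0,z^* )\cap E^s(0,\tau)$, and the crossing is regular if $\Gamma$ is nonsingular. For a quadratic form $Q$, $n_\pm(Q)$ are its positive and negative indices of inertia and $\mathrm{sign}(Q)=n_+(Q)-n_-(Q)$. The time $z=\tau$ is always a crossing since $\varphi'(\tau)$ lies in both planes. Define $$\mathrm{Maslov}(\varphi)=\sum_{z^*\in(-\infty,\tau)}\mathrm{sign}\,\Gamma(E^u,E^s(0,\tau);z^* )+n_+\big(\Gamma(E^u,E^s(0,\tau);\tau)\big),$$ the sum being over all crossings $z^*<\tau$. *)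

(* Defs.v *)
From HB Require Import structures.
From mathcomp Require Import all_boot all_order all_algebra.
From mathcomp Require Import all_classical all_reals all_analysis.

Set Implicit Arguments.
Unset Strict Implicit.
Unset Printing Implicit Defensive.

Import Order.TTheory GRing.Theory Num.Theory.
Import numFieldNormedType.Exports.

Local Open Scope classical_set_scope.
Local Open Scope ring_scope.

Definition colv (R : realType) (n : nat) (s : seq R) : 'cV[R]_n :=
  \col_(i < n) s`_i.

Definition matl (R : realType) (n : nat) (rows : seq (seq R)) : 'M[R]_n :=
  \matrix_(i < n, j < n) (nth [::] rows i)`_j.

Definition C2 (R : realType) (h : R -> R) : Prop :=
  [/\ forall x, derivable h x 1,
      forall x, derivable (derive1 h) x 1 &
      continuous (derive1 (derive1 h))].

(* u : R -> R -> R takes the space variable first, the time variable second *)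
Definition has_ut_uxx (R : realType) (u : R -> R -> R) : Prop :=
  forall x t, [/\ derivable (u x) t 1,
                  derivable (u^~ t) x 1 &
                  derivable (derive1 (u^~ t)) x 1].

Definition rd_solution (R : realType) (f g : R -> R) (sigma alpha : R)
    (u v : R -> R -> R) : Prop :=
  [/\ has_ut_uxx u, has_ut_uxx v &
      forall x t,
        derive1 (u x) t = derive1 (derive1 (u^~ t)) x + f (u x t) - sigma * v x t /\
        derive1 (v x) t = derive1 (derive1 (v^~ t)) x + g (v x t) + alpha * u x t].

Definition traveling_wave (R : realType) (f g : R -> R) (sigma alpha c : R)
    (uh vh : R -> R) : Prop :=
  [/\ rd_solution f g sigma alpha
        (fun x t => uh (x - c * t)) (fun x t => vh (x - c * t)),
      ~ (exists a b, forall z, uh z = a /\ vh z = b) &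
      exists C kappa : R, 0 < kappa /\
        forall z, `|uh z| + `|vh z| <= C * expR (- (kappa * `|z|))].

Definition reaction_matrix (R : realType) (f g : R -> R) (sigma alpha : R) :
    'M[R]_2 :=
  matl 2 [:: [:: derive1 f 0; - sigma];
             [:: alpha; derive1 g 0]].

Definition mu_minus (R : realType) (c nu : R) : R :=
  - (c / 2) - Num.sqrt (c ^+ 2 - 4 * nu) / 2.

Definition mu_plus (R : realType) (c nu : R) : R :=
  - (c / 2) + Num.sqrt (c ^+ 2 - 4 * nu) / 2.

Definition wave_orbit (R : realType) (sigma alpha : R) (uh vh : R -> R)
    (z : R) : 'cV[R]_4 :=
  colv 4 [:: uh z; vh z; derive1 uh z / sigma; derive1 vh z / alpha].

Definition wave_velocity (R : realType) (sigma alpha : R) (uh vh : R -> R)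
    (z : R) : 'cV[R]_4 :=
  colv 4 [:: derive1 uh z; derive1 vh z;
             derive1 (derive1 uh) z / sigma; derive1 (derive1 vh) z / alpha].

(* The first-order system u' = sigma w, v' = alpha y of the wave profile,
   augmented with c' = 0; the coordinates of p are (u, v, w, y, c). *)
Definition augmented_field (R : realType) (f g : R -> R) (sigma alpha : R)
    (p : 'cV[R]_5) : 'cV[R]_5 :=
  let u := p 0 0 in let v := p 1 0 in
  let w := p 2 0 in let y := p 3 0 in let c := p 4 0 in
  colv 5 [:: sigma * w;
             alpha * y;
             - (c * w) - f u / sigma + v;
             - (c * y) - u - g v / alpha;
             0].

(* Near an equilibrium p whose centre directions are filled by a curve of
   equilibria (here p = (0, 0, 0, 0, c), the curve being {0} x R), the local
   centre-unstable manifold is unique and consists of the points whose backward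
   orbit stays near p.  cu_manifold F p delta T is its image, for the
   neighbourhood of radius delta, under the time-T flow of F.  Up to shrinking
   delta, these are the pieces of which the (immersed) global centre-unstable
   manifold is the increasing union as T grows. *)
Definition cu_manifold (R : realType) (n : nat)
    (F : 'cV[R]_n.+1 -> 'cV[R]_n.+1) (p : 'cV[R]_n.+1) (delta T : R) :
    set 'cV[R]_n.+1 :=
  [set q | exists X : R -> 'cV[R]_n.+1,
     [/\ X 0 = q,
         forall z : R, z <= 0 -> is_derive z 1 X (F (X z)) &
         forall z, z <= - T -> `|X z - p| <= delta]].

Definition cs_manifold (R : realType) (n : nat)
    (F : 'cV[R]_n.+1 -> 'cV[R]_n.+1) (p : 'cV[R]_n.+1) (delta T : R) :
    set 'cV[R]_n.+1 :=
  [set q | exists X : R -> 'cV[R]_n.+1,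
     [/\ X 0 = q,
         forall z : R, 0 <= z -> is_derive z 1 X (F (X z)) &
         forall z, T <= z -> `|X z - p| <= delta]].

Definition tangent_vector (R : realType) (n : nat) (W : set 'cV[R]_n.+1)
    (q v : 'cV[R]_n.+1) : Prop :=
  exists gamma : R -> 'cV[R]_n.+1,
    [/\ gamma 0 = q,
        \forall s \near (0 : R), W (gamma s) &
        is_derive (0 : R) 1 gamma v].

(* The curve is required to stay in a single piece cu_manifold F p delta T,
   i.e. to be a curve for the immersed topology of the global manifold. *)
Definition cu_tangent (R : realType) (n : nat)
    (F : 'cV[R]_n.+1 -> 'cV[R]_n.+1) (p q v : 'cV[R]_n.+1) : Prop :=
  forall delta, 0 < delta -> exists T,
    tangent_vector (cu_manifold F p delta T) q v.

Definition cs_tangent (R : realType) (n : nat)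
    (F : 'cV[R]_n.+1 -> 'cV[R]_n.+1) (p q v : 'cV[R]_n.+1) : Prop :=
  forall delta, 0 < delta -> exists T,
    tangent_vector (cs_manifold F p delta T) q v.

(* At each point of the curve (phi(z), c) the tangent spaces of the
   centre-unstable and centre-stable manifolds span R^5.  That the curve lies
   on both manifolds is part of the existence of the tangent vectors. *)
Definition transversely_constructed (R : realType) (f g : R -> R)
    (sigma alpha c : R) (uh vh : R -> R) : Prop :=
  let F := augmented_field f g sigma alpha in
  let p := colv 5 [:: 0; 0; 0; 0; c] in
  forall z,
    let q := colv 5 [:: uh z; vh z; derive1 uh z / sigma; derive1 vh z / alpha; c] in
    forall v : 'cV[R]_5, exists a b,
      [/\ cu_tangent F p q a, cs_tangent F p q b & v = a + b].

Definition A0 (R : realType) (f g : R -> R) (sigma alpha c : R)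
    (uh vh : R -> R) (z : R) : 'M[R]_4 :=
  matl 4 [:: [:: 0; 0; sigma; 0];
             [:: 0; 0; 0; alpha];
             [:: - (derive1 f (uh z) / sigma); 1; - c; 0];
             [:: - 1; - (derive1 g (vh z) / alpha); 0; - c]].

Definition linear_solution (R : realType) (n : nat) (A : R -> 'M[R]_n.+1)
    (Y : R -> 'cV[R]_n.+1) : Prop :=
  forall z : R, is_derive z 1 Y (A z *m Y z).

Definition eigenvector (R : realType) (n : nat) (M : 'M[R]_n) (mu : R)
    (eta : 'cV[R]_n) : Prop :=
  eta != 0 /\ M *m eta = mu *: eta.

Definition det4 (R : realType) (a b c d : 'cV[R]_4) : R :=
  \det (\matrix_(i < 4, j < 4) (nth 0 [:: a; b; c; d] j) i 0).

Definition span2 (R : realType) (n : nat) (a b : 'cV[R]_n) :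
    {vspace 'cV[R]_n} := <<[:: a; b]>>%VS.

(* Coordinates are numbered from 0:
   omega = dx_0 /\ dx_2 - dx_1 /\ dx_3. *)
Definition omega (R : realType) (a b : 'cV[R]_4) : R :=
  (a 0 0 * b 2 0 - a 2 0 * b 0 0) - (a 1 0 * b 3 0 - a 3 0 * b 1 0).

Definition Omega (R : realType) (c z : R) (a b : 'cV[R]_4) : R :=
  expR (c * z) * omega a b.

Section Inertia.
Variables (R : realType) (V : vectType R).
Implicit Types (Q : V -> R) (U W : {vspace V}).

(* index of inertia: the largest dimension of a subspace of U on which Q is
   positive definite *)
Definition pos_index Q U : nat :=
  \max_(k < (\dim U).+1 |
     `[< exists W, [/\ (W <= U)%VS, \dim W = k &
           forall x, x \in W -> x != 0 -> 0 < Q x] >]) k.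

Definition neg_index Q U : nat := pos_index (fun x => - Q x) U.

Definition form_sign Q U : int := (pos_index Q U)%:Z - (neg_index Q U)%:Z.

Definition polar_form Q (x y : V) : R := (Q (x + y) - Q x - Q y) / 2.

Definition nonsingular_form Q U : Prop :=
  forall x, x \in U -> (forall y, y \in U -> polar_form Q x y = 0) -> x = 0.

End Inertia.

Definition crossing (R : realType) (Eu : R -> {vspace 'cV[R]_4})
    (L : {vspace 'cV[R]_4}) (z : R) : Prop := (Eu z :&: L)%VS != 0%VS.

Definition crossing_form (R : realType) (A : R -> 'M[R]_4) (z : R)
    (xi : 'cV[R]_4) : R := omega xi (A z *m xi).

Definition regular_crossing (R : realType) (A : R -> 'M[R]_4)
    (Eu : R -> {vspace 'cV[R]_4}) (L : {vspace 'cV[R]_4}) (z : R) : Prop :=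
  nonsingular_form (crossing_form A z) (Eu z :&: L)%VS.

(* The sum over a classical set is a finite sum whenever all but finitely many
   terms vanish.  This is the case as soon as all crossings are regular, since
   crossings are then isolated and bounded below. *)
Definition maslov (R : realType) (A : R -> 'M[R]_4)
    (Eu : R -> {vspace 'cV[R]_4}) (L : {vspace 'cV[R]_4}) (tau : R) : int :=
  \sum_(z \in [set z | z < tau /\ crossing Eu L z])
     form_sign (crossing_form A z) (Eu z :&: L)%VS
  + (pos_index (crossing_form A tau) (Eu tau :&: L)%VS)%:Z.

(* Main.v *)
(** The function beta(z) = det(u1(tau), u2(tau), u3(z), u4(z)) vanishes exactly at
    the crossings.  By the Pfaffian expansion of det4 and the Lagrangian property,
    beta(z) / (z - s)^d has a nonzero limit at z = s, where d is the dimension of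
    the crossing, and d has the parity of the signature of the regular form
    Gamma.  Hence (-1)^(sum of signatures) is the sign of beta just before tau,
    as beta is positive near -oo: its sign there is that of
    det(u1(t), u2(t), eta3, eta4), which does not vanish for t >= tau and tends,
    after scaling, to det(eta1, ..., eta4) > 0.  At tau,
    beta'(tau) = omega(u1, u4) Gamma(phi').

    Transversality is needed only for omega(u1, u4) <> 0.  Otherwise u3 and u4
    both decay at both ends, so that Omega(u3, _) and Omega(u4, _) are adjoint
    solutions.  On vectors tangent to either invariant manifold such a covector
    is a multiple of the component along c, so that the two tangent spaces
    together span at most a hyperplane of R^5.  The decay used here is an integral
    estimate with exponential weight for orbits that stay near the fixed point,
    obtained from the indefinite quadratic form sum_i y_i^2 / mu_i in
    eigencoordinates. *)

Require Import Defs.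
From HB Require Import structures.
From mathcomp Require Import all_boot all_order all_algebra.
From mathcomp Require Import all_classical all_reals all_analysis.
From mathcomp Require Import ring lra.

Set Implicit Arguments.
Unset Strict Implicit.
Unset Printing Implicit Defensive.

Import Order.TTheory GRing.Theory Num.Theory.
Import numFieldNormedType.Exports.

Local Open Scope classical_set_scope.
Local Open Scope ring_scope.

(** * Calculus *)

(** The tangent vectors in the transversality hypothesis come from curves of orbits that are only
    known to stay close to the fixed point: neither smoothness of the invariant manifolds nor a
    decay rate is at hand. A difference quotient Y of such an orbit with the wave is bounded on the
    half line, but the bound degenerates as the step of the quotient tends to 0, and the
    linearization error is only eps |Y|. Paired with a decaying covector, this error is harmless as
    soon as the integral of exp(k z) |Y|^2 is bounded through Y(0) and D alone. The form sum_i y_i^2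
    / mu_i achieves this because its derivative along y_i' = mu_i y_i is 2 sum_i y_i^2 whatever the
    signs of the mu_i, so that stable and unstable directions need not be separated. The speed
    varies along the curves too and contributes a source term D r. Combining two tangent vectors so
    that their components along c cancel removes it; for this reason the pairing is determined only
    up to a multiple of that component. *)

Lemma is_deriveD_fun (R : realType) (f g : R -> R) (z a b : R) :
  is_derive z 1 f a -> is_derive z 1 g b ->
  is_derive z 1 (fun x => f x + g x) (a + b).
Proof. by move=> df dg; exact: is_deriveD. Qed.

Lemma is_deriveB_fun (R : realType) (f g : R -> R) (z a b : R) :
  is_derive z 1 f a -> is_derive z 1 g b ->
  is_derive z 1 (fun x => f x - g x) (a - b).
Proof. by move=> df dg; exact: is_deriveB. Qed.

Lemma is_deriveN_fun (R : realType) (f : R -> R) (z a : R) :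
  is_derive z 1 f a -> is_derive z 1 (fun x => - f x) (- a).
Proof. by move=> df; exact: is_deriveN. Qed.

Lemma is_deriveM_fun (R : realType) (f g : R -> R) (z a b : R) :
  is_derive z 1 f a -> is_derive z 1 g b ->
  is_derive z 1 (fun x => f x * g x) (a * g z + f z * b).
Proof.
move=> df dg; apply: (is_derive_eq (is_deriveM df dg)).
by rewrite /GRing.scale /=; ring.
Qed.

Lemma is_deriveZ_fun (R : realType) (f : R -> R) (k z a : R) :
  is_derive z 1 f a -> is_derive z 1 (fun x => k * f x) (k * a).
Proof. by move=> df; exact: (is_deriveZ k df). Qed.

Lemma is_derive_sum_fun (R : realType) n (f : 'I_n -> R -> R) (z : R)
    (a : 'I_n -> R) :
  (forall i, is_derive z 1 (f i) (a i)) ->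
  is_derive z 1 (fun x => \sum_i f i x) (\sum_i a i).
Proof.
move=> df; have := is_derive_sum (h := f) (x := z) (v := 1) (dh := a) df.
by congr is_derive; apply/funext => x; rewrite fct_sumE.
Qed.

Lemma is_derive_expM (R : realType) (k z : R) :
  is_derive z 1 (fun x => expR (k * x)) (k * expR (k * z)).
Proof.
have dk : is_derive z 1 (fun x => k * x) k.
  by apply: is_derive_eq (is_deriveZ_fun k (is_derive_id z 1)) _; rewrite mulr1.
by rewrite mulrC; exact: (@is_derive1_comp R expR _ z _ k).
Qed.

Lemma is_derive_mulx (R : realType) (f : R -> R) (k z a : R) :
  is_derive (k * z) 1 f a -> is_derive z 1 (fun x => f (k * x)) (k * a).
Proof.
move=> df; rewrite mulrC.
have dk : is_derive z 1 (fun x => k * x) k.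
  by apply: is_derive_eq (is_deriveZ_fun k (is_derive_id z 1)) _; rewrite mulr1.
exact: (@is_derive1_comp _ f _ z a k).
Qed.

Lemma is_derive_entry (R : realType) m n (Y : R -> 'M[R]_(m.+1, n.+1)) (z : R)
    (dY : 'M[R]_(m.+1, n.+1)) i j :
  is_derive z 1 Y dY -> is_derive z 1 (fun x => Y x i j) (dY i j).
Proof.
case=> dvY <-; apply: DeriveDef; first by have /derivable_mxP := dvY; apply.
by rewrite derive_mx// mxE.
Qed.

Lemma is_derive_continuous (R : realType) (f : R -> R) (z a : R) :
  is_derive z 1 f a -> {for z, continuous f}.
Proof.
by case=> df _; apply/differentiable_continuous/derivable1_diffP.
Qed.

Lemma is_derive_cvg_quot (R : realType) (f : R -> R) (z a : R) :
  is_derive z 1 f a -> (f x - f z) / (x - z) @[x --> z^'] --> a.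
Proof.
move=> /is_derive1_caratheodory[g [fE cg <-]].
have {}cg : g x @[x --> z^'] --> g z.
  by move=> B /cg; rewrite /= !nbhs_simpl /=; exact: nbhs_dnbhs.
apply: cvg_trans cg; apply: near_eq_cvg; near=> x.
rewrite fE mulfK// subr_eq0; near: x; exact: nbhs_dnbhs_neq.
Unshelve. all: by end_near. Qed.

Lemma le_of_derive_ge0 (R : realType) (f df : R -> R) (a b : R) : a <= b ->
  (forall z, a <= z <= b -> is_derive z 1 f (df z)) ->
  (forall z, a <= z <= b -> 0 <= df z) -> f a <= f b.
Proof.
move=> ab dfE df0.
have [||c] := @MVT_segment R f df a b ab.
- by move=> x; rewrite in_itv/= => /andP[/ltW ax /ltW xb]; apply: dfE; rewrite ax.
- apply: continuous_in_subspaceT => x; rewrite inE/= in_itv/= => xab.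
  exact: is_derive_continuous (dfE _ xab).
rewrite in_itv/= => cab fE; rewrite -subr_ge0 fE mulr_ge0 ?subr_ge0//.
exact: df0.
Qed.

(** Replaces integration over (-oo, b]: estimates of improper integrals become comparisons of a
    function with an explicit antiderivative of its bound, both tending to 0 at -oo. *)
Lemma ge0_of_derive_ge0_ninfty (R : realType) (f df : R -> R) (b : R) :
  (forall z, z <= b -> is_derive z 1 f (df z)) ->
  (forall z, z <= b -> 0 <= df z) -> f z @[z --> -oo] --> (0 : R) -> 0 <= f b.
Proof.
move=> dfE df0 f0; rewrite leNgt; apply/negP => fb.
move/cvgrPdist_lt : f0 => /(_ (- f b)); rewrite oppr_gt0 => /(_ fb) H.
near (@ninfty_nbhs R) => z.
have zb : z <= b by near: z; exact: (nbhs_ninfty_le (num_real b)).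
have : `|0 - f z| < - f b by near: z.
have := @le_of_derive_ge0 R f df z b zb.
move=> /(_ (fun t ht => dfE t (proj2 (andP ht))) (fun t ht => df0 t (proj2 (andP ht)))) fzb.
rewrite sub0r normrN ltr_norml opprK => /andP[].
by move=> /lt_le_trans /(_ fzb); rewrite ltxx.
Unshelve. all: by end_near. Qed.

Lemma is_derive0_const (R : realType) (f : R -> R) (a b : R) : a <= b ->
  (forall z, a <= z <= b -> is_derive z 1 f 0) -> f a = f b.
Proof.
move=> ab df; apply/eqP; rewrite eq_le; apply/andP; split.
  by apply: (@le_of_derive_ge0 _ _ (fun=> 0)).
rewrite -lerN2; apply: (@le_of_derive_ge0 _ (fun x => - f x) (fun=> 0)) => // z zab.
by apply: is_derive_eq (is_deriveN_fun (df _ zab)) _; rewrite oppr0.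
Qed.

(** * Symplectic linear algebra *)

Lemma det_mx22 (R : comNzRingType) (M : 'M[R]_2) :
  \det M = M 0 0 * M 1 1 - M 0 1 * M 1 0.
Proof.
rewrite (expand_det_row _ 0) !big_ord_recl big_ord0 /cofactor !det_mx11 !mxE.
have E1 : lift 0 0 = 1 :> 'I_2 by exact: val_inj.
have E2 : lift 1 0 = 0 :> 'I_2 by exact: val_inj.
have E7 : lift ord0 ord0 = 1 :> 'I_2 by exact: val_inj.
have E8 : ord0 = 0 :> 'I_2 by exact: val_inj.
rewrite ?E7 ?E8 ?E1 ?E2 /=. ring.
Qed.

Lemma det_mx33 (R : comNzRingType) (M : 'M[R]_3) :
  \det M = M 0 0 * (M 1 1 * M 2 2 - M 1 2 * M 2 1)
         - M 0 1 * (M 1 0 * M 2 2 - M 1 2 * M 2 0)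
         + M 0 2 * (M 1 0 * M 2 1 - M 1 1 * M 2 0).
Proof.
rewrite (expand_det_row _ 0) !big_ord_recl big_ord0 /cofactor !det_mx22 !mxE.
have E0 : ord0 = 0 :> 'I_3 by exact: val_inj.
have E1 : lift 0 0 = 1 :> 'I_3 by exact: val_inj.
have E2 : lift 0 1 = 2 :> 'I_3 by exact: val_inj.
have E3 : lift 1 0 = 0 :> 'I_3 by exact: val_inj.
have E4 : lift 1 1 = 2 :> 'I_3 by exact: val_inj.
have E5 : lift 2 0 = 0 :> 'I_3 by exact: val_inj.
have E6 : lift 2 1 = 1 :> 'I_3 by exact: val_inj.
have E7 : lift ord0 ord0 = 1 :> 'I_2 by exact: val_inj.
have E8 : ord0 = 0 :> 'I_2 by exact: val_inj.
rewrite ?E7 ?E8 ?E0 ?E1 ?E2 ?E3 ?E4 ?E5 ?E6 /=.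
ring.
Qed.

Lemma ord4_ind (P : 'I_4 -> Prop) : P 0 -> P 1 -> P 2 -> P 3 -> forall i, P i.
Proof.
move=> P0 P1 P2 P3 [[|[|[|[|//]]]] i4].
- by rewrite (_ : Ordinal i4 = 0)//; exact: val_inj.
- by rewrite (_ : Ordinal i4 = 1)//; exact: val_inj.
- by rewrite (_ : Ordinal i4 = 2)//; exact: val_inj.
- by rewrite (_ : Ordinal i4 = 3)//; exact: val_inj.
Qed.

Lemma sum_ord4 (V : zmodType) (F : 'I_4 -> V) :
  \sum_i F i = F 0 + F 1 + F 2 + F 3.
Proof.
rewrite !big_ord_recl big_ord0 addr0 !addrA.
by congr (_ + F _ + F _ + F _); exact: val_inj.
Qed.

(** Half of the exterior square of [omega] is dx_0 dx_1 dx_2 dx_3 with sign +1, because moving dx_2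
    past dx_1 cancels the minus sign of dx_1 dx_3 in [omega]. *)
Lemma det4E (R : realType) (a b c d : 'cV[R]_4) :
  det4 a b c d =
  omega a b * omega c d - omega a c * omega b d + omega a d * omega b c.
Proof.
rewrite /det4; set M := \matrix_(i, j) _.
have Ma i : M i 0 = a i 0 by rewrite mxE.
have Mb i : M i 1 = b i 0 by rewrite mxE.
have Mc i : M i 2 = c i 0 by rewrite mxE.
have Md i : M i 3 = d i 0 by rewrite mxE.
rewrite (expand_det_row _ 0) sum_ord4 /cofactor !det_mx33.
have minorE (N : 'M[R]_4) i j k l : row' i (col' j N) k l = N (lift i k) (lift j l).
  by rewrite !mxE.
rewrite !minorE.
have E0 : lift 0 0 = 1 :> 'I_4 by exact: val_inj.
have E1 : lift 0 1 = 2 :> 'I_4 by exact: val_inj.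
have E2 : lift 0 2 = 3 :> 'I_4 by exact: val_inj.
have E3 : lift 1 0 = 0 :> 'I_4 by exact: val_inj.
have E4 : lift 1 1 = 2 :> 'I_4 by exact: val_inj.
have E5 : lift 1 2 = 3 :> 'I_4 by exact: val_inj.
have E6 : lift 2 0 = 0 :> 'I_4 by exact: val_inj.
have E7 : lift 2 1 = 1 :> 'I_4 by exact: val_inj.
have E8 : lift 2 2 = 3 :> 'I_4 by exact: val_inj.
have E9 : lift 3 0 = 0 :> 'I_4 by exact: val_inj.
have E10 : lift 3 1 = 1 :> 'I_4 by exact: val_inj.
have E11 : lift 3 2 = 2 :> 'I_4 by exact: val_inj.
rewrite !(E0, E1, E2, E3, E4, E5, E6, E7, E8, E9, E10, E11).
rewrite !(Ma, Mb, Mc, Md) /=.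
rewrite /omega.
move: (a 0 0) (a 1 0) (a 2 0) (a 3 0) (b 0 0) (b 1 0) (b 2 0) (b 3 0).
move: (c 0 0) (c 1 0) (c 2 0) (c 3 0) (d 0 0) (d 1 0) (d 2 0) (d 3 0).
by move=> *; ring.
Qed.

Definition indep2 (R : realType) (a b : 'cV[R]_4) : Prop :=
  forall x y : R, x *: a + y *: b = 0 -> x = 0 /\ y = 0.

Lemma omegaDl (R : realType) (a b c : 'cV[R]_4) :
  omega (a + b) c = omega a c + omega b c.
Proof. rewrite /omega !mxE; ring. Qed.

Lemma omegaZl (R : realType) k (a c : 'cV[R]_4) :
  omega (k *: a) c = k * omega a c.
Proof. rewrite /omega !mxE; ring. Qed.

Lemma omegaC (R : realType) (a b : 'cV[R]_4) : omega a b = - omega b a.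
Proof. rewrite /omega; ring. Qed.

Lemma omegaDr (R : realType) (a b c : 'cV[R]_4) :
  omega c (a + b) = omega c a + omega c b.
Proof. rewrite /omega !mxE; ring. Qed.

Lemma omegaZr (R : realType) k (a c : 'cV[R]_4) :
  omega c (k *: a) = k * omega c a.
Proof. rewrite /omega !mxE; ring. Qed.

Lemma omegaNr (R : realType) (a c : 'cV[R]_4) : omega c (- a) = - omega c a.
Proof. rewrite /omega !mxE; ring. Qed.

Lemma omegaxx (R : realType) (a : 'cV[R]_4) : omega a a = 0.
Proof. rewrite /omega; ring. Qed.

Lemma omega0r (R : realType) (a : 'cV[R]_4) : omega a 0 = 0.
Proof. rewrite /omega !mxE; ring. Qed.

Lemma omega_nondegenerate (R : realType) (v : 'cV[R]_4) :
  (forall x, omega v x = 0) -> v = 0.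
Proof.
move=> v0; apply/matrixP => i j; rewrite ord1 mxE; move: i.
have H k := v0 (delta_mx k 0).
move: (H 0) (H 1) (H 2) (H 3); rewrite /omega !mxE /=.
rewrite !mulr0 !mulr1 !subr0 !sub0r ?opprK ?oppr0 ?subr0 => H0 H1 H2 H3.
by apply: ord4_ind; lra.
Qed.

Lemma mem_span2 (R : realType) n (a b v : 'cV[R]_n) :
  reflect (exists x y, v = x *: a + y *: b) (v \in span2 a b).
Proof.
rewrite /span2 span_cons span_seq1; apply: (iffP memv_addP).
  move=> [_ /vlineP[x ->] [_ /vlineP[y ->] ->]]; by exists x, y.
by move=> [x [y ->]]; exists (x *: a); rewrite ?memvZ ?memv_line//;
  exists (y *: b); rewrite ?memvZ ?memv_line.
Qed.

Lemma dim_span2 (R : realType) (a b : 'cV[R]_4) :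
  indep2 a b -> \dim (span2 a b) = 2%N.
Proof.
move=> ab; apply/eqP; rewrite eqn_leq (leq_trans (dim_span _))//=.
have af : free [:: a; b].
  rewrite !free_cons nil_free span_nil memv0 andbT.
  apply/andP; split; last first.
    by apply/eqP => b0; have [_ /eqP] := ab 0 1 ltac:(by rewrite b0 scaler0 scale0r addr0);
      rewrite oner_eq0.
  apply/negP; rewrite span_seq1 => /vlineP[k ak].
  have [/eqP] := ab 1 (- k) ltac:(by rewrite ak scale1r scaleNr subrr).
  by rewrite oner_eq0.
by move: af; rewrite /free /span2 => /eqP->.
Qed.

Lemma det4_dependent (R : realType) (a b c d : 'cV[R]_4) :
  det4 a b c d = 0 <->
  exists x y z w : R, [\/ x != 0, y != 0, z != 0 | w != 0] /\
    x *: a + y *: b + z *: c + w *: d = 0.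
Proof.
pose M := \matrix_(i < 4, j < 4) (nth 0 [:: a; b; c; d] j) i 0.
have ME (v : 'rV[R]_4) : (v *m M^T)^T =
    v 0 0 *: a + v 0 1 *: b + v 0 2 *: c + v 0 3 *: d.
  by apply/matrixP => i j; rewrite ord1 !mxE sum_ord4 !mxE.
split.
  move=> /eqP; rewrite /det4 -/M -det_tr => /det0P[v v0 vM].
  exists (v 0 0), (v 0 1), (v 0 2), (v 0 3); split; last first.
    by rewrite -ME vM trmx0.
  have [v00|] := eqVneq (v 0 0) 0; last by constructor 1.
  have [v01|] := eqVneq (v 0 1) 0; last by constructor 2.
  have [v02|] := eqVneq (v 0 2) 0; last by constructor 3.
  have [v03|] := eqVneq (v 0 3) 0; last by constructor 4.
  exfalso; move/eqP: v0; apply; apply/matrixP => i j; rewrite ord1 mxE.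
  by move: j; apply: ord4_ind.
move=> [x [y [z [w [H E]]]]].
apply/eqP; rewrite /det4 -/M -det_tr; apply/det0P.
pose v : 'rV[R]_4 := \row_j [:: x; y; z; w]`_j.
have v00 : v 0 0 = x by rewrite mxE.
have v01 : v 0 1 = y by rewrite mxE.
have v02 : v 0 2 = z by rewrite mxE.
have v03 : v 0 3 = w by rewrite mxE.
exists v.
  apply/eqP => v0; move: v00 v01 v02 v03; rewrite v0 !mxE => x0 y0 z0 w0.
  by case: H; rewrite -?x0 -?y0 -?z0 -?w0 eqxx.
by apply: trmx_inj; rewrite ME v00 v01 v02 v03 E trmx0.
Qed.

Lemma dim_cV4 (R : realType) : \dim {:'cV[R]_4} = 4%N.
Proof. by rewrite dimvf /dim /=. Qed.

(** With these three pairings zero, every term of the Pfaffian expansion of det(a, b, v, x) has a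
    vanishing factor. So a, b, v, x are dependent for all x, and if v were outside the plane, three
    vectors would span R^4. *)
Lemma lagrangian_maximal (R : realType) (a b v : 'cV[R]_4) :
  indep2 a b -> omega a b = 0 -> omega a v = 0 -> omega b v = 0 ->
  exists x y, v = x *: a + y *: b.
Proof.
move=> ab wab wav wbv.
have D x : det4 a b v x = 0 by rewrite det4E wab wav wbv; ring.
apply: contrapT => nv.
suff : ({:'cV[R]_4} <= <<[:: a; b; v]>>)%VS.
  move=> /dimvS; rewrite dim_cV4 => /leq_trans /(_ (dim_span _)).
  by rewrite ltnn.
apply/subvP => x _.
have /det4_dependent[p [q [r [s [pqrs E]]]]] := D x.
have [s0|s0] := eqVneq s 0; last first.
  have -> : x = (- (s^-1 * p)) *: a + (- (s^-1 * q)) *: b + (- (s^-1 * r)) *: v.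
    have : s^-1 *: (p *: a + q *: b + r *: v + s *: x) = 0 by rewrite E scaler0.
    rewrite !scalerDr !scalerA mulVf// scale1r => /eqP.
    rewrite addrC addr_eq0 => /eqP->.
    by rewrite !opprD !scaleNr.
  by rewrite !rpredD// rpredZ// memv_span// !inE eqxx ?orbT.
move: E; rewrite s0 scale0r addr0 => E.
have [r0|r0] := eqVneq r 0.
  move: E; rewrite r0 scale0r addr0 => /ab[p0 q0].
  by case: pqrs; rewrite ?p0 ?q0 ?r0 ?s0 eqxx.
exfalso; apply: nv; exists (- (r^-1 * p)), (- (r^-1 * q)).
have : r^-1 *: (p *: a + q *: b + r *: v) = 0 by rewrite E scaler0.
rewrite !scalerDr !scalerA mulVf// scale1r addrC => /eqP.
by rewrite addr_eq0 => /eqP->; rewrite opprD !scaleNr.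
Qed.

Lemma span2_cap_neq0 (R : realType) (a b c d : 'cV[R]_4) :
  indep2 a b -> indep2 c d ->
  ((span2 c d :&: span2 a b)%VS != 0%VS) = (det4 a b c d == 0).
Proof.
move=> ab cd; apply/idP/eqP => [H|/det4_dependent].
  have := memv_pick (span2 c d :&: span2 a b)%VS.
  rewrite memv_cap; have := vpick0 (span2 c d :&: span2 a b)%VS.
  set v := vpick _ => v0 /andP[/mem_span2[x [y vE]] /mem_span2[z [w vE']]].
  apply/det4_dependent; exists z, w, (- x), (- y); split; last first.
    by rewrite -vE' -addrA !scaleNr -opprD -vE subrr.
  rewrite (negbTE H) in v0.
  have [z0|] := eqVneq z 0; last by constructor 1.
  have [w0|] := eqVneq w 0; last by constructor 2.
  by move: v0; rewrite vE' z0 w0 !scale0r addr0 eqxx.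
move=> [x [y [z [w [xyzw E]]]]].
have {}E : z *: c + w *: d = - (x *: a + y *: b).
  by apply/eqP; rewrite -addr_eq0 addrC addrA E.
apply/eqP => cap0.
have : z *: c + w *: d \in (span2 c d :&: span2 a b)%VS.
  rewrite memv_cap; apply/andP; split; first by apply/mem_span2; exists z, w.
  by rewrite E rpredN; apply/mem_span2; exists x, y.
rewrite cap0 memv0 => /eqP cd0; have [z0 w0] := cd _ _ cd0.
move/eqP: E; rewrite cd0 eq_sym oppr_eq0 => /eqP /ab[x0 y0].
by case: xyzw; rewrite ?x0 ?y0 ?z0 ?w0 eqxx.
Qed.

(** * Indices of inertia *)

Lemma pos_index_le_dim (R : realType) (V : vectType R) (Q : V -> R)
    (U : {vspace V}) : (pos_index Q U <= \dim U)%N.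
Proof. by apply/bigmax_leqP => i _; rewrite -ltnS ltn_ord. Qed.

Lemma leq_pos_index (R : realType) (V : vectType R) (Q : V -> R)
    (U W : {vspace V}) : (W <= U)%VS ->
  (forall x, x \in W -> x != 0 -> 0 < Q x) -> (\dim W <= pos_index Q U)%N.
Proof.
move=> WU WQ; have Wn : (\dim W < (\dim U).+1)%N by rewrite ltnS dimvS.
apply: (@bigop.leq_bigmax_cond _ _ (fun k : 'I__ => k : nat) (Ordinal Wn)).
by apply/asboolP; exists W.
Qed.

Lemma pos_index_attained (R : realType) (V : vectType R) (Q : V -> R)
    (U : {vspace V}) : exists W, [/\ (W <= U)%VS, \dim W = pos_index Q U &
  forall x, x \in W -> x != 0 -> 0 < Q x].
Proof.
pose P (k : 'I_(\dim U).+1) := `[< exists W, [/\ (W <= U)%VS, \dim W = k &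
           forall x, x \in W -> x != 0 -> 0 < Q x] >].
have P0 : P ord0.
  apply/asboolP; exists 0%VS; rewrite sub0v dimv0; split=> // x.
  by rewrite memv0 => ->.
have [k Pk] : {k | P k & pos_index Q U = k :> nat}.
  by rewrite /pos_index; apply: eq_bigmax_cond; apply/card_gt0P; exists ord0.
by move: Pk => /asboolP[W [WU Wk WQ]] E; exists W; rewrite E.
Qed.

Lemma pos_index_definite (R : realType) (V : vectType R) (Q : V -> R)
    (U : {vspace V}) : (forall x, x \in U -> x != 0 -> 0 < Q x) ->
  pos_index Q U = \dim U /\ neg_index Q U = 0%N.
Proof.
move=> UQ; split; first by apply/eqP; rewrite eqn_leq pos_index_le_dim leq_pos_index.
have [W [WU WE WQ]] := pos_index_attained (fun x => - Q x) U.
rewrite /neg_index -WE; apply/eqP; rewrite dimv_eq0; apply/eqP; apply/vspaceP => x; rewrite memv0.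
apply/idP/eqP => [xW|->]; last exact: mem0v.
apply/eqP/negP => x0; have := WQ _ xW (introN idP x0).
by rewrite oppr_gt0 ltNge (ltW (UQ _ (subvP WU _ xW) (introN idP x0))).
Qed.


Lemma exprz_signB (R : realType) (m n : nat) :
  (-1 : R) ^ (m%:Z - n%:Z) = (-1) ^+ (m + n).
Proof.
rewrite expfzDr ?oppr_eq0 ?oner_eq0// exprD; congr (_ * _).
by rewrite -exprnN invr_sign.
Qed.

Lemma form_sign_definite (R : realType) (V : vectType R) (Q : V -> R)
    (U : {vspace V}) : (forall x, x \in U -> x != 0 -> 0 < Q x) ->
  (-1 : R) ^ Defs.form_sign Q U = (-1) ^+ \dim U.
Proof.
by move=> /pos_index_definite[pE nE]; rewrite /Defs.form_sign exprz_signB pE nE addn0.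
Qed.

Lemma form_signN (R : realType) (V : vectType R) (Q : V -> R)
    (U : {vspace V}) : Defs.form_sign (fun x => - Q x) U = - Defs.form_sign Q U.
Proof.
rewrite /Defs.form_sign /neg_index opprB; congr (_ - (pos_index _ _)%:Z).
by apply/funext => x; rewrite opprK.
Qed.

(** A null vector x of a semidefinite form lies in its kernel: t -> Q(x + t y) is nonnegative
    without constant term, so its linear coefficient vanishes. Hence a nonsingular semidefinite form
    is definite. The bilinear map b may fail to be symmetric, since Q sees only b x y + b y x. *)
Lemma form_sign_semidefinite (R : realType) (V : vectType R) (b : V -> V -> R)
    (U : {vspace V}) :
  (forall x y z, b (x + y) z = b x z + b y z) ->
  (forall x y z, b z (x + y) = b z x + b z y) ->
  (forall k x y, b (k *: x) y = k * b x y) ->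
  (forall k x y, b y (k *: x) = k * b y x) ->
  nonsingular_form (fun x => b x x) U ->
  (forall x, x \in U -> 0 <= b x x) ->
  (-1 : R) ^ Defs.form_sign (fun x => b x x) U = (-1) ^+ \dim U.
Proof.
move=> bDl bDr bZl bZr bns b0; apply: form_sign_definite => x xU x0.
rewrite lt_def b0// andbT; apply: contra_neq x0 => bx; apply: bns => // y yU.
rewrite /polar_form !bDl !bDr bx add0r; set s := b x y + b y x.
rewrite (_ : _ - 0 - _ = s); last by rewrite /s; ring.
have H t : 0 <= t * s + t ^+ 2 * b y y.
  have := b0 (x + t *: y); rewrite rpredD// ?rpredZ// => /(_ isT).
  by rewrite !bDl !bDr bx !bZl !bZr /s; lra.
suff -> : s = 0 by rewrite mul0r.
apply/eqP/negP => /negP s0.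
(* The value at t = -s / (b y y + 1) is -s^2 / (b y y + 1)^2 < 0; adding 1 keeps the denominator
   positive when b y y = 0. *)
have q0 := b0 y yU; have q1 : 0 < b y y + 1 by lra.
have := H (- s / (b y y + 1)).
rewrite (_ : _ + _ = - (s ^+ 2) / (b y y + 1) ^+ 2); last by field; lra.
by rewrite mulNr oppr_ge0 leNgt divr_gt0 ?exprn_even_gt0//= ?s0 ?orbT ?gt_eqF.
Qed.

Lemma form_sign_parity (R : realType) (V : vectType R) (b : V -> V -> R)
    (U : {vspace V}) :
  (forall x y z, b (x + y) z = b x z + b y z) ->
  (forall x y z, b z (x + y) = b z x + b z y) ->
  (forall k x y, b (k *: x) y = k * b x y) ->
  (forall k x y, b y (k *: x) = k * b y x) ->
  nonsingular_form (fun x => b x x) U -> (\dim U <= 2)%N ->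
  (-1 : R) ^ Defs.form_sign (fun x => b x x) U = (-1) ^+ \dim U.
Proof.
move=> bDl bDr bZl bZr bns U2.
have [pU|/existsNP[y /not_implyP[yU /negP]]] :=
  pselect (forall x, x \in U -> 0 <= b x x).
  exact: form_sign_semidefinite.
rewrite -ltNge => y0.
have [nU|/existsNP[x /not_implyP[xU /negP]]] :=
  pselect (forall x, x \in U -> b x x <= 0).
  pose c x y := - b x y.
  have := @form_sign_semidefinite R V c U.
  have -> : (fun x => c x x) = (fun x => - b x x) by [].
  rewrite form_signN -exprz_inv invrN1; apply.
  - by move=> *; rewrite /c bDl opprD.
  - by move=> *; rewrite /c bDr opprD.
  - by move=> *; rewrite /c bZl mulrN.
  - by move=> *; rewrite /c bZr mulrN.
  - move=> z zU cz; apply: bns => // t tU; have := cz t tU.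
    by rewrite /polar_form /c; lra.
  - by move=> z zU; rewrite /c oppr_ge0 nU.
rewrite -ltNge => x0.
(* A vector with Q > 0 makes the index positive; a vector with Q < 0 prevents the whole space from
   being a positive subspace. *)
have half (Q : V -> R) z t : (forall k x, Q (k *: x) = k ^+ 2 * Q x) ->
    z \in U -> t \in U -> 0 < Q z -> Q t < 0 ->
    (0 < pos_index Q U < \dim U)%N.
  move=> QZ zU tU z0 t0.
  have Q0 : Q 0 = 0 by rewrite -[X in Q X](scale0r (0 : V)) QZ expr0n mul0r.
  apply/andP; split.
    apply: (@leq_trans (\dim <[z]>%VS)).
      rewrite dim_vline; case: eqVneq z0 => // ->.
      by rewrite Q0 ltxx.
    apply: leq_pos_index; first by rewrite -memvE.
    move=> _ /vlineP[k ->]; rewrite scaler_eq0 negb_or => /andP[k0 _].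
    by rewrite QZ mulr_gt0// exprn_even_gt0.
  rewrite ltn_neqAle pos_index_le_dim andbT; apply/negP => /eqP E.
  have [W [WU WE WQ]] := pos_index_attained Q U.
  have : W == U by rewrite eqEdim WU WE E leqnn.
  move=> /eqP WUE; have := WQ t; rewrite WUE => /(_ tU).
  case: eqVneq t0 => [->|_ t0 /(_ isT)]; last by rewrite ltNge (ltW t0).
  by rewrite Q0 ltxx.
have bQ k z : b (k *: z) (k *: z) = k ^+ 2 * b z z by rewrite bZl bZr; ring.
have /andP[p1 p2] := half (fun x => b x x) x y bQ xU yU x0 y0.
have /andP[n1 n2] : (0 < neg_index (fun x => b x x) U < \dim U)%N.
  apply: (half (fun x => - b x x) y x) => //; last 2 first.
  - by rewrite oppr_gt0.
  - by rewrite oppr_lt0.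
  by move=> k z; rewrite bQ mulrN.
have d2 : \dim U = 2%N by apply/eqP; rewrite eqn_leq U2 (leq_trans _ p2).
rewrite /Defs.form_sign exprz_signB.
have -> : pos_index (fun x => b x x) U = 1%N.
  by apply/eqP; rewrite eqn_leq p1 andbT -ltnS -d2.
have -> : neg_index (fun x => b x x) U = 1%N.
  by apply/eqP; rewrite eqn_leq n1 andbT -ltnS -d2.
by rewrite d2.
Qed.

(** * Sign changes *)

(** Applies to the supremum of the points of [a, b] where P holds. The hypothesis for limits from
    the left assumes P only at points accumulating at s, which is all that a supremum supplies. *)
Lemma real_induction (R : realType) (P : R -> Prop) (a b : R) : a <= b ->
  P a ->
  (forall s, a < s <= b ->
     (forall e, 0 < e -> exists t, [/\ s - e < t, t < s & P t]) -> P s) ->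
  (forall s, a <= s < b -> P s -> exists2 e, 0 < e &
     forall t, s < t < s + e -> P t) ->
  P b.
Proof.
move=> ab Pa Pl Pr.
pose E := [set t | a <= t <= b /\ P t].
have Ea : E a by split; rewrite ?lexx.
have Eub : ubound E b by move=> t [/andP[]].
have Esup : has_sup E by split; [exists a|exists b].
set s := sup E.
have ubs t : E t -> t <= s by apply: ub_le_sup; exists b.
have as_ : a <= s by exact: ubs.
have sb : s <= b by apply: ge_sup => //; exists a.
have Ps : P s.
  apply: contrapT => nPs; apply: (nPs); apply: Pl.
    rewrite sb andbT lt_neqAle as_ andbT; apply/eqP => as0.
    by apply: nPs; rewrite -as0.
  move=> e e0; have [t Et set_] := sup_adherent e0 Esup.
  exists t; split=> //; last by case: Et.
  by rewrite lt_neqAle (ubs _ Et) andbT; apply/eqP => ts; apply: nPs; rewrite -ts; case: Et.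
have [<-//|sb'] := eqVneq s b.
have sltb : s < b by rewrite lt_neqAle sb'.
have [|e e0 He] := Pr s _ Ps; first by rewrite as_.
have m0 : 0 < Num.min e (b - s) by rewrite lt_min e0 subr_gt0.
have me : Num.min e (b - s) <= e by rewrite ge_min lexx.
have mb : Num.min e (b - s) <= b - s by rewrite ge_min lexx orbT.
have : s + Num.min e (b - s) / 2 <= s.
  apply: ubs; split; first by apply/andP; split; lra.
  by apply: He; apply/andP; split; lra.
by rewrite gerDl; lra.
Qed.

(** Only the local behaviour of [beta] is assumed, not finiteness of Z. Finiteness of the part of Z
    to the left is carried along in the real induction, because splitting a crossing off the sum
    over a set requires it. *)
Lemma sign_crossing_count (R : realType) (beta : R -> R) (F : R -> int)
    (Z : set R) (a b : R) : a <= b ->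
  (forall z, z <= a -> 0 < beta z /\ ~ Z z) ->
  (forall s, a <= s <= b -> exists2 e, 0 < e & forall x y,
     s - e < x < s -> s < y < s + e ->
     [/\ ~ Z x, ~ Z y,
         Z s -> Num.sg (beta y) = (-1) ^ F s * Num.sg (beta x) &
         ~ Z s -> Num.sg (beta y) = Num.sg (beta x)]) ->
  exists2 e, 0 < e & forall x, b - e < x < b ->
    Num.sg (beta x) = (-1) ^ (\sum_(z \in [set z | z < b /\ Z z]) F z).
Proof.
move=> ab betaa loc.
pose Zl t := [set z | z < t /\ Z z].
pose P t := finite_set (Zl t) /\ exists2 e, 0 < e & forall x, t - e < x < t ->
    Num.sg (beta x) = (-1 : R) ^ (\sum_(z \in Zl t) F z).
suff [_] : P b by [].
apply: (real_induction ab).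
- have Z0 : Zl a = set0.
    by apply/seteqP; split=> // z [/ltW/betaa[]].
  rewrite /P Z0; split; first exact: finite_set0.
  exists 1 => // x /andP[_ /ltW/betaa[b0 _]].
  by rewrite fsbig_set0 gtr0_sg.
- move=> s /andP[as_ sb] near_s.
  have [|e e0 He] := loc s; first by rewrite ltW.
  have [t [set_ ts [tfin [e' e'0 He']]]] := near_s e e0.
  have ZE : Zl s = Zl t.
    apply/seteqP; split=> z [zs Zz]; split=> //; last exact: lt_trans ts.
    rewrite ltNge; apply/negP => tz.
    have zse : s - e < z < s by rewrite zs andbT; lra.
    have yse : s < s + e / 2 < s + e by apply/andP; split; lra.
    by have [] := He z _ zse yse.
  rewrite /P ZE; split=> //; exists e => // x xs.
  (* The point m lies both in the window to the left of t, where the count is known, and in the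
     window to the left of s. Comparing m and x with the same point to the right of s gives [beta]
     the same sign at both. *)
  pose m := Num.max (t - e' / 2) (t - (t - (s - e)) / 2).
  have mE : m < t by rewrite gt_max; apply/andP; split; lra.
  have m1 : t - e' < m by rewrite lt_max; apply/orP; left; lra.
  have m2 : s - e < m by rewrite lt_max; apply/orP; right; lra.
  rewrite -(He' m); last by rewrite m1 mE.
  have ys : s < s + e / 2 < s + e by apply/andP; split; lra.
  have ms : s - e < m < s by rewrite m2 (lt_trans mE).
  have [_ _ x1 x2] := He x _ xs ys.
  have [_ _ y1 y2] := He m _ ms ys.
  have [Zs|nZs] := pselect (Z s); last by rewrite -x2// y2.
  have := x1 Zs; rewrite (y1 Zs) => /mulfI-> //.
  by rewrite expfz_neq0// oppr_eq0 oner_eq0.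
- move=> s /andP[as_ sb] [sfin [e' e'0 He']].
  have [|e e0 He] := loc s; first by rewrite as_ ltW.
  exists e => // t tse.
  pose m := Num.max (s - e' / 2) (s - e / 2).
  have mE : m < s by rewrite gt_max; apply/andP; split; lra.
  have m1 : s - e' < m by rewrite lt_max; apply/orP; left; lra.
  have m2 : s - e < m by rewrite lt_max; apply/orP; right; lra.
  have ms : s - e < m < s by rewrite m2 mE.
  have Zt z : s < z < s + e -> ~ Z z by move=> zs; have [] := He m z ms zs.
  have [Zs|nZs] := pselect (Z s).
    have ZE : Zl t = Zl s `|` [set s].
      apply/seteqP; split=> z; last first.
        case=> [[zs Zz]|->]; split=> //; last by case/andP: tse.
        by apply: lt_trans zs _; case/andP: tse.
      move=> [zt Zz]; have [zs|sz|zs] := ltgtP z s; [by left| |by right].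
      exfalso; apply: Zt Zz; rewrite sz (lt_trans zt)//; by case/andP: tse.
    have dis : Zl s `&` [set s] `<=` set0.
      by move=> z [[zs _] zE]; move: zs; rewrite zE ltxx.
    rewrite /P ZE finite_setU; split.
      by split=> //; apply: finite_set1.
    exists (t - s); first by rewrite subr_gt0; case/andP: tse.
    move=> x; rewrite subKr => /andP[sx xt].
    have xs : s < x < s + e by rewrite sx (lt_trans xt)//; case/andP: tse.
    have [_ _ /(_ Zs) -> _] := He m x ms xs.
    rewrite (He' m) ?m1// fsbigU0//=.
    by rewrite fsbig_set1 expfzDr ?oppr_eq0 ?oner_eq0// mulrC.
  have ZE : Zl t = Zl s.
    apply/seteqP; split=> z [zt Zz]; split=> //; last first.
      by apply: lt_trans zt _; case/andP: tse.
    have [//|sz|zs] := ltgtP z s; last by case: nZs; rewrite -zs.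
    exfalso; apply: Zt Zz; rewrite sz (lt_trans zt)//; by case/andP: tse.
  rewrite /P ZE; split=> //.
  exists (t - s); first by rewrite subr_gt0; case/andP: tse.
  move=> x; rewrite subKr => /andP[sx xt].
  have xs : s < x < s + e by rewrite sx (lt_trans xt)//; case/andP: tse.
  have [_ _ _ /(_ nZs) ->] := He m x ms xs.
  by rewrite (He' m) ?m1.
Qed.

(** Near s the function behaves like C (z - s)^d, so the parity of d decides whether the sign
    changes. The exponent d = 0 covers the points that are not crossings. *)
Lemma sg_near_zero (R : realType) (beta : R -> R) (s C : R) (d : nat) :
  C != 0 -> beta z / (z - s) ^+ d @[z --> s^'] --> C ->
  exists2 e, 0 < e & forall x y, s - e < x < s -> s < y < s + e ->
    [/\ beta x != 0, beta y != 0, Num.sg (beta y) = Num.sg C &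
        Num.sg (beta x) = (-1) ^+ d * Num.sg C].
Proof.
move=> C0 betaC.
have sgE : \forall z \near s^', Num.sg (beta z / (z - s) ^+ d) = Num.sg C.
  have [C1|C1] := ltrP 0 C.
    near=> z; rewrite (gtr0_sg C1) gtr0_sg//.
    near: z; exact: cvgr_gt betaC _ C1.
  have {}C1 : C < 0 by rewrite lt_neqAle C0.
  near=> z; rewrite (ltr0_sg C1) ltr0_sg//.
  near: z; exact: cvgr_lt betaC _ C1.
have [e e0 He] : exists2 e, 0 < e & forall z, `|z - s| < e -> z != s ->
    Num.sg (beta z / (z - s) ^+ d) = Num.sg C.
  move: sgE => /nbhs_ballP[e e0 He]; exists e => // z zs zns.
  by apply: He => //; rewrite /ball/= distrC.
exists e => // x y /andP[x1 x2] /andP[y1 y2].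
have {He}sgb z : `|z - s| < e -> z != s ->
    Num.sg (beta z) = Num.sg (z - s) ^+ d * Num.sg C.
  move=> zs zns; rewrite -(He z)// sgrM sgrV sgrX mulrCA -exprMn.
  by rewrite -expr2 sqr_sg subr_eq0 zns expr1n mulr1.
have sgx : Num.sg (beta x) = (-1) ^+ d * Num.sg C.
  rewrite sgb; last by rewrite lt_eqF.
    by rewrite ltr0_sg// subr_lt0.
  by rewrite ltr_norml; apply/andP; split; lra.
have sgy : Num.sg (beta y) = Num.sg C.
  rewrite sgb; last by rewrite gt_eqF.
    by rewrite gtr0_sg ?subr_gt0// expr1n mul1r.
  by rewrite ltr_norml; apply/andP; split; lra.
split=> //; rewrite -sgr_eq0 ?sgx ?sgy ?mulf_eq0 ?sgr_eq0 ?(negbTE C0)//.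
by rewrite signr_eq0.
Unshelve. all: by end_near. Qed.

(** * Weighted estimates on a half line *)

(** The entrywise sum norm. Unlike the maximum norm it is submultiplicative with constant 1, which
    keeps dimension factors out of most estimates. *)
Definition l1 (R : realType) m n (M : 'M[R]_(m, n)) : R :=
  \sum_i \sum_j `|M i j|.

Lemma l1_ge0 (R : realType) m n (M : 'M[R]_(m, n)) : 0 <= l1 M.
Proof. by apply: sumr_ge0 => i _; apply: sumr_ge0 => j _. Qed.

Lemma l1D (R : realType) m n (M N : 'M[R]_(m, n)) : l1 (M + N) <= l1 M + l1 N.
Proof.
rewrite /l1 -big_split; apply: ler_sum => i _; rewrite -big_split.
by apply: ler_sum => j _; rewrite mxE ler_normD.
Qed.

Lemma l1Z (R : realType) m n k (M : 'M[R]_(m, n)) : l1 (k *: M) = `|k| * l1 M.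
Proof.
rewrite /l1 mulr_sumr; apply: eq_bigr => i _; rewrite mulr_sumr.
by apply: eq_bigr => j _; rewrite mxE normrM.
Qed.

Lemma l1N (R : realType) m n (M : 'M[R]_(m, n)) : l1 (- M) = l1 M.
Proof. by rewrite -scaleN1r l1Z normrN1 mul1r. Qed.

Lemma ler_l1 (R : realType) m n (M : 'M[R]_(m, n)) i j : `|M i j| <= l1 M.
Proof.
rewrite /l1 (bigD1 i)//= (bigD1 j)//= -addrA lerDl addr_ge0 ?sumr_ge0//.
by move=> k _; apply: sumr_ge0.
Qed.

Lemma l1M (R : realType) m n p (M : 'M[R]_(m, n)) (N : 'M[R]_(n, p)) :
  l1 (M *m N) <= l1 M * l1 N.
Proof.
have H i : \sum_k `|(M *m N) i k| <= (\sum_j `|M i j|) * l1 N.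
  apply: (@le_trans _ _ (\sum_k \sum_j `|M i j| * `|N j k|)).
    apply: ler_sum => k _; rewrite mxE (le_trans (ler_norm_sum _ _ _))//.
    by apply: ler_sum => j _; rewrite normrM.
  rewrite exchange_big mulr_suml; apply: ler_sum => j _; rewrite -mulr_sumr.
  rewrite ler_wpM2l// /l1 (bigD1 j)//= lerDl sumr_ge0// => k _.
  exact: sumr_ge0.
by rewrite {1}/l1 (le_trans (ler_sum _ (fun i _ => H i)))// -mulr_suml.
Qed.

Lemma l1_col (R : realType) n (v : 'cV[R]_n) : l1 v = \sum_i `|v i 0|.
Proof. by apply: eq_bigr => i _; rewrite big_ord1. Qed.

(** Cauchy-Schwarz against the constant vector, obtained from |y_i| |y_j| <= (y_i^2 + y_j^2) / 2. *)
Lemma sum_norm_sqr_le (R : realType) n (y : 'I_n -> R) :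
  (\sum_i `|y i|) ^+ 2 <= n%:R * \sum_i y i ^+ 2.
Proof.
have H : \sum_i \sum_j `|y i| * `|y j| <= \sum_i \sum_j ((y i ^+ 2 + y j ^+ 2) / 2).
  apply: ler_sum => i _; apply: ler_sum => j _.
  rewrite -(real_normK (num_real (y i))) -(real_normK (num_real (y j))).
  rewrite -subr_ge0; have := sqr_ge0 (`|y i| - `|y j|); lra.
rewrite expr2 big_distrlr /= (le_trans H)//.
set S := \sum_i y i ^+ 2.
have -> : \sum_i \sum_j ((y i ^+ 2 + y j ^+ 2) / 2) =
    \sum_i (n%:R / 2 * y i ^+ 2 + S / 2).
  apply: eq_bigr => i _; rewrite -mulr_suml big_split /= sumr_const card_ord.
  by rewrite -mulr_natl -/S; lra.
rewrite big_split /= -mulr_sumr sumr_const card_ord -/S -mulr_natl; lra.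
Qed.

Lemma sum_sqr_le_norm (R : realType) n (y : 'I_n -> R) :
  \sum_i y i ^+ 2 <= (\sum_i `|y i|) ^+ 2.
Proof.
rewrite expr2 mulr_suml; apply: ler_sum => i _.
rewrite -(real_normK (num_real (y i))) expr2 ler_wpM2l// (bigD1 i)//= lerDl.
exact: sumr_ge0.
Qed.

Lemma cvg_expM_ninfty (R : realType) (k : R) : 0 < k ->
  expR (k * z) @[z --> -oo] --> (0 : R).
Proof.
move=> k0; apply/cvgrPdist_lt => e e0; near=> z.
rewrite sub0r normrN ger0_norm ?expR_ge0// -[ltRHS]lnK// ltr_expR.
rewrite -ltr_pdivlMl//; near: z; exact: (nbhs_ninfty_lt (num_real _)).
Unshelve. all: by end_near. Qed.

Lemma cvg_exp_bounded_ninfty (R : realType) (k M : R) (f : R -> R) : 0 < k ->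
  (forall z, z <= 0 -> `|f z| <= M * expR (k * z)) ->
  f z @[z --> -oo] --> (0 : R).
Proof.
move=> k0 fM; apply/cvgr0Pnorm_lt => e e0.
have M0 : 0 < `|M| + 1 by rewrite ltr_pwDr.
have := cvg_expM_ninfty k0 => /cvgr0Pnorm_lt /(_ (e / (`|M| + 1))).
rewrite divr_gt0// => /(_ isT) H; near=> z.
have z0 : z <= 0 by near: z; exact: (nbhs_ninfty_le (num_real _)).
rewrite (le_lt_trans (fM _ z0))//.
have : `|expR (k * z)| < e / (`|M| + 1) by near: z.
rewrite ger0_norm ?expR_ge0// ltr_pdivlMr// => H'.
apply: le_lt_trans H'; rewrite mulrC ler_wpM2l ?expR_ge0//.
by rewrite (le_trans (ler_norm _))// lerDl.
Unshelve. all: by end_near. Qed.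

(** Used with w = 1 / mu for the derivative of the indefinite form and with w = 1 for that of sums
    of squares. *)
Lemma sum_weighted_le (R : realType) n (w y e : 'I_n -> R) (m r : R) :
  (forall i, `|w i| <= m) -> (forall i, `|e i| <= r) ->
  `|\sum_i w i * (y i * e i)| <= m * (r * \sum_i `|y i|).
Proof.
move=> wm er; rewrite (le_trans (ler_norm_sum _ _ _))// !mulr_sumr.
apply: ler_sum => i _; rewrite !normrM [`|y i| * _]mulrC.
by rewrite ler_pM// ?mulr_ge0// ler_wpM2r.
Qed.

(* The weight is exp(k z) sum_i y_i^2 / mu_i, corrected on the bounded interval
   [-T, 0], where the system is not close to its limit, by a large multiple of
   the rapidly growing exp(l z) (sum_i y_i^2 + D^2). *)
Lemma hyperbolic_weight (R : realType) n (mu : 'I_n -> R) :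
  (forall i, mu i != 0) -> exists2 eta : R, 0 < eta & forall K T k0 : R,
  0 <= K -> 0 <= T -> 0 < k0 -> exists k C : R, [/\ 0 < k, k <= k0, 0 <= C &
  forall (y e : 'I_n -> R -> R) (D : R),
    (forall z : R, z <= 0 -> forall i,
       is_derive z 1 (y i) (mu i * y i z + e i z)) ->
    (forall z : R, z <= 0 -> forall i,
       `|e i z| <= K * (\sum_j `|y j z|) + K * `|D|) ->
    (forall z : R, z <= - T -> forall i,
       `|e i z| <= eta * (\sum_j `|y j z|) + K * `|D|) ->
    (exists B : R, forall z : R, z <= 0 -> \sum_j `|y j z| <= B) ->
    exists E dE : R -> R, [/\
      forall z : R, z <= 0 -> is_derive z 1 E (dE z),
      forall z : R, z <= 0 -> expR (k * z) * (\sum_j y j z ^+ 2) <= dE z,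
      E z @[z --> -oo%R] --> (0 : R) &
      E 0 <= C * (\sum_j y j 0 ^+ 2 + D ^+ 2)]].
Proof.
move=> mu0.
pose m : R := \sum_i `|(mu i)^-1|.
have m_ge i : `|(mu i)^-1| <= m by rewrite /m (bigD1 i)//= lerDl sumr_ge0.
have m0 : 0 <= m by exact: sumr_ge0.
pose M : R := \sum_i `|mu i|.
have M_ge i : `|mu i| <= M by rewrite /M (bigD1 i)//= lerDl sumr_ge0.
have M0 : 0 <= M by exact: sumr_ge0.
pose N : R := n.+1%:R.
have N0 : 0 < N by rewrite ltr0n.
(* Let S be the sum of squares and W the indefinite form. For z <= -T the term 2 S in the derivative
   of W has to outweigh three losses: S/4 from k W, S/4 from the part of e that is linear in y, for
   which eta is chosen, and S/2 from the cross term with D. What remains is S. *)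
pose eta : R := (8 * ((m + 1) * N))^-1.
have den0 : 0 < 8 * ((m + 1) * N) by rewrite !mulr_gt0// ltr_pwDr.
have eta0 : 0 < eta by rewrite invr_gt0.
have etaE : 2 * (m * (eta * N)) <= 1 / 4.
  have : eta * (8 * ((m + 1) * N)) = 1 by rewrite mulVf// gt_eqF.
  have := mulr_gt0 eta0 N0; lra.
exists eta => // K T k0 K0 T0 k00.
pose k : R := Num.min k0 (4 * (m + 1))^-1.
have m4 : 0 < 4 * (m + 1) by rewrite mulr_gt0// ltr_pwDr.
have kpos : 0 < k by rewrite lt_min k00 invr_gt0.
have kk0 : k <= k0 by rewrite ge_min lexx.
have km : k * m <= 1 / 4.
  have k4 : k <= (4 * (m + 1))^-1 by rewrite ge_min lexx orbT.
  have := ler_wpM2r (ltW m4) k4; rewrite mulVf ?gt_eqF// => H; lra.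
(* C1 comes from completing the square in the cross term of D with y; C2 measures the loss on
   [-T, 0], where only the bound K is available. *)
pose C1 : R := 2 * N * (m * K) ^+ 2.
pose C2 : R := 2 * (m * (K * N)).
have C10 : 0 <= C1 by rewrite !mulr_ge0 ?sqr_ge0// ltW.
have C20 : 0 <= C2 by rewrite !mulr_ge0// ltW.
(* The rate lam gives exp(lam z) (S + D^2) a derivative at least as large as itself, and G makes G
   times this derivative exceed (C2 + 1) (S + D^2) on [-T, 0]. *)
pose lam : R := 2 * M * N + 3 * K * N + K + 1.
have lam0 : 0 < lam by rewrite ltr_pwDr// !addr_ge0 ?mulr_ge0// ltW.
pose G : R := (C2 + 1) * expR (lam * T).
have G0 : 0 <= G by rewrite mulr_ge0 ?expR_ge0// addr_ge0.
exists k, (m + G + C1 / k); split=> //.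
  by rewrite !addr_ge0// divr_ge0// ltW.
move=> y e D dy eK eeta [B yB].
pose s (z : R) : R := \sum_j `|y j z|.
pose S (z : R) : R := \sum_j y j z ^+ 2.
pose W (z : R) : R := \sum_j (mu j)^-1 * y j z ^+ 2.
have s0 (z : R) : 0 <= s z by exact: sumr_ge0.
have S0 (z : R) : 0 <= S z by apply: sumr_ge0 => j _; exact: sqr_ge0.
have sS (z : R) : s z ^+ 2 <= N * S z.
  apply: le_trans (sum_norm_sqr_le (fun i => y i z)) _.
  by rewrite ler_wpM2r ?S0// ler_nat.
have Ss (z : R) : S z <= s z ^+ 2 by exact: sum_sqr_le_norm (fun i => y i z).
have Wm (z : R) : `|W z| <= m * S z.
  rewrite (le_trans (ler_norm_sum _ _ _))// mulr_sumr; apply: ler_sum => i _.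
  by rewrite normrM (ger0_norm (sqr_ge0 _)) ler_wpM2r ?sqr_ge0.
have dyy (z : R) i : z <= 0 -> is_derive z 1 (fun x => y i x ^+ 2)
    (2 * (y i z * (mu i * y i z + e i z))).
  move=> z0; apply: is_derive_eq (is_deriveM_fun (dy z z0 i) (dy z z0 i)) _.
  by ring.
pose P (z : R) : R := \sum_i (mu i)^-1 * (y i z * e i z).
pose dW (z : R) : R := 2 * S z + 2 * P z.
have dWE (z : R) : z <= 0 -> is_derive z 1 W (dW z).
  move=> z0; apply: is_derive_eq.
    by apply: is_derive_sum_fun => i; apply: is_deriveZ_fun (dyy z i z0).
  rewrite /dW /S /P !mulr_sumr -big_split /=; apply: eq_bigr => i _.
  by field; exact: mu0.
pose Q (z : R) : R := \sum_i (mu i * y i z ^+ 2 + 1 * (y i z * e i z)).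
have dSE (z : R) : z <= 0 -> is_derive z 1 S (2 * Q z).
  move=> z0; apply: is_derive_eq.
    by apply: is_derive_sum_fun => i; exact: (dyy z i z0).
  by rewrite /Q mulr_sumr; apply: eq_bigr => i _; ring.
have Ple (z : R) h : 0 <= h -> (forall i, `|e i z| <= h * s z + K * `|D|) ->
    - (2 * (m * (h * N)) * S z + S z / 2 + C1 * D ^+ 2) <= 2 * P z.
  move=> h0 eh.
  have := sum_weighted_le (w := fun i => (mu i)^-1)
     (e := fun i => e i z) (fun i => y i z) m_ge eh.
  rewrite -/(P z) -/(s z) => PH.
  have PH' : - P z <= m * ((h * s z + K * `|D|) * s z).
    by rewrite (le_trans _ PH)// -normrN ler_norm.
  have H1 : m * h * s z ^+ 2 <= m * h * (N * S z).
    by rewrite ler_wpM2l// mulr_ge0.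
  have H2 : 2 * (m * K * `|D|) * s z <= S z / 2 + C1 * D ^+ 2.
    have q1 := sqr_ge0 (s z - 2 * N * (m * K * `|D|)).
    have q2 : `|D| ^+ 2 = D ^+ 2 by rewrite real_normK ?num_real.
    have q3 : 2 * N * (2 * (m * K * `|D|) * s z) <=
        2 * N * (S z / 2 + C1 * D ^+ 2).
      by rewrite /C1 -q2; have := sS z; move: q1; clear; lra.
    by rewrite ler_pM2l in q3; [exact: q3|rewrite mulr_gt0].
  by move: PH' H1 H2; clear; lra.
have Qle (z : R) : z <= 0 -> - (lam - 1) * (S z + D ^+ 2) <= 2 * Q z.
  move=> z0; rewrite /Q big_split /=.
  have := sum_weighted_le (w := fun=> 1)
     (e := fun i => e i z) (m := 1) (fun i => y i z)
     (fun=> ltac:(by rewrite normr1)) (eK z z0).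
  set p := \sum_i 1 * _; rewrite -/(s z) mul1r => pH.
  have p1 : - p <= (K * s z + K * `|D|) * s z.
    by rewrite (le_trans _ pH)// -normrN ler_norm.
  have q1 : - (M * S z) <= \sum_i mu i * y i z ^+ 2.
    rewrite lerNl -sumrN mulr_sumr; apply: ler_sum => i _.
    rewrite -mulNr ler_wpM2r ?sqr_ge0//.
    by rewrite (le_trans _ (M_ge i))// -normrN ler_norm.
  have q2 : `|D| ^+ 2 = D ^+ 2 by rewrite real_normK ?num_real.
  have q3 := ler_wpM2l K0 (sS z).
  have q4 := ler_wpM2l K0 (sqr_ge0 (s z - `|D|)).
  have q5 : M * S z <= M * N * S z.
    by rewrite -mulrA ler_wpM2l// ler_peMl// ler1n.
  have q6 : 0 <= (2 * M * N + 3 * K * N) * D ^+ 2.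
    by rewrite mulr_ge0 ?sqr_ge0// addr_ge0// !mulr_ge0// ltW.
  have q7 : 0 <= K * S z by rewrite mulr_ge0.
  have q8 : 0 <= K * N * S z by rewrite !mulr_ge0// ltW.
  move: p1 q1 q3 q4 q5 q6 q7 q8; rewrite /lam -q2; clear; lra.
(* The last term is there for its derivative C1 D^2 exp(k z), which pays for the cross term with
   D. *)
pose E (z : R) : R := expR (k * z) * W z + G * (expR (lam * z) * (S z + D ^+ 2))
            + C1 / k * D ^+ 2 * expR (k * z).
pose dE (z : R) : R := (k * expR (k * z)) * W z + expR (k * z) * dW z
   + G * ((lam * expR (lam * z)) * (S z + D ^+ 2) + expR (lam * z) * (2 * Q z + 0))
   + C1 / k * D ^+ 2 * (k * expR (k * z)).
exists E, dE; split.
- move=> z z0; apply: is_deriveD_fun; first apply: is_deriveD_fun.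
  + by apply: is_deriveM_fun (is_derive_expM _ _) (dWE _ z0).
  + apply: is_deriveZ_fun; apply: is_deriveM_fun (is_derive_expM _ _) _.
    exact: is_deriveD_fun (dSE _ z0) (is_derive_cst _ _ _).
  + by apply: is_deriveZ_fun; exact: is_derive_expM.
- move=> z z0; rewrite -/(S z) /dE.
  set x := expR (k * z); set X := expR (lam * z).
  have x0 : 0 <= x by exact: expR_ge0.
  have X0 : 0 <= X by exact: expR_ge0.
  have t1 : X * (S z + D ^+ 2) <=
     lam * X * (S z + D ^+ 2) + X * (2 * Q z + 0).
    by have := ler_wpM2l X0 (Qle z z0); clear; lra.
  have t2 : - (1 / 4 * S z) <= k * W z.
    rewrite lerNl (le_trans (ler_norm _))// normrN normrM (gtr0_norm kpos).
    rewrite (le_trans (ler_wpM2l (ltW kpos) (Wm z)))// mulrA.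
    by rewrite ler_wpM2r.
  have t3 : C1 / k * D ^+ 2 * (k * x) = x * (C1 * D ^+ 2).
    by field; rewrite gt_eqF.
  rewrite t3.
  have t4 := ler_wpM2l G0 t1.
  have t5 := ler_wpM2l x0 t2.
  have t6 : 0 <= G * (X * (S z + D ^+ 2)).
    by rewrite !mulr_ge0// addr_ge0 ?sqr_ge0.
  have [zT|zT] := lerP z (- T).
    have := Ple z eta (ltW eta0) (eeta z zT).
    have := ler_wpM2r (S0 z) etaE => t7 t8.
    have t9 : - (3 / 4 * S z + C1 * D ^+ 2) <= 2 * P z.
      by move: t7 t8; clear; lra.
    have := ler_wpM2l x0 t9; move: t4 t5 t6; rewrite /dW; clear; lra.
  have := Ple z K K0 (eK z z0); rewrite -/C2 => /(ler_wpM2l x0) t7.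
  have x1 : x <= 1 by rewrite -expR0 ler_expR pmulr_rle0.
  have t8 : (C2 + 1) * (S z + D ^+ 2) <= G * (X * (S z + D ^+ 2)).
    rewrite /G -mulrA ler_wpM2l ?addr_ge0// mulrA -expRD -mulrDr.
    rewrite ler_peMl ?addr_ge0 ?sqr_ge0// -expR0 ler_expR mulr_ge0 ?ltW//.
    by move: zT; clear; lra.
  have t9 : x * (C2 * S z) <= C2 * S z by rewrite ler_piMl// mulr_ge0.
  have t10 : 0 <= C2 * D ^+ 2 by rewrite mulr_ge0 ?sqr_ge0.
  have t11 := sqr_ge0 D.
  have t12 : 0 <= x * S z by rewrite mulr_ge0.
  have t13 := S0 z.
  move: t4 t5 t7 t8 t9 t10 t11 t12 t13; rewrite /dW; clear; lra.
- have B0 : 0 <= B by rewrite (le_trans (s0 0))// yB.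
  have SB (z : R) : z <= 0 -> S z <= B ^+ 2.
    move=> z0; rewrite (le_trans (Ss z))// ler_sqr ?nnegrE ?yB//.
  rewrite (_ : 0 = 0 + 0 + 0); last by rewrite !addr0.
  apply: cvgD; first apply: cvgD.
  + apply: (cvg_exp_bounded_ninfty kpos (M := m * B ^+ 2)) => z z0.
    rewrite normrM ger0_norm ?expR_ge0// mulrC ler_wpM2r ?expR_ge0//.
    by rewrite (le_trans (Wm z))// ler_wpM2l// SB.
  + apply: (cvg_exp_bounded_ninfty lam0 (M := G * (B ^+ 2 + D ^+ 2))) => z z0.
    rewrite ger0_norm; last first.
      by rewrite mulr_ge0// mulr_ge0 ?expR_ge0// addr_ge0 ?sqr_ge0.
    rewrite -mulrA ler_wpM2l// mulrC ler_wpM2r ?expR_ge0// lerD2r SB//.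
  + apply: (cvg_exp_bounded_ninfty kpos (M := C1 / k * D ^+ 2)) => z z0.
    rewrite ger0_norm// mulr_ge0 ?expR_ge0// mulr_ge0 ?sqr_ge0// divr_ge0//.
    exact: ltW.
- rewrite /E !mulr0 expR0 !mul1r mulr1 -/(S 0).
  have w0 : W 0 <= m * S 0 by rewrite (le_trans (ler_norm _)).
  have w1 : 0 <= C1 / k * S 0 by rewrite mulr_ge0// divr_ge0// ltW.
  have w2 : 0 <= m * D ^+ 2 by rewrite mulr_ge0 ?sqr_ge0.
  by lra.
Qed.

(* Y stands for a difference quotient of orbits, D for the quotient of their
   speeds, and - r for the derivative of the field in the speed. *)
Definition approx_solution (R : realType) (A : R -> 'M[R]_4) (r : R -> 'cV[R]_4)
    (eps : R) (Y N : R -> 'cV[R]_4) (D : R) : Prop :=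
  [/\ forall z : R, z <= 0 -> forall i, is_derive z 1 (fun x => Y x i 0)
        ((A z *m Y z + N z - D *: r z) i 0),
      forall z : R, z <= 0 -> l1 (N z) <= eps * l1 (Y z) &
      exists B : R, forall z : R, z <= 0 -> l1 (Y z) <= B].

(** E is an antiderivative of a majorant of exp(k z) |Y|^2, so E(0) bounds its integral over the
    half line. The constants are fixed before Y; the bound of Y in [approx_solution] makes E tend to
    0 at -oo but does not enter the estimate of E(0). *)
Definition has_weight (R : realType) (A : R -> 'M[R]_4) (r : R -> 'cV[R]_4)
    (k0 : R) : Prop :=
  exists k C e0 : R, [/\ 0 < k, k <= k0, 0 <= C, 0 < e0 &
  forall eps Y N D, eps <= e0 -> approx_solution A r eps Y N D ->
    exists E dE : R -> R, [/\
      forall z : R, z <= 0 -> is_derive z 1 E (dE z),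
      forall z : R, z <= 0 -> expR (k * z) * l1 (Y z) ^+ 2 <= dE z,
      E z @[z --> -oo%R] --> (0 : R) &
      E 0 <= C * (l1 (Y 0) ^+ 2 + D ^+ 2)]].

(** In the eigencoordinates Q Y the limit matrix is diagonal, and the contributions of A - Ai, N and
    D r together form the error term of [hyperbolic_weight]. *)
Lemma approx_solution_weight (R : realType) (A : R -> 'M[R]_4)
    (r : R -> 'cV[R]_4) (Ai P Q : 'M[R]_4) (mu : 'rV[R]_4) (K k0 : R) :
  P *m Q = 1%:M -> Q *m Ai = diag_mx mu *m Q -> (forall i, mu 0 i != 0) ->
  (forall z, z <= 0 -> l1 (A z - Ai) <= K) ->
  (forall eta, 0 < eta ->
     exists2 T, 0 <= T & forall z, z <= - T -> l1 (A z - Ai) <= eta) ->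
  (forall z, z <= 0 -> l1 (r z) <= K) -> 0 < k0 ->
  has_weight A r k0.
Proof.
move=> PQ QA mu0 AK Aeta rK k00.
have K0 : 0 <= K by rewrite (le_trans (l1_ge0 (r 0)))// rK.
have [eta eta0 weight] := hyperbolic_weight mu0.
pose p : R := l1 P; pose q : R := l1 Q.
have p0 : 0 <= p := l1_ge0 P; have q0 : 0 <= q := l1_ge0 Q.
have qp0 : 0 < 2 * (q * p + 1) by rewrite mulr_gt0// ltr_pwDr// mulr_ge0.
(* Half of the allowed error goes to A - Ai for z <= -T and half to N, each bounded by h |Y|; q and
   p account for the changes of coordinates. *)
pose h : R := eta / (2 * (q * p + 1)).
have h0 : 0 < h by rewrite divr_gt0.
have hE : q * ((h + h) * p) <= eta.
  have : h * (2 * (q * p + 1)) = eta by rewrite divfK// gt_eqF.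
  by have := h0; lra.
have [T T0 AT] := Aeta h h0.
pose K' : R := q * ((K + h) * p) + q * K.
have K'0 : 0 <= K' by rewrite addr_ge0// !mulr_ge0// addr_ge0// ltW.
have [k [C [kpos kk0 C0 H]]] := weight K' T k0 K'0 T0 k00.
(* From |Y|^2 <= p^2 (sum_j |y_j|)^2 <= 4 p^2 sum_j y_j^2. *)
pose c : R := 4 * p ^+ 2.
have c0 : 0 <= c by rewrite mulr_ge0// sqr_ge0.
exists k, (c * (C * (q ^+ 2 + 1))), h; split=> //.
  by rewrite !mulr_ge0// addr_ge0// sqr_ge0.
move=> eps Y N D epsh [dY NY [B YB]].
pose y i z := (Q *m Y z) i 0.
pose e i z := (Q *m ((A z - Ai) *m Y z + N z - D *: r z)) i 0.
have Yy z : l1 (Y z) <= p * \sum_j `|y j z|.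
  by rewrite -[Y z]mul1mx -PQ -mulmxA -l1_col; exact: l1M.
have yY z : \sum_j `|y j z| <= q * l1 (Y z) by rewrite -l1_col; exact: l1M.
have eE z a : z <= 0 -> l1 (A z - Ai) <= a -> forall i,
    `|e i z| <= q * ((a + h) * p) * (\sum_j `|y j z|) + q * K * `|D|.
  move=> z0 Aa i; rewrite (le_trans (ler_l1 _ i 0))// (le_trans (l1M _ _))//.
  have a0 : 0 <= a by rewrite (le_trans (l1_ge0 _) Aa).
  rewrite -/q -!mulrA -mulrDr ler_wpM2l//.
  have t1 : l1 ((A z - Ai) *m Y z) <= a * l1 (Y z).
    by rewrite (le_trans (l1M _ _))// ler_wpM2r ?l1_ge0.
  have t2 : l1 (N z) <= h * l1 (Y z).
    by rewrite (le_trans (NY z z0))// ler_wpM2r ?l1_ge0.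
  have t3 : l1 (- (D *: r z)) <= K * `|D|.
    by rewrite l1N l1Z mulrC ler_wpM2r// rK.
  have t4 := l1D ((A z - Ai) *m Y z + N z) (- (D *: r z)).
  have t5 := l1D ((A z - Ai) *m Y z) (N z).
  have t6 : (a + h) * l1 (Y z) <= (a + h) * (p * \sum_j `|y j z|).
    by rewrite ler_wpM2l ?Yy// addr_ge0// ltW.
  by lra.
have [||||E [dE [dEE dEge E0 EC]]] := H y e D.
- move=> z z0 i.
  have -> : mu 0 i * y i z + e i z =
      \sum_j Q i j * (A z *m Y z + N z - D *: r z) j 0.
    have <- : (Q *m (A z *m Y z + N z - D *: r z)) i 0 =
      \sum_j Q i j * (A z *m Y z + N z - D *: r z) j 0 by rewrite mxE.
    have -> : A z *m Y z + N z - D *: r z =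
        Ai *m Y z + ((A z - Ai) *m Y z + N z - D *: r z).
      by rewrite mulmxBl !addrA [Ai *m _ + _]addrC addrK.
    rewrite mulmxDr mulmxA QA -mulmxA mul_diag_mx [RHS]mxE; congr (_ + _).
    by rewrite mxE.
  have -> : y i = (fun x => \sum_j Q i j * Y x j 0).
    by apply/funext => x; rewrite /y mxE.
  by apply: is_derive_sum_fun => j; apply: is_deriveZ_fun; exact: dY.
- move=> z z0 i; rewrite (le_trans (eE z K z0 (AK z z0) i))// /K' lerD//.
    rewrite ler_wpM2r ?sumr_ge0// lerDl mulr_ge0//.
  by rewrite ler_wpM2r// lerDr !mulr_ge0// addr_ge0// ltW.
- move=> z zT i.
  have z0 : z <= 0 by rewrite (le_trans zT)// oppr_le0.
  rewrite (le_trans (eE z h z0 (AT z zT) i))// /K' lerD//.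
    by rewrite ler_wpM2r ?sumr_ge0.
  by rewrite ler_wpM2r// lerDr !mulr_ge0// addr_ge0// ltW.
- exists (q * B) => z z0; rewrite (le_trans (yY z))// ler_wpM2l// YB//.
exists (fun z => c * E z), (fun z => c * dE z); split.
- by move=> z z0; apply: is_deriveZ_fun; exact: dEE.
- move=> z z0; rewrite (le_trans _ (ler_wpM2l c0 (dEge z z0)))//.
  rewrite [leRHS]mulrCA ler_wpM2l ?expR_ge0// /c -mulrA [leRHS]mulrCA.
  have := sum_norm_sqr_le (fun j => y j z) => t.
  apply: (@le_trans _ _ (p ^+ 2 * (\sum_j `|y j z|) ^+ 2)).
    rewrite -exprMn ler_sqr ?nnegrE ?l1_ge0 ?Yy//.
    by rewrite mulr_ge0// sumr_ge0.
  by rewrite ler_wpM2l// sqr_ge0.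
- have -> : (0 : R) = c * 0 by rewrite mulr0.
  by apply: cvgM => //; exact: cvg_cst.
- rewrite -mulrA ler_wpM2l// (le_trans EC)// -mulrA ler_wpM2l//.
  have t1 : \sum_j y j 0 ^+ 2 <= q ^+ 2 * l1 (Y 0) ^+ 2.
    rewrite (le_trans (sum_sqr_le_norm (fun j => y j 0)))// -exprMn.
    by rewrite ler_sqr ?nnegrE ?sumr_ge0 ?mulr_ge0 ?l1_ge0.
  have t2 := mulr_ge0 (sqr_ge0 q) (sqr_ge0 D).
  by have := sqr_ge0 (l1 (Y 0)); lra.
Qed.

(** A weak form of the statement that a bounded solution of the variational equation has initial
    value a and speed variation d. No exact solution is asked for, only approximate ones, whose
    bounds may depend on eps. *)
Definition variational_limit (R : realType) (A : R -> 'M[R]_4)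
    (r : R -> 'cV[R]_4) (a : 'cV[R]_4) (d : R) : Prop :=
  forall eps, 0 < eps -> exists Y N D,
    [/\ approx_solution A r eps Y N D, l1 (Y 0 - a) <= eps & `|D - d| <= eps].

Lemma eq0_small (R : realType) (x C e : R) : 0 < e ->
  (forall eps, 0 < eps -> eps <= e -> `|x| <= C * eps) -> x = 0.
Proof.
move=> e0 H; apply/eqP; rewrite -normr_eq0 -[_ == 0]negbK; apply/negP => x0.
have xp : 0 < `|x| by rewrite lt_def x0 normr_ge0.
have C0 : 0 < `|C| + 1 by rewrite ltr_pwDr.
pose eps : R := Num.min e (`|x| / (2 * (`|C| + 1))).
have q0 : 0 < `|x| / (2 * (`|C| + 1)) by rewrite divr_gt0// mulr_gt0.
have eps0 : 0 < eps by rewrite lt_min e0.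
have ee : eps <= e by rewrite ge_min lexx.
have ex : eps <= `|x| / (2 * (`|C| + 1)) by rewrite ge_min lexx orbT.
have := H eps eps0 ee.
have t1 : C * eps <= (`|C| + 1) * eps.
  by rewrite ler_wpM2r ?(ltW eps0)// (le_trans (ler_norm _))// lerDl.
have t2 : (`|C| + 1) * eps <= `|x| / 2.
  have -> : `|x| / 2 = (`|C| + 1) * (`|x| / (2 * (`|C| + 1))).
    by field; rewrite gt_eqF.
  by rewrite ler_wpM2l// ltW.
by lra.
Qed.

(** The derivative of L(z, Y) is L(z, N) - D L(z, r), and L(z, Y) tends to 0 at -oo. In the
    combination with coefficients t1 and t2 the factor of L(z, r) is of order eps, and the weight
    bounds the integral of L(z, N) by a multiple of eps. So the value at 0 is of order eps, for
    every small eps. *)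
Lemma variational_limit_pairing (R : realType) (A : R -> 'M[R]_4)
    (r : R -> 'cV[R]_4) (k0 K M : R) (L : R -> 'cV[R]_4 -> R) :
  has_weight A r k0 -> 0 <= K -> 0 <= M ->
  (forall z : R, z <= 0 -> l1 (r z) <= K) ->
  (forall z (u v : 'cV[R]_4) (D : R), L z (u - D *: v) = L z u - D * L z v) ->
  (forall (z : R) v, z <= 0 -> `|L z v| <= M * expR (k0 * z) * l1 v) ->
  (forall (Y : R -> 'cV[R]_4) (F : 'cV[R]_4) (z : R), z <= 0 ->
    (forall i, is_derive z 1 (fun x => Y x i 0) ((A z *m Y z + F) i 0)) ->
    is_derive z 1 (fun x => L x (Y x)) (L z F)) ->
  forall (a1 a2 : 'cV[R]_4) (d1 d2 t1 t2 : R),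
  variational_limit A r a1 d1 -> variational_limit A r a2 d2 ->
  t1 * d1 + t2 * d2 = 0 -> t1 * L 0 a1 + t2 * L 0 a2 = 0.
Proof.
move=> [k [C [e0 [kpos kk0 C0 e00 weight]]]] K0 M0 rK Llin Lbd Lder.
move=> a1 a2 d1 d2 t1 t2 lim1 lim2 td.
have Lb (z : R) v : z <= 0 -> `|L z v| <= M * expR (k * z) * l1 v.
  move=> z0; rewrite (le_trans (Lbd z v z0))// ler_wpM2r ?l1_ge0//.
  rewrite ler_wpM2l// ler_expR.
  have : (k0 - k) * z <= 0 by rewrite mulr_ge0_le0 ?subr_ge0.
  by lra.
pose G (a : 'cV[R]_4) (d : R) : R := 1 / k + C * ((l1 a + 1) ^+ 2 + (`|d| + 1) ^+ 2).
pose Ct : R := `|t1| * (M * G a1 d1 + M) + `|t2| * (M * G a2 d2 + M)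
   + (`|t1| + `|t2|) * (M * K / k).
apply: (@eq0_small _ _ Ct (Num.min e0 1)); first by rewrite lt_min e00 /=.
move=> eps eps0; rewrite le_min => /andP[epse eps1].
have step a d : variational_limit A r a d ->
  exists (Y N : R -> 'cV[R]_4) (D : R) (E dE : R -> R), [/\
    approx_solution A r eps Y N D, `|D - d| <= eps,
    forall z : R, z <= 0 -> is_derive z 1 E (dE z),
    forall z : R, z <= 0 -> `|L z (N z)| <= dE z &
    [/\ E z @[z --> -oo%R] --> (0 : R), E 0 <= eps * (M * G a d),
       L z (Y z) @[z --> -oo%R] --> (0 : R) & `|L 0 (Y 0) - L 0 a| <= M * eps]].
  move=> /(_ eps eps0)[Y [N [D [app Ya Dd]]]].
  have [E [dE [dEE dEge E0 EC]]] := weight eps Y N D epse app.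
  have [dY NY [B YB]] := app.
  have Me : 0 <= M * eps by rewrite mulr_ge0// ltW.
  (* Since |N| <= eps |Y| and |Y| <= |Y|^2 + 1, the weight E takes care of |Y|^2, and the second
     summand, with derivative exp(k z), of the constant 1. *)
  exists Y, N, D, (fun z => M * eps * (E z + k^-1 * expR (k * z))),
    (fun z => M * eps * (dE z + k^-1 * (k * expR (k * z)))); split=> //.
  - move=> z z0; apply: is_deriveZ_fun; apply: is_deriveD_fun; first exact: dEE.
    by apply: is_deriveZ_fun; exact: is_derive_expM.
  - move=> z z0; rewrite (le_trans (Lb z _ z0))// mulrA mulVf ?gt_eqF// mul1r.
    apply: (@le_trans _ _ (M * eps * (expR (k * z) * (l1 (Y z) ^+ 2 + 1)))).
      rewrite -!mulrA ler_wpM2l// mulrCA ler_wpM2l ?expR_ge0//.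
      rewrite (le_trans (NY z z0))// ler_wpM2l ?(ltW eps0)//.
      by have := sqr_ge0 (l1 (Y z) - 1); have := sqr_ge0 (l1 (Y z)); lra.
    by rewrite ler_wpM2l// mulrDr mulr1 lerD2r dEge.
  - have l1Y0 : l1 (Y 0) <= l1 a + 1.
      have := l1D (Y 0 - a) a; rewrite subrK; lra.
    split.
    + have -> : (0 : R) = M * eps * (0 + k^-1 * 0) by rewrite !(mulr0, addr0).
      apply: cvgM; first exact: cvg_cst.
      apply: cvgD => //; apply: cvgM; first exact: cvg_cst.
      exact: cvg_expM_ninfty.
    + rewrite mulr0 expR0 mulr1 [leRHS]mulrCA -mulrA ler_wpM2l//.
      rewrite ler_wpM2l ?(ltW eps0)// /G mul1r addrC lerD2l (le_trans EC)//.
      rewrite ler_wpM2l// lerD//.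
        by rewrite ler_sqr// nnegrE ?addr_ge0 ?l1_ge0.
      rewrite -(real_normK (num_real D)) ler_sqr// ?nnegrE ?addr_ge0//.
      by have := ler_normD (D - d) d; rewrite subrK; lra.
    + apply: (cvg_exp_bounded_ninfty kpos (M := M * B)) => z z0.
      rewrite (le_trans (Lb z _ z0))// -!mulrA ler_wpM2l// mulrC.
      by rewrite ler_wpM2r ?expR_ge0// YB.
    + have -> : L 0 (Y 0) - L 0 a = L 0 (Y 0 - 1 *: a) by rewrite Llin mul1r.
      rewrite (le_trans (Lb 0 _ (lexx _)))// mulr0 expR0 mulr1 scale1r.
      by rewrite ler_wpM2l.
have [Y1 [N1 [D1 [E1 [dE1 [[dY1 _ _] Dd1 dEE1 LN1 [E10 E1C LY1 La1]]]]]]] := step _ _ lim1.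
have [Y2 [N2 [D2 [E2 [dE2 [[dY2 _ _] Dd2 dEE2 LN2 [E20 E2C LY2 La2]]]]]]] := step _ _ lim2.
pose Th (z : R) : R := t1 * L z (Y1 z) + t2 * L z (Y2 z).
pose tD : R := t1 * D1 + t2 * D2.
have tDle : `|tD| <= (`|t1| + `|t2|) * eps.
  have -> : tD = t1 * (D1 - d1) + t2 * (D2 - d2) by rewrite /tD; lra.
  rewrite (le_trans (ler_normD _ _))// !normrM mulrDl.
  by rewrite lerD// ler_wpM2l.
pose dTh (z : R) : R := t1 * L z (N1 z - D1 *: r z) + t2 * L z (N2 z - D2 *: r z).
have dThE (z : R) : z <= 0 -> is_derive z 1 Th (dTh z).
  move=> z0; apply: is_deriveD_fun; apply: is_deriveZ_fun; apply: Lder => // i.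
    by rewrite addrA; exact: dY1.
  by rewrite addrA; exact: dY2.
(* U is an antiderivative of a bound for the derivative of Th, and both tend to 0 at -oo;
   monotonicity of U + Th and U - Th then gives |Th 0| <= U 0. *)
pose U (z : R) : R := `|t1| * E1 z + `|t2| * E2 z + `|tD| * (M * K / k) * expR (k * z).
pose dU (z : R) : R := `|t1| * dE1 z + `|t2| * dE2 z
   + `|tD| * (M * K / k) * (k * expR (k * z)).
have dUE (z : R) : z <= 0 -> is_derive z 1 U (dU z).
  move=> z0; apply: is_deriveD_fun; first apply: is_deriveD_fun.
  - by apply: is_deriveZ_fun; exact: dEE1.
  - by apply: is_deriveZ_fun; exact: dEE2.
  - by apply: is_deriveZ_fun; exact: is_derive_expM.
have ThU (z : R) : z <= 0 -> `|dTh z| <= dU z.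
  move=> z0; have -> : dTh z = t1 * L z (N1 z) + t2 * L z (N2 z) - tD * L z (r z).
    by rewrite /dTh !Llin /tD; ring.
  rewrite (le_trans (ler_normB _ _))// lerD//.
    rewrite (le_trans (ler_normD _ _))// !normrM lerD// ler_wpM2l//.
      exact: LN1.
    exact: LN2.
  rewrite normrM -mulrA ler_wpM2l//.
  have -> : M * K / k * (k * expR (k * z)) = M * expR (k * z) * K.
    by field; rewrite gt_eqF.
  by rewrite (le_trans (Lb z _ z0))// ler_wpM2l ?mulr_ge0 ?expR_ge0// rK.
have Th0 : Th z @[z --> -oo%R] --> (0 : R).
  have -> : (0 : R) = t1 * 0 + t2 * 0 by rewrite !mulr0 addr0.
  by apply: cvgD; apply: cvgM => //; exact: cvg_cst.
have U0 : U z @[z --> -oo%R] --> (0 : R).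
  have -> : (0 : R) = `|t1| * 0 + `|t2| * 0 + `|tD| * (M * K / k) * 0.
    by rewrite !mulr0 !addr0.
  apply: cvgD; first by apply: cvgD; apply: cvgM => //; exact: cvg_cst.
  by apply: cvgM; [exact: cvg_cst|exact: cvg_expM_ninfty].
have P1 : 0 <= U 0 + Th 0.
  apply: (@ge0_of_derive_ge0_ninfty _ (fun z => U z + Th z) (fun z => dU z + dTh z)).
  - by move=> z z0; apply: is_deriveD_fun; [exact: dUE|exact: dThE].
  - move=> z z0; have := ThU z z0; rewrite ler_norml => /andP[]; clear; lra.
  - have -> : (0 : R) = 0 + 0 by rewrite addr0.
    exact: cvgD.
have P2 : 0 <= U 0 - Th 0.
  apply: (@ge0_of_derive_ge0_ninfty _ (fun z => U z - Th z) (fun z => dU z - dTh z)).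
  - by move=> z z0; apply: is_deriveB_fun; [exact: dUE|exact: dThE].
  - move=> z z0; have := ThU z z0; rewrite ler_norml => /andP[]; clear; lra.
  - have -> : (0 : R) = 0 - 0 by rewrite subr0.
    exact: cvgB.
have P3 : `|Th 0| <= U 0.
  by rewrite ler_norml; apply/andP; split; move: P1 P2; clear; lra.
have -> : t1 * L 0 a1 + t2 * L 0 a2 =
    Th 0 - t1 * (L 0 (Y1 0) - L 0 a1) - t2 * (L 0 (Y2 0) - L 0 a2).
  by rewrite /Th; ring.
have P4 : `|t1 * (L 0 (Y1 0) - L 0 a1)| <= `|t1| * (M * eps).
  by rewrite normrM ler_wpM2l.
have P5 : `|t2 * (L 0 (Y2 0) - L 0 a2)| <= `|t2| * (M * eps).
  by rewrite normrM ler_wpM2l.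
have P6 : U 0 <= Ct * eps - `|t1| * (M * eps) - `|t2| * (M * eps).
  rewrite /U mulr0 expR0 mulr1.
  have u1 := ler_wpM2l (normr_ge0 t1) E1C.
  have u2 := ler_wpM2l (normr_ge0 t2) E2C.
  have MKk : 0 <= M * K / k by rewrite divr_ge0 ?mulr_ge0// ltW.
  have u3 := ler_wpM2r MKk tDle.
  by move: u1 u2 u3; rewrite /Ct; clear; lra.
have := ler_normB (Th 0 - t1 * (L 0 (Y1 0) - L 0 a1)) (t2 * (L 0 (Y2 0) - L 0 a2)).
have := ler_normB (Th 0) (t1 * (L 0 (Y1 0) - L 0 a1)).
by move: P3 P4 P5 P6; clear; lra.
Qed.

(** The hypothesis makes L factor through d. The constant k is L a / d at some pair with d nonzero,
    and 0 if there is no such pair. *)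
Lemma variational_limit_line (R : realType) (V : lmodType R) (lim : V -> R -> Prop)
    (L : V -> R) :
  (forall a1 a2 d1 d2 t1 t2, lim a1 d1 -> lim a2 d2 ->
     t1 * d1 + t2 * d2 = 0 -> t1 * L a1 + t2 * L a2 = 0) ->
  exists k, forall a d, lim a d -> L a = d * k.
Proof.
move=> H; have [[a [d [ad d0]]]|nex] := pselect (exists a d, lim a d /\ d != 0).
  exists (L a / d) => a' d' ad'.
  have := H a' a d' d d (- d') ad' ad.
  rewrite mulNr mulrC subrr => /(_ erefl) E.
  by apply: (mulfI d0); rewrite mulrCA [d * (_ / d)]mulrCA divff// mulr1; lra.
exists 0 => a d ad; rewrite mulr0.
have d0 : d = 0 by apply: contrapT => /eqP d0; apply: nex; exists a, d.
have := H a a d d 1 0 ad ad; rewrite d0 !mulr0 addr0 => /(_ erefl).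
by rewrite mul1r mul0r addr0.
Qed.

(** * Orbits near the wave *)

Lemma derivable1_is_derive (R : realType) (h : R -> R) (x : R) :
  derivable h x 1 -> is_derive x 1 h (derive1 h x).
Proof. by move=> hx; rewrite derive1E; exact: derivableP. Qed.

Lemma mean_value (R : realType) (h dh : R -> R) (t d : R) :
  (forall x : R, is_derive x 1 h (dh x)) ->
  exists2 xi : R, `|xi - t| <= `|d| & h (t + d) - h t = dh xi * d.
Proof.
move=> hd; have hc (a b : R) : {within `[a, b], continuous h}.
  by apply: continuous_subspaceT => x; exact: is_derive_continuous (hd x).
have [d0|d0] := lerP 0 d.
  have td : t <= t + d by rewrite lerDl.
  have [xi] := MVT_segment td (fun x _ => hd x) (hc _ _).
  rewrite in_itv /= => /andP[x1 x2] E; exists xi; last by lra.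
  by rewrite (ger0_norm d0) ler_norml; apply/andP; split; lra.
have td : t + d <= t by rewrite gerDl ltW.
have [xi] := MVT_segment td (fun x _ => hd x) (hc _ _).
rewrite in_itv /= => /andP[x1 x2] E; exists xi; last by lra.
by rewrite (ltr0_norm d0) ler_norml; apply/andP; split; lra.
Qed.

Lemma continuous_bounded_itv (R : realType) (h : R -> R) (B : R) :
  continuous h -> exists2 K, 0 <= K & forall x, `|x| <= B -> `|h x| <= K.
Proof.
move=> ch; have [B0|B0] := ltrP B 0.
  exists 0 => // x xB; exfalso; have := normr_ge0 x; lra.
have BB : - B <= B by lra.
have [|x xB H] := @EVT_max R (fun x => `|h x|) (- B) B BB.
  apply: continuous_subspaceT => x; apply: continuous_comp; first exact: ch.
  exact: norm_continuous.
exists `|h x| => // y yB; apply: H.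
by rewrite in_itv /= -ler_norml.
Qed.

(** Two applications of the mean value theorem give the remainder, without the factor 1/2; the bound
    |d| <= 1 keeps the intermediate points in [-B - 1, B + 1]. *)
Lemma C2_taylor (R : realType) (h : R -> R) (B : R) : C2 h ->
  exists2 K, 0 <= K & forall t d, `|t| <= B -> `|d| <= 1 ->
    `|derive1 h t| <= K /\ `|h (t + d) - h t - derive1 h t * d| <= K * d ^+ 2.
Proof.
move=> [dh ddh ch].
have dhE (x : R) := derivable1_is_derive (dh x).
have ddhE (x : R) := derivable1_is_derive (ddh x).
have [K1 K10 HK1] := continuous_bounded_itv (B + 1) ch.
have cdh : continuous (derive1 h) by move=> x; exact: is_derive_continuous (ddhE x).
have [K2 K20 HK2] := continuous_bounded_itv B cdh.
exists (K1 + K2); first by rewrite addr_ge0.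
move=> t d tB d1; split; first by rewrite (le_trans (HK2 t tB))// lerDr.
have [xi xit ->] := mean_value t d dhE.
have [ze zet E] := mean_value t (xi - t) ddhE.
have -> : h^`()%classic xi * d - h^`()%classic t * d =
  h^`()%classic^`()%classic ze * (xi - t) * d.
  by rewrite -E [t + _]addrC subrK; ring.
have zeB : `|ze| <= B + 1.
  have := ler_normD (ze - t) t; rewrite subrK; lra.
rewrite !normrM -mulrA.
have t1 : `|xi - t| * `|d| <= d ^+ 2.
  by rewrite -(real_normK (num_real d)) expr2 ler_wpM2r.
rewrite (le_trans (ler_pM _ _ (HK1 _ zeB) t1))// ?mulr_ge0//.
by rewrite ler_wpM2r ?sqr_ge0// lerDl.
Qed.

Lemma gronwall_backward (R : realType) (S dS : R -> R) (l z : R) : z <= 0 ->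
  (forall x : R, z <= x <= 0 -> is_derive x 1 S (dS x)) ->
  (forall x : R, z <= x <= 0 -> - (l * S x) <= dS x) ->
  S z <= S 0 * expR (- (l * z)).
Proof.
move=> z0 dSE dSl.
have := @le_of_derive_ge0 R (fun x => S x * expR (l * x))
  (fun x => dS x * expR (l * x) + S x * (l * expR (l * x))) z 0 z0.
rewrite mulr0 expR0 mulr1 => H.
have {}H : S z * expR (l * z) <= S 0.
  apply: H => x xz; first by apply: is_deriveM_fun (dSE _ xz) (is_derive_expM _ _).
  rewrite mulrA [S x * l]mulrC -mulrDl mulr_ge0 ?expR_ge0//.
  by have := dSl x xz; lra.
rewrite expRN -(@ler_pM2r _ (expR (l * z))) ?expR_gt0// -mulrA mulVf ?mulr1//.
by rewrite gt_eqF// expR_gt0.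
Qed.

(** The differential inequality is available only while S <= 1. Gronwall's bound then keeps S
    strictly below 1, and continuity extends the range of z. The real induction runs over the length
    t of the interval [-t, 0]. *)
Lemma gronwall_bootstrap (R : realType) (S dS : R -> R) (l T : R) :
  0 <= T -> 0 <= l ->
  (forall z : R, - T <= z <= 0 -> is_derive z 1 S (dS z)) ->
  (forall z : R, - T <= z <= 0 -> 0 <= S z) ->
  (forall z : R, - T <= z <= 0 -> S z <= 1 -> - (l * S z) <= dS z) ->
  S 0 * expR (l * T) < 1 ->
  forall z, - T <= z <= 0 -> S z <= S 0 * expR (l * T).
Proof.
move=> T0 l0 dSE S0 dSl small.
pose P (t : R) := forall z, - t <= z <= 0 -> S z <= 1.
have PS t : 0 <= t <= T -> P t -> forall z, - t <= z <= 0 -> S z <= S 0 * expR (l * T).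
  move=> /andP[t0 tT] Pt z /andP[tz z0].
  apply: (@le_trans _ _ (S 0 * expR (- (l * z)))).
    have xT x : z <= x <= 0 -> - T <= x <= 0.
      by move=> /andP[zx ->]; rewrite andbT; lra.
    apply: (gronwall_backward z0 (dS := dS)) => x xz; first exact/dSE/xT.
    apply: dSl; first exact: xT.
    by apply: Pt; case/andP: xz => zx ->; rewrite andbT; lra.
  rewrite ler_wpM2l ?S0 ?oppr_le0 ?T0 ?lexx// ler_expR -mulrN ler_wpM2l//; lra.
suff PT : P T by apply: PS => //; rewrite T0 lexx.
apply: (real_induction T0).
- move=> z; rewrite oppr0 -eq_le => /eqP <-.
  have : S 0 <= S 0 * expR (l * T).
    by rewrite ler_peMr ?S0 ?oppr_le0 ?T0 ?lexx// -expR0 ler_expR mulr_ge0.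
  lra.
- move=> s /andP[s0 sT] near_s z /andP[sz z0].
  have [zs|zs] := eqVneq z (- s); last first.
    have e0 : 0 < z + s by rewrite -[s]opprK subr_gt0 lt_neqAle eq_sym zs.
    have [t [t1 t2 Pt]] := near_s _ e0.
    by apply: Pt; rewrite z0 andbT; lra.
  rewrite leNgt; apply/negP => Sz.
  have zT : - T <= z <= 0 by rewrite z0 andbT zs; lra.
  have cS := is_derive_continuous (dSE z zT).
  have [e e0 He] : exists2 e, 0 < e & forall x, `|x - z| < e -> 1 < S x.
    have /nbhs_ballP[e e0 He] : \forall x \near z, 1 < S x by exact: cvgr_gt cS _ Sz.
    by exists e => // x xz; apply: He; rewrite /ball/= distrC.
  have [t [t1 t2 Pt]] := near_s e e0.
  have [t0|t0] := lerP 0 t; last first.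
    have : 1 < S 0 by apply: He; rewrite ltr_norml; apply/andP; split; lra.
    have : S 0 <= S 0 * expR (l * T).
      by rewrite ler_peMr ?S0 ?oppr_le0 ?T0 ?lexx// -expR0 ler_expR mulr_ge0.
    lra.
  have : S (- t) <= 1 by apply: Pt; rewrite lexx oppr_le0.
  have : 1 < S (- t) by apply: He; rewrite ltr_norml; apply/andP; split; lra.
  lra.
- move=> s /andP[s0 sT] Ps.
  have sTs : - T <= - s <= 0 by rewrite oppr_le0 s0 andbT; lra.
  have Ss : S (- s) < 1.
    apply: le_lt_trans small; apply: (PS s) => //; first by rewrite s0 ltW.
    by rewrite lexx oppr_le0.
  have cS := is_derive_continuous (dSE _ sTs).
  have [e e0 He] : exists2 e, 0 < e & forall x, `|x - (- s)| < e -> S x < 1.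
    have /nbhs_ballP[e e0 He] : \forall x \near - s, S x < 1 by exact: cvgr_lt cS _ Ss.
    by exists e => // x xz; apply: He; rewrite /ball/= distrC.
  exists e => // t /andP[st te] z /andP[tz z0].
  have [sz|sz] := lerP (- s) z; first by apply: Ps; rewrite sz.
  by apply/ltW/He; rewrite ltr_norml; apply/andP; split; lra.
Qed.

Lemma ler_entry_norm (R : realType) m n (M : 'M[R]_(m.+1, n.+1)) i j :
  `|M i j| <= `|M|.
Proof.
rewrite [leRHS]/Num.Def.normr/= mx_normrE.
by apply: le_trans; last exact: (le_bigmax _ _ (i, j)).
Qed.

Lemma l1_cV4 (R : realType) (v : 'cV[R]_4) :
  l1 v = `|v 0 0| + `|v 1 0| + `|v 2 0| + `|v 3 0|.
Proof. by rewrite l1_col sum_ord4. Qed.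

(* k is the speed of the nearby orbit. The error N collects the Taylor remainders
   of f and g and the product of the speed increment with the difference d; the
   last clause is Gronwall's inequality, continued as long as d is small. *)
Lemma orbit_difference (R : realType) (f g : R -> R) (sigma alpha c sg B K : R)
    (U V W Y : R -> R) :
  0 < sigma -> 0 < alpha -> `|sg| = 1 -> 0 <= K ->
  (forall z : R, is_derive z 1 U (sigma * W z)) ->
  (forall z : R, is_derive z 1 V (alpha * Y z)) ->
  (forall z : R, is_derive z 1 W (- (c * W z) - f (U z) / sigma + V z)) ->
  (forall z : R, is_derive z 1 Y (- (c * Y z) - U z - g (V z) / alpha)) ->
  (forall z, [/\ `|U z| <= B, `|V z| <= B, `|W z| <= B & `|Y z| <= B]) ->
  (forall t d, `|t| <= B -> `|d| <= 1 ->
    `|derive1 f t| <= K /\ `|f (t + d) - f t - derive1 f t * d| <= K * d ^+ 2) ->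
  (forall t d, `|t| <= B -> `|d| <= 1 ->
    `|derive1 g t| <= K /\ `|g (t + d) - g t - derive1 g t * d| <= K * d ^+ 2) ->
  exists l rho : R, [/\ 0 <= l, 0 < rho &
  forall (x0 x1 x2 x3 : R -> R) (k : R),
  (forall z : R, z <= 0 -> is_derive z 1 x0 (sg * (sigma * x2 z))) ->
  (forall z : R, z <= 0 -> is_derive z 1 x1 (sg * (alpha * x3 z))) ->
  (forall z : R, z <= 0 -> is_derive z 1 x2
      (sg * (- (k * x2 z) - f (x0 z) / sigma + x1 z))) ->
  (forall z : R, z <= 0 -> is_derive z 1 x3
      (sg * (- (k * x3 z) - x0 z - g (x1 z) / alpha))) ->
  let d z := colv 4 [:: x0 z - U (sg * z); x1 z - V (sg * z);
                        x2 z - W (sg * z); x3 z - Y (sg * z)] in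
  let r z := colv 4 [:: 0; 0; W (sg * z); Y (sg * z)] in
  let A z := A0 f g sigma alpha c U V (sg * z) in
  exists N : R -> 'cV[R]_4, [/\
    forall z : R, z <= 0 -> forall i, is_derive z 1 (fun x => d x i 0)
      ((sg *: A z *m d z + N z - (k - c) *: (sg *: r z)) i 0),
    forall z : R, z <= 0 -> l1 (d z) <= 1 ->
      l1 (N z) <= rho * (l1 (d z) + `|k - c|) * l1 (d z) &
    forall T, 0 <= T ->
      4 * (l1 (d 0) ^+ 2 + (k - c) ^+ 2) * expR (l * T) < 1 ->
      forall z, - T <= z <= 0 ->
      l1 (d z) ^+ 2 <= 4 * (l1 (d 0) ^+ 2 + (k - c) ^+ 2) * expR (l * T)]].
Proof.
move=> sigma0 alpha0 sg1 K0 dU dV dW dY bd fK gK.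
have B0 : 0 <= B by have [+ _ _ _] := bd 0; apply: le_trans.
have sn0 : sigma != 0 by rewrite gt_eqF.
have an0 : alpha != 0 by rewrite gt_eqF.
have Ks : 0 <= K / sigma by rewrite divr_ge0// ltW.
have Ka : 0 <= K / alpha by rewrite divr_ge0// ltW.
pose rho : R := 1 + K / sigma + K / alpha.
have rho0 : 0 < rho by rewrite /rho; lra.
(* Lc (|d| + |D|) bounds the entries of the right-hand side while the quantity S below is at most 1:
   the first terms bound the matrix, 3 rho bounds N because then |d| + |D| <= 3, and 2 B bounds r.
   The factor 16 arises from (|d| + |D|) |d| <= 8 S. *)
pose Lc : R := sigma + alpha + 2 * `|c| + 2 + K / sigma + K / alpha + 3 * rho + 2 * B.
have Lc0 : 0 <= Lc by rewrite /Lc; have := normr_ge0 c; lra.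
exists (16 * Lc), rho; split=> //; first by rewrite mulr_ge0.
move=> x0 x1 x2 x3 k dx0 dx1 dx2 dx3 d r A.
pose D : R := k - c.
pose nf (z : R) : R := f (x0 z) - f (U (sg * z)) - derive1 f (U (sg * z)) * (x0 z - U (sg * z)).
pose ng (z : R) : R := g (x1 z) - g (V (sg * z)) - derive1 g (V (sg * z)) * (x1 z - V (sg * z)).
pose n2 (z : R) : R := - (D * (x2 z - W (sg * z))) - nf z / sigma.
pose n3 (z : R) : R := - (D * (x3 z - Y (sg * z))) - ng z / alpha.
pose N (z : R) := colv 4 [:: 0; 0; sg * n2 z; sg * n3 z].
have dE (z : R) : z <= 0 -> forall i, is_derive z 1 (fun x => d x i 0)
      ((sg *: A z *m d z + N z - (k - c) *: (sg *: r z)) i 0).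
  move=> z0; apply: ord4_ind; rewrite !mxE sum_ord4 !mxE /=.
  - apply: is_derive_eq.
      rewrite (_ : (fun x => d x 0 0) = (fun x => x0 x - U (sg * x))); last first.
        by apply/funext => x; rewrite mxE.
      by apply: is_deriveB_fun (dx0 z z0) (is_derive_mulx (dU _)).
    by ring.
  - apply: is_derive_eq.
      rewrite (_ : (fun x => d x 1 0) = (fun x => x1 x - V (sg * x))); last first.
        by apply/funext => x; rewrite mxE.
      by apply: is_deriveB_fun (dx1 z z0) (is_derive_mulx (dV _)).
    by ring.
  - apply: is_derive_eq.
      rewrite (_ : (fun x => d x 2 0) = (fun x => x2 x - W (sg * x))); last first.
        by apply/funext => x; rewrite mxE.
      by apply: is_deriveB_fun (dx2 z z0) (is_derive_mulx (dW _)).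
    by rewrite /n2 /nf /D; field.
  - apply: is_derive_eq.
      rewrite (_ : (fun x => d x 3 0) = (fun x => x3 x - Y (sg * x))); last first.
        by apply/funext => x; rewrite mxE.
      by apply: is_deriveB_fun (dx3 z z0) (is_derive_mulx (dY _)).
    by rewrite /n3 /ng /D; field.
have l1dE (z : R) : l1 (d z) = `|x0 z - U (sg * z)| + `|x1 z - V (sg * z)| +
    `|x2 z - W (sg * z)| + `|x3 z - Y (sg * z)|.
  by rewrite l1_cV4 !mxE.
have taylor (z : R) : (forall i, `|d z i 0| <= 1) ->
  [/\ `|derive1 f (U (sg * z))| <= K, `|derive1 g (V (sg * z))| <= K,
      `|nf z| <= K * `|x0 z - U (sg * z)| ^+ 2 &
      `|ng z| <= K * `|x1 z - V (sg * z)| ^+ 2].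
  move=> d1; have := d1 0; have := d1 1; rewrite !mxE /= => d11 d10.
  have [bU bV _ _] := bd (sg * z).
  have [f1 f2] := fK _ _ bU d10; have [g1 g2] := gK _ _ bV d11.
  rewrite !real_normK ?num_real//; split=> //.
    by rewrite /nf; move: f2; rewrite addrCA subrr addr0.
  by rewrite /ng; move: g2; rewrite addrCA subrr addr0.
have NE (z : R) : (forall i, `|d z i 0| <= 1) ->
    l1 (N z) <= rho * (l1 (d z) + `|D|) * l1 (d z).
  move=> d1; have [_ _ nfK ngK] := taylor z d1.
  rewrite l1_cV4 !mxE /= normr0 !add0r !normrM sg1 !mul1r l1dE.
  have := normr_ge0 (x0 z - U (sg * z)); have := normr_ge0 (x1 z - V (sg * z)).
  have := normr_ge0 (x2 z - W (sg * z)); have := normr_ge0 (x3 z - Y (sg * z)).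
  have q2 : `|n2 z| <= `|D| * `|x2 z - W (sg * z)| + K / sigma * `|x0 z - U (sg * z)| ^+ 2.
    rewrite (le_trans (ler_normB _ _))// normrN normrM lerD2l normrM normfV.
    rewrite (gtr0_norm sigma0) mulrAC ler_pdivrMr// divfK//.
  have q3 : `|n3 z| <= `|D| * `|x3 z - Y (sg * z)| + K / alpha * `|x1 z - V (sg * z)| ^+ 2.
    rewrite (le_trans (ler_normB _ _))// normrN normrM lerD2l normrM normfV.
    rewrite (gtr0_norm alpha0) mulrAC ler_pdivrMr// divfK//.
  move: q2 q3 (normr_ge0 D); rewrite /rho.
  move: `|n2 z| `|n3 z| `|D| `|x0 z - _| `|x1 z - _| `|x2 z - _| `|x3 z - _|.
  move: Ks Ka; move: (K / sigma) (K / alpha).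
  move=> ks ka ks0 ka0 m2 m3 D' e0 e1 e2 e3 q2 q3 D0 e30 e20 e10 e00.
  clear -ks0 ka0 q2 q3 D0 e30 e20 e10 e00.
  set s := e0 + e1 + e2 + e3.
  have s0 : 0 <= s by rewrite /s; lra.
  have t0 : e0 ^+ 2 <= s * s by rewrite expr2 ler_pM//; rewrite /s; lra.
  have t1 : e1 ^+ 2 <= s * s by rewrite expr2 ler_pM//; rewrite /s; lra.
  have t2 : D' * (e2 + e3) <= D' * s by rewrite ler_wpM2l// /s; lra.
  have t3 := ler_wpM2l ks0 t0; have t4 := ler_wpM2l ka0 t1.
  have t5 : 0 <= s * s by rewrite mulr_ge0.
  have t6 : 0 <= (ks + ka) * (D' * s) by rewrite mulr_ge0 ?addr_ge0// mulr_ge0.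
  by lra.
exists N; split=> //.
  move=> z z0 d1; apply: NE => i; apply: le_trans d1; exact: ler_l1.
move=> T T0 small.
(* Including the constant D^2 turns the inhomogeneous estimate into a linear one in S alone. *)
pose S (z : R) : R := \sum_i d z i 0 ^+ 2 + D ^+ 2.
pose F (z : R) := sg *: A z *m d z + N z - (k - c) *: (sg *: r z).
pose dS (z : R) : R := 2 * \sum_i 1 * (d z i 0 * F z i 0).
have dSE (z : R) : z <= 0 -> is_derive z 1 S (dS z).
  move=> z0; apply: is_derive_eq.
    have dd := is_derive_sum_fun (fun i => is_deriveM_fun (dE z z0 i) (dE z z0 i)).
    exact: is_deriveD_fun dd (is_derive_cst _ _ _).
  rewrite addr0 /dS mulr_sumr; apply: eq_bigr => i _; rewrite -/(F z); ring.
have dS1 (z : R) : S z <= 1 -> forall i, `|d z i 0| <= 1.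
  move=> S1 i; rewrite -(@expr_le1 _ 2)// real_normK ?num_real//.
  apply: le_trans S1; rewrite /S (bigD1 i)//= -addrA lerDl addr_ge0 ?sqr_ge0//.
  by apply: sumr_ge0 => j _; exact: sqr_ge0.
have l1S (z : R) : l1 (d z) ^+ 2 <= 4 * (S z - D ^+ 2).
  by rewrite /S addrK l1_col; exact: sum_norm_sqr_le (fun i => d z i 0).
have Sl1 (z : R) : S z <= l1 (d z) ^+ 2 + D ^+ 2.
  by rewrite /S lerD2r l1_col; exact: sum_sqr_le_norm (fun i => d z i 0).
have FL (z : R) : S z <= 1 -> forall i, `|F z i 0| <= Lc * (l1 (d z) + `|D|).
  move=> S1; have d1 := dS1 z S1.
  have [fU gV _ _] := taylor z d1.
  have [bU bV bW bY] := bd (sg * z).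
  have d2 : l1 (d z) <= 2.
    rewrite -(@ler_sqr _ (l1 (d z)))// ?nnegrE ?l1_ge0//.
    by have := l1S z; have := sqr_ge0 D; move: S1; clear; lra.
  have D1 : `|D| <= 1.
    rewrite -(@expr_le1 _ 2)// real_normK ?num_real// (le_trans _ S1)// /S lerDr.
    by apply: sumr_ge0 => i _; exact: sqr_ge0.
  have l0 := l1_ge0 (d z).
  have n1 : l1 (N z) <= 3 * rho * l1 (d z).
    rewrite (le_trans (NE z d1))// ler_wpM2r// [leRHS]mulrC ler_wpM2l ?(ltW rho0)//.
    by move: d2 D1; clear; lra.
  have a1 : l1 (sg *: A z) <= sigma + alpha + 2 * `|c| + 2 + K / sigma + K / alpha.
    rewrite l1Z sg1 mul1r /l1 !sum_ord4 !mxE /= !normrN !normr0 !normr1 !normrM !normfV.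
    rewrite (gtr0_norm sigma0) (gtr0_norm alpha0).
    have u1 : `|derive1 f (U (sg * z))| / sigma <= K / sigma.
      by rewrite ler_wpM2r// invr_ge0 ltW.
    have u2 : `|derive1 g (V (sg * z))| / alpha <= K / alpha.
      by rewrite ler_wpM2r// invr_ge0 ltW.
    by move: u1 u2; clear; lra.
  have r1 : l1 (- (D *: (sg *: r z))) <= `|D| * (2 * B).
    rewrite l1N !l1Z sg1 mul1r ler_wpM2l// l1_cV4 !mxE /= normr0.
    by move: bW bY; clear; lra.
  move=> i; rewrite (le_trans (ler_l1 _ i 0))//.
  have v1 := l1D (sg *: A z *m d z + N z) (- (D *: (sg *: r z))).
  have v2 := l1D (sg *: A z *m d z) (N z).
  have v3 := l1M (sg *: A z) (d z).
  have v4 := ler_wpM2r l0 a1.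
  have v5 : 0 <= (Lc - 2 * B) * `|D|.
    by rewrite mulr_ge0// /Lc; have := normr_ge0 c;
      move: sigma0 alpha0 Ks Ka rho0; clear; lra.
  have v6 : 0 <= 2 * B * l1 (d z) by rewrite !mulr_ge0.
  by rewrite /F -/D; move: v1 v2 v3 v4 v5 v6 r1 n1; rewrite /Lc; clear; lra.
have small' : S 0 * expR (16 * Lc * T) < 1.
  apply: le_lt_trans small; rewrite ler_wpM2r ?expR_ge0//.
  have := sqr_ge0 (l1 (d 0)); have := sqr_ge0 D; have := Sl1 0; rewrite -/D.
  by clear; lra.
move=> z zT.
have SB : S z <= S 0 * expR (16 * Lc * T).
  apply: (@gronwall_bootstrap R S dS (16 * Lc) T T0 _ _ _ _ small' z zT).
  - by rewrite mulr_ge0.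
  - by move=> x /andP[_ x0']; exact: dSE.
  - move=> x _; rewrite addr_ge0 ?sqr_ge0// sumr_ge0// => i _; exact: sqr_ge0.
  - move=> x _ S1.
    have := sum_weighted_le (w := fun=> 1) (e := fun i => F x i 0) (m := 1)
      (fun i => d x i 0) (fun=> ltac:(by rewrite normr1)) (FL x S1).
    rewrite -l1_col mul1r => p1.
    have p2 : - dS x <= 2 * (Lc * (l1 (d x) + `|D|) * l1 (d x)).
      by rewrite -mulrN ler_wpM2l// (le_trans _ p1)// -normrN ler_norm.
    have p3 := l1S x.
    have p4 : `|D| ^+ 2 = D ^+ 2 by rewrite real_normK ?num_real.
    have p5 := sqr_ge0 (l1 (d x) - `|D|).
    have p6 : (l1 (d x) + `|D|) * l1 (d x) <= 8 * S x.
      have := sqr_ge0 D; have := sqr_ge0 (l1 (d x)); clear -p3 p4 p5; lra.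
    have := ler_wpM2l Lc0 p6; clear -p2; lra.
have p1 := l1S z; have p2 := sqr_ge0 D.
have p3 : S 0 * expR (16 * Lc * T) <= (l1 (d 0) ^+ 2 + D ^+ 2) * expR (16 * Lc * T).
  by rewrite ler_wpM2r ?expR_ge0.
by rewrite -/D; clear -p1 p2 p3 SB; lra.
Qed.

(** For a curve gam in the manifold with velocity a, Y is (X - wave) / s with X the orbit through
    gam s, and D is the same quotient of speeds. The radius th is fixed by eps, then the time T
    beyond which X and the wave are within th / 8 of the fixed point, and s last, so that Gronwall's
    inequality keeps them within th of each other on [-T, 0]. *)
Lemma tangent_variational_limit (R : realType) (f g : R -> R)
    (sigma alpha c sg B : R) (U V W Y : R -> R) (a : 'cV[R]_5) :
  let F := augmented_field f g sigma alpha in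
  let p := colv 5 [:: 0; 0; 0; 0; c] : 'cV[R]_5 in
  let q := colv 5 [:: U 0; V 0; W 0; Y 0; c] : 'cV[R]_5 in
  C2 f -> C2 g -> 0 < sigma -> 0 < alpha -> `|sg| = 1 ->
  (forall z : R, is_derive z 1 U (sigma * W z)) ->
  (forall z : R, is_derive z 1 V (alpha * Y z)) ->
  (forall z : R, is_derive z 1 W (- (c * W z) - f (U z) / sigma + V z)) ->
  (forall z : R, is_derive z 1 Y (- (c * Y z) - U z - g (V z) / alpha)) ->
  (forall z, [/\ `|U z| <= B, `|V z| <= B, `|W z| <= B & `|Y z| <= B]) ->
  (forall e, 0 < e -> exists T, forall z, z <= - T ->
    [/\ `|U (sg * z)| <= e, `|V (sg * z)| <= e, `|W (sg * z)| <= e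
      & `|Y (sg * z)| <= e]) ->
  (forall e, 0 < e -> exists T M, tangent_vector M q a /\
     forall q', M q' -> exists X : R -> 'cV[R]_5, [/\ X 0 = q',
       forall z : R, z <= 0 -> forall i,
         is_derive z 1 (fun x => X x i 0) (sg * F (X z) i 0) &
       forall z, z <= - T -> `|X z - p| <= e]) ->
  variational_limit (fun z => sg *: A0 f g sigma alpha c U V (sg * z))
    (fun z => sg *: colv 4 [:: 0; 0; W (sg * z); Y (sg * z)])
    (colv 4 [:: a 0 0; a 1 0; a 2 0; a 3 0]) (a 4 0).
Proof.
move=> F p q C2f C2g sigma0 alpha0 sg1 dU dV dW dY bd lim0 tan eps eps0.
have [Kf Kf0 HKf] := C2_taylor B C2f.
have [Kg Kg0 HKg] := C2_taylor B C2g.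
have [||l [rho [l0 rho0 orbit]]] := @orbit_difference R f g sigma alpha c sg B (Kf + Kg)
  U V W Y sigma0 alpha0 sg1 (addr_ge0 Kf0 Kg0) dU dV dW dY bd.
- move=> t d tB d1; have [h1 h2] := HKf t d tB d1; split.
    by rewrite (le_trans h1)// lerDl.
  by rewrite (le_trans h2)// ler_wpM2r ?sqr_ge0// lerDl.
- move=> t d tB d1; have [h1 h2] := HKg t d tB d1; split.
    by rewrite (le_trans h1)// lerDr.
  by rewrite (le_trans h2)// ler_wpM2r ?sqr_ge0// lerDr.
(* As |N| <= rho (|d| + |k - c|) |d|, the bound th <= eps / (2 rho) makes this at most eps |d|; th
   <= 1 keeps d within reach of the Taylor estimates. *)
pose th : R := Num.min 1 (eps / (2 * rho)).
have th0 : 0 < th by rewrite lt_min ltr01 divr_gt0// mulr_gt0.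
have th1 : th <= 1 by rewrite ge_min lexx.
have the : rho * (th + th) <= eps.
  have : th <= eps / (2 * rho) by rewrite ge_min lexx orbT.
  by rewrite ler_pdivlMr ?mulr_gt0//; clear; lra.
(* Four coordinates, each with th / 8 from the orbit and th / 8 from the wave, add up to th. *)
have th8 : 0 < th / 8 by rewrite divr_gt0.
have [T1 wave1] := lim0 _ th8.
have [T2 [M [[gam [gam0 gamM dgam]] MX]]] := tan _ th8.
pose T : R := Num.max (Num.max T1 T2) 0.
have T0 : 0 <= T by rewrite le_max lexx orbT.
have TT1 : T1 <= T by rewrite !le_max lexx.
have TT2 : T2 <= T by rewrite !le_max lexx orbT.
(* With initial distance at most 4 eta and speed increment at most eta, Gronwall's bound is 68 eta^2
   exp(l T), below 100 eta^2 exp(l T)^2 = th^2. *)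
pose eta : R := th / (10 * expR (l * T)).
have ex1 : 1 <= expR (l * T) by rewrite -expR0 ler_expR mulr_ge0.
have eta0 : 0 < eta by rewrite divr_gt0// mulr_gt0// expR_gt0.
have etaE : 68 * eta ^+ 2 * expR (l * T) < th ^+ 2.
  have E : eta * (10 * expR (l * T)) = th.
    by rewrite divfK// gt_eqF// mulr_gt0// expR_gt0.
  have -> : th ^+ 2 = 100 * (eta ^+ 2 * expR (l * T) * expR (l * T)).
    by rewrite -E; ring.
  have h : 0 < eta ^+ 2 * expR (l * T) by rewrite mulr_gt0 ?exprn_gt0// expR_gt0.
  have := ler_wpM2l (ltW h) ex1; move: h; clear; lra.
have dgi i := is_derive_entry i 0 dgam.
have qi i : gam 0 i 0 = q i 0 by rewrite gam0.
have gamc i : \forall s \near 0^', `|gam s i 0 - q i 0| <= eta.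
  have := is_derive_continuous (dgi i) => cg.
  have : \forall s \near (0 : R), `|gam s i 0 - q i 0| <= eta.
    have /cvgrPdist_le /(_ _ eta0) : gam s i 0 @[s --> (0 : R)] --> gam 0 i 0 by exact: cg.
    by rewrite qi; apply: filterS => s; rewrite distrC.
  exact: nbhs_dnbhs.
have gamd i : \forall s \near 0^', `|s^-1 * (gam s i 0 - q i 0) - a i 0| <= eps / 4.
  have := is_derive_cvg_quot (dgi i) => /cvgrPdist_le /(_ (eps / 4)).
  rewrite divr_gt0// => /(_ isT); apply: filterS => s.
  by rewrite subr0 distrC qi [_ / s]mulrC.
have [s [s0 gs [sc0 sc1 sc2 sc3 sc4] [sd0 sd1 sd2 sd3 sd4]]] : exists s : R, [/\ s != 0, M (gam s),
  [/\ `|gam s 0 0 - q 0 0| <= eta, `|gam s 1 0 - q 1 0| <= eta,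
      `|gam s 2 0 - q 2 0| <= eta, `|gam s 3 0 - q 3 0| <= eta
    & `|gam s 4 0 - q 4 0| <= eta] &
  [/\ `|s^-1 * (gam s 0 0 - q 0 0) - a 0 0| <= eps / 4,
      `|s^-1 * (gam s 1 0 - q 1 0) - a 1 0| <= eps / 4,
      `|s^-1 * (gam s 2 0 - q 2 0) - a 2 0| <= eps / 4,
      `|s^-1 * (gam s 3 0 - q 3 0) - a 3 0| <= eps / 4
    & `|s^-1 * (gam s 4 0 - q 4 0) - a 4 0| <= eps / 4]].
  have gM' : \forall s \near 0^', M (gam s) by exact: nbhs_dnbhs gamM.
  near ((0 : R)^') => s; exists s; split.
  - near: s; exact: nbhs_dnbhs_neq.
  - by near: s.
  - by split; near: s.
  - by split; near: s.
have [X [X0 dX Xp]] := MX _ gs.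
pose k : R := gam s 4 0.
have Xk z : z <= 0 -> X z 4 0 = k.
  move=> z0; rewrite /k -X0; apply: (is_derive0_const (f := fun x => X x 4 0) z0) => x /andP[_ x0].
  by apply: is_derive_eq (dX x x0 4) _; rewrite !mxE /= mulr0.
have [|||| N [dE NE boot]] := orbit (fun z => X z 0 0) (fun z => X z 1 0)
   (fun z => X z 2 0) (fun z => X z 3 0) k.
- by move=> z z0; apply: is_derive_eq (dX z z0 0) _; rewrite !mxE.
- by move=> z z0; apply: is_derive_eq (dX z z0 1) _; rewrite !mxE.
- by move=> z z0; apply: is_derive_eq (dX z z0 2) _; rewrite !mxE /= Xk.
- by move=> z z0; apply: is_derive_eq (dX z z0 3) _; rewrite !mxE /= Xk.
pose d (z : R) : 'cV[R]_4 := colv 4 [:: X z 0 0 - U (sg * z);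
  X z 1 0 - V (sg * z); X z 2 0 - W (sg * z); X z 3 0 - Y (sg * z)].
have {}NE (z : R) : z <= 0 -> l1 (d z) <= 1 ->
  l1 (N z) <= rho * (l1 (d z) + `|k - c|) * l1 (d z) := NE z.
have {}boot (S : R) : 0 <= S ->
  4 * (l1 (d 0) ^+ 2 + (k - c) ^+ 2) * expR (l * S) < 1 ->
  forall z, - S <= z <= 0 ->
  l1 (d z) ^+ 2 <= 4 * (l1 (d 0) ^+ 2 + (k - c) ^+ 2) * expR (l * S) := boot S.
have q0 : q 0 0 = U 0 by rewrite mxE.
have q1 : q 1 0 = V 0 by rewrite mxE.
have q2 : q 2 0 = W 0 by rewrite mxE.
have q3 : q 3 0 = Y 0 by rewrite mxE.
have q4 : q 4 0 = c by rewrite mxE.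
have d0E : d 0 = colv 4 [:: gam s 0 0 - q 0 0; gam s 1 0 - q 1 0;
    gam s 2 0 - q 2 0; gam s 3 0 - q 3 0].
  by rewrite /d mulr0 X0 q0 q1 q2 q3.
have l1d0 : l1 (d 0) <= 4 * eta.
  by rewrite d0E l1_cV4; move: sc0 sc1 sc2 sc3; rewrite !mxE /=; clear; lra.
have kc : `|k - c| <= eta by rewrite -q4.
have small : 4 * (l1 (d 0) ^+ 2 + (k - c) ^+ 2) * expR (l * T) < th ^+ 2.
  apply: le_lt_trans etaE; rewrite ler_wpM2r ?expR_ge0//.
  have t1 : l1 (d 0) ^+ 2 <= (4 * eta) ^+ 2.
    by rewrite ler_sqr ?nnegrE ?l1_ge0// mulr_ge0// ltW.
  have t2 : (k - c) ^+ 2 <= eta ^+ 2.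
    by rewrite -(real_normK (num_real (k - c))) ler_sqr ?nnegrE// ltW.
  by move: t1 t2; clear; lra.
have dth (z : R) : z <= 0 -> l1 (d z) <= th.
  move=> z0; have [zT|zT] := lerP (- T) z.
    rewrite -(@ler_sqr _ (l1 (d z)))// ?nnegrE ?l1_ge0 ?(ltW th0)//.
    apply/ltW/(le_lt_trans _ small)/boot => //; last by rewrite zT.
    by apply: lt_le_trans small _; rewrite expr_le1// ltW.
  have [|w0 w1 w2 w3] := wave1 z; first by move: zT TT1; clear; lra.
  have Xz := Xp z ltac:(by move: zT TT2; clear; lra).
  have Xi i : `|X z i 0 - p i 0| <= th / 8.
    by apply: le_trans Xz; have := ler_entry_norm (X z - p) i 0; rewrite !mxE.
  have := Xi 0; have := Xi 1; have := Xi 2; have := Xi 3.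
  rewrite l1_cV4 !mxE /= !subr0 => X3 X2 X1 X0'.
  have n0 := ler_normB (X z 0 0) (U (sg * z)).
  have n1 := ler_normB (X z 1 0) (V (sg * z)).
  have n2 := ler_normB (X z 2 0) (W (sg * z)).
  have n3 := ler_normB (X z 3 0) (Y (sg * z)).
  by move: w0 w1 w2 w3 X3 X2 X1 X0' n0 n1 n2 n3; clear; lra.
have Dth : `|k - c| <= th.
  rewrite (le_trans kc)// ler_pdivrMr ?mulr_gt0 ?expR_gt0// ler_peMr ?(ltW th0)//.
  by move: ex1; clear; lra.
exists (fun z => s^-1 *: d z), (fun z => s^-1 *: N z), (s^-1 * (k - c)); split.
- split.
  + move=> z z0 i.
    have -> : (fun x => (s^-1 *: d x) i 0) = (fun x => s^-1 * d x i 0).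
      by apply/funext => x; rewrite mxE.
    apply: is_derive_eq; first exact: is_deriveZ_fun (dE z z0 i).
    by rewrite -scalemxAr -scalerA -scalerDr -scalerBr [RHS]mxE.
  + move=> z z0; rewrite !l1Z mulrCA ler_wpM2l//.
    rewrite (le_trans (NE z z0 _)) ?(le_trans (dth z z0))//.
    rewrite ler_wpM2r ?l1_ge0// (le_trans _ the)// ler_wpM2l ?(ltW rho0)//.
    by rewrite lerD// dth.
  + by exists (`|s^-1| * th) => z z0; rewrite l1Z ler_wpM2l// dth.
- by rewrite d0E l1_cV4; move: sd0 sd1 sd2 sd3; rewrite !mxE /=; clear; lra.
- by move: sd4; rewrite -/k q4 => /le_trans; apply; move: eps0; clear; lra.
Unshelve. all: by end_near. Qed.

(** * The linearized system *)

(** Adding c / 2 times the identity makes the matrix Hamiltonian for [omega]: the couplings 1 and -1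
    between the two components match the opposite signs of the two terms of [omega]. *)
Lemma omega_A0 (R : realType) (f g : R -> R) (sigma alpha c : R)
    (U V : R -> R) (z : R) (u y : 'cV[R]_4) :
  let A := A0 f g sigma alpha c U V z in
  omega (A *m u) y + omega u (A *m y) = - c * omega u y.
Proof.
rewrite /omega !mxE !sum_ord4 !mxE /=.
move: (u 0 0) (u 1 0) (u 2 0) (u 3 0) (y 0 0) (y 1 0) (y 2 0) (y 3 0).
by move=> *; ring.
Qed.

Lemma is_derive_omega (R : realType) (u y : R -> 'cV[R]_4) (du dy : 'cV[R]_4) (z : R) :
  (forall i, is_derive z 1 (fun x => u x i 0) (du i 0)) ->
  (forall i, is_derive z 1 (fun x => y x i 0) (dy i 0)) ->
  is_derive z 1 (fun x => omega (u x) (y x)) (omega du (y z) + omega (u z) dy).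
Proof.
move=> hu hy; have h := is_deriveB_fun
  (is_deriveB_fun (is_deriveM_fun (hu 0) (hy 2)) (is_deriveM_fun (hu 2) (hy 0)))
  (is_deriveB_fun (is_deriveM_fun (hu 1) (hy 3)) (is_deriveM_fun (hu 3) (hy 1))).
by apply: (is_derive_eq h); rewrite /omega; ring.
Qed.

(* The change of variable x = sg * z treats both time directions at once. *)
Lemma is_derive_Omega (R : realType) (f g : R -> R) (sigma alpha c sg : R)
    (U V : R -> R) (u Y : R -> 'cV[R]_4) (F : 'cV[R]_4) (z : R) :
  let A := A0 f g sigma alpha c U V in
  linear_solution A u ->
  (forall i, is_derive z 1 (fun x => Y x i 0)
     ((sg *: A (sg * z) *m Y z + F) i 0)) ->
  is_derive z 1 (fun x => Omega c (sg * x) (u (sg * x)) (Y x))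
    (Omega c (sg * z) (u (sg * z)) F).
Proof.
move=> A du dY.
have du' i : is_derive z 1 (fun x => u (sg * x) i 0)
    ((sg *: (A (sg * z) *m u (sg * z))) i 0).
  rewrite mxE; apply: (is_derive_mulx (f := fun x => u x i 0)).
  exact: is_derive_entry (du _).
have dw := is_derive_omega du' dY.
have de : is_derive z 1 (fun x => expR (c * (sg * x)))
    (c * sg * expR (c * (sg * z))).
  have -> : (fun x => expR (c * (sg * x))) = (fun x => expR ((c * sg) * x)).
    by apply/funext => x; rewrite mulrA.
  by rewrite (mulrA c sg z); exact: is_derive_expM.
apply: (is_derive_eq (is_deriveM_fun de dw)).
have := omega_A0 f g sigma alpha c U V (sg * z) (u (sg * z)) (Y z).
rewrite -/A -scalemxAl omegaZl omegaDr omegaZr /Omega => H.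
have -> : omega (A (sg * z) *m u (sg * z)) (Y z) =
  - c * omega (u (sg * z)) (Y z) - omega (u (sg * z)) (A (sg * z) *m Y z).
  by rewrite -H addrK.
ring.
Qed.

Lemma Omega_const (R : realType) (f g : R -> R) (sigma alpha c : R)
    (U V : R -> R) (u Y : R -> 'cV[R]_4) (z z' : R) :
  let A := A0 f g sigma alpha c U V in
  linear_solution A u -> linear_solution A Y ->
  Omega c z (u z) (Y z) = Omega c z' (u z') (Y z').
Proof.
move=> A du dY.
have H (x : R) : is_derive x 1 (fun x => Omega c x (u x) (Y x)) 0.
  have := @is_derive_Omega R f g sigma alpha c 1 U V u Y 0 x du.
  have -> : (fun x : R => Omega c (1 * x) (u (1 * x)) (Y x)) =
      (fun x : R => Omega c x (u x) (Y x)) by apply/funext => t; rewrite mul1r.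
  rewrite /Omega omega0r mulr0; apply => i.
  by rewrite addr0 scale1r mul1r; exact: is_derive_entry (dY x).
exact: (is_derive_0_is_cst (f := fun x => Omega c x (u x) (Y x))).
Qed.

Lemma linear_solution_lin (R : realType) (A : R -> 'M[R]_4) (u v : R -> 'cV[R]_4)
    (a b : R) : linear_solution A u -> linear_solution A v ->
  linear_solution A (fun z => a *: u z + b *: v z).
Proof.
move=> du dv z; apply: is_derive_eq.
  exact: is_deriveD (is_deriveZ a (du z)) (is_deriveZ b (dv z)).
by rewrite mulmxDr !scalemxAr.
Qed.

(** Uniqueness by Gronwall's argument in both directions of time, from |S'| <= 8 K S for the sum of
    squares S. *)
Lemma linear_solution_eq0 (R : realType) (A : R -> 'M[R]_4) (Y : R -> 'cV[R]_4)
    (K z0 : R) : (forall z, l1 (A z) <= K) -> linear_solution A Y -> Y z0 = 0 ->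
  forall z, Y z = 0.
Proof.
move=> AK dY Y0 z.
have dYi (x : R) i : is_derive x 1 (fun t => Y t i 0) ((A x *m Y x) i 0).
  exact: is_derive_entry (dY x).
pose S (x : R) : R := \sum_i Y x i 0 ^+ 2.
pose dS (x : R) : R := 2 * \sum_i 1 * (Y x i 0 * (A x *m Y x) i 0).
have dSE (x : R) : is_derive x 1 S (dS x).
  have dd := is_derive_sum_fun (fun i => is_deriveM_fun (dYi x i) (dYi x i)).
  apply: (is_derive_eq dd).
  rewrite /dS mulr_sumr; apply: eq_bigr => i _.
  ring.
have K0 : 0 <= K by rewrite (le_trans (l1_ge0 _) (AK 0)).
have S0 x : 0 <= S x by apply: sumr_ge0 => i _; exact: sqr_ge0.
have dSl x : `|dS x| <= 8 * K * S x.
  have FL i : `|(A x *m Y x) i 0| <= K * l1 (Y x).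
    rewrite (le_trans (ler_l1 _ i 0))// (le_trans (l1M _ _))//.
    by rewrite ler_wpM2r ?l1_ge0.
  have := sum_weighted_le (w := fun=> 1) (e := fun i => (A x *m Y x) i 0) (m := 1)
      (fun i => Y x i 0) (fun=> ltac:(by rewrite normr1)) FL.
  rewrite -l1_col mul1r -mulrA -expr2 => p1.
  have p2 : l1 (Y x) ^+ 2 <= 4 * S x.
    by rewrite l1_col; exact: sum_norm_sqr_le (fun i => Y x i 0).
  have p3 := ler_wpM2l K0 p2.
  rewrite /dS normrM (gtr0_norm (_ : 0 < 2))//; move: p1 p3; clear; lra.
have Sz0 : S z0 = 0.
  by rewrite /S Y0; apply: big1 => i _; rewrite mxE expr0n.
suff Sz : S z = 0.
  apply/matrixP => i j; rewrite ord1 [RHS]mxE; apply/eqP.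
  rewrite -sqrf_eq0; apply/eqP.
  exact: (psumr_eq0P (fun i _ => sqr_ge0 (Y z i 0)) Sz).
apply/eqP; rewrite eq_le S0 andbT.
have [zz|zz] := lerP z z0.
  rewrite -(@pmulr_lle0 _ (expR (8 * K * z))) ?expR_gt0//.
  have -> : 0 = S z0 * expR (8 * K * z0) by rewrite Sz0 mul0r.
  apply: (@le_of_derive_ge0 _ (fun x => S x * expR (8 * K * x))
     (fun x => dS x * expR (8 * K * x) + S x * (8 * K * expR (8 * K * x)))) => // x _.
    exact: is_deriveM_fun (dSE x) (is_derive_expM _ _).
  rewrite mulrA [S x * _]mulrC -mulrDl mulr_ge0 ?expR_ge0//.
  by have := dSl x; rewrite ler_norml => /andP[]; clear; lra.
rewrite -(@pmulr_lle0 _ (expR (- (8 * K) * z))) ?expR_gt0//.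
rewrite -oppr_ge0.
have -> : 0 = - (S z0 * expR (- (8 * K) * z0)) by rewrite Sz0 mul0r oppr0.
apply: (@le_of_derive_ge0 _ (fun x => - (S x * expR (- (8 * K) * x)))
   (fun x => - (dS x * expR (- (8 * K) * x) +
      S x * (- (8 * K) * expR (- (8 * K) * x))))) => [|x _|x _]; first exact: ltW.
  exact: is_deriveN_fun (is_deriveM_fun (dSE x) (is_derive_expM _ _)).
rewrite mulrA [S x * _]mulrC -mulrDl -mulNr mulr_ge0 ?expR_ge0//.
by have := dSl x; rewrite ler_norml => /andP[]; clear; lra.
Qed.

(** * Limits and exponential bounds at the two ends *)

Lemma cvg_entry (R : realType) (T : Type) (F : set_system T) {FF : Filter F} m n
    (M : T -> 'M[R]_(m.+1, n.+1)) (l : 'M[R]_(m.+1, n.+1)) i j :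
  M x @[x --> F] --> l -> M x i j @[x --> F] --> l i j.
Proof.
move=> Ml.
exact: (cvg_comp M (fun N : 'M[R]_(_, _) => N i j) Ml (@coord_continuous R _ _ i j l)).
Qed.

Lemma cvg_omega (R : realType) (T : Type) (F : set_system T) {FF : Filter F}
    (u v : T -> 'cV[R]_4) (a b : 'cV[R]_4) :
  u x @[x --> F] --> a -> v x @[x --> F] --> b ->
  omega (u x) (v x) @[x --> F] --> omega a b.
Proof.
move=> ua vb; apply: cvgB; apply: cvgB; apply: cvgM; exact: cvg_entry.
Qed.

Lemma cvg_det4 (R : realType) (T : Type) (F : set_system T) {FF : Filter F}
    (u v w x : T -> 'cV[R]_4) (a b c d : 'cV[R]_4) :
  u t @[t --> F] --> a -> v t @[t --> F] --> b -> w t @[t --> F] --> c ->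
  x t @[t --> F] --> d ->
  det4 (u t) (v t) (w t) (x t) @[t --> F] --> det4 a b c d.
Proof.
move=> ua vb wc xd; rewrite det4E.
have -> : (fun t => det4 (u t) (v t) (w t) (x t)) = (fun t =>
   omega (u t) (v t) * omega (w t) (x t) - omega (u t) (w t) * omega (v t) (x t)
   + omega (u t) (x t) * omega (v t) (w t)).
  by apply/funext => t; rewrite det4E.
by apply: cvgD; first apply: cvgB; apply: cvgM; exact: cvg_omega.
Qed.

Lemma linear_solution_cvg (R : realType) (A : R -> 'M[R]_4) (Y : R -> 'cV[R]_4) (z : R) :
  linear_solution A Y -> Y x @[x --> z] --> Y z.
Proof.
move=> /(_ z)[dY _]; exact/differentiable_continuous/derivable1_diffP.
Qed.

Lemma l1_le_norm (R : realType) m n (M : 'M[R]_(m.+1, n.+1)) :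
  l1 M <= (m.+1 * n.+1)%:R * `|M|.
Proof.
apply: (@le_trans _ _ (\sum_(i < m.+1) \sum_(j < n.+1) `|M|)).
  by apply: ler_sum => i _; apply: ler_sum => j _; exact: ler_entry_norm.
by rewrite !sumr_const !card_ord -mulrnA mulnC mulr_natl.
Qed.

Lemma continuous_bounded_ninfty (R : realType) (h : R -> R) (l : R) :
  continuous h -> h z @[z --> -oo] --> l ->
  exists2 M, 0 <= M & forall z, z <= 0 -> `|h z| <= M.
Proof.
move=> ch hl.
have /cvgrPdist_le /(_ _ ltr01) [T [_ HT]] := hl.
have [K K0 HK] := continuous_bounded_itv `|T| ch.
exists (K + (`|l| + 1)); first by rewrite !addr_ge0.
move=> z z0; have [zT|zT] := ltrP z T.
  have := HT z zT; rewrite /= distrC => h1.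
  have := ler_normD (h z - l) l; rewrite subrK; move: h1 K0; clear; lra.
rewrite (le_trans (HK z _)) ?lerDl ?addr_ge0//.
by rewrite ler0_norm// ler0_norm ?(le_trans zT)// lerN2.
Qed.

Lemma bounded_exp_ninfty (R : realType) (u : R -> 'cV[R]_4) (m : R) (eta : 'cV[R]_4) :
  continuous u -> expR (- (m * z)) *: u z @[z --> -oo] --> eta ->
  exists2 M, 0 <= M & forall z, z <= 0 -> l1 (u z) <= M * expR (m * z).
Proof.
move=> cu ueta.
have cl (F : set_system R) (FF : Filter F) (v : R -> 'cV[R]_4) (w : 'cV[R]_4) :
    v z @[z --> F] --> w -> l1 (v z) @[z --> F] --> l1 w.
  move=> vw; rewrite l1_cV4.
  have -> : (fun z => l1 (v z)) = (fun z => `|v z 0 0| + `|v z 1 0| + `|v z 2 0| + `|v z 3 0|).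
    by apply/funext => z; rewrite l1_cV4.
  by apply: cvgD; [apply: cvgD; [apply: cvgD|]|]; apply: cvg_norm; exact: cvg_entry.
have [|M M0 HM] := continuous_bounded_ninfty _ (cl _ _ _ _ ueta).
  move=> z; apply: cl; apply: cvgZ; last exact: cu.
  have -> : (fun x : R => expR (- (m * x))) = (fun x => expR ((- m) * x)).
    by apply/funext => x; rewrite mulNr.
  rewrite -mulNr; exact: is_derive_continuous (is_derive_expM (- m) z).
exists M => // z z0; have := HM z z0; rewrite ger0_norm ?l1_ge0// l1Z.
rewrite ger0_norm ?expR_ge0// expRN mulrC ler_pdivrMr ?expR_gt0//.
Qed.

Lemma bounded_exp_pinfty (R : realType) (u : R -> 'cV[R]_4) (m : R) (eta : 'cV[R]_4) :
  continuous u -> expR (- (m * z)) *: u z @[z --> +oo] --> eta ->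
  exists2 M, 0 <= M & forall z, 0 <= z -> l1 (u z) <= M * expR (m * z).
Proof.
move=> cu ueta.
have [||M M0 HM] := @bounded_exp_ninfty R (fun z => u (- z)) (- m) eta.
- by move=> z; apply: cvg_comp; [exact: opp_continuous|exact: cu].
- move: ueta; rewrite -ninftyN => h.
  have -> : (fun z : R => expR (- (- m * z)) *: u (- z)) =
     (fun z : R => expR (- (m * z)) *: u z) \o -%R.
    by apply/funext => z /=; rewrite mulNr mulrN.
  by apply: cvg_comp h.
exists M => // z z0; have := HM (- z); rewrite opprK mulrNN; apply.
by rewrite oppr_le0.
Qed.

Lemma omega_le (R : realType) (u v : 'cV[R]_4) : `|omega u v| <= l1 u * l1 v.
Proof.
rewrite /omega !l1_cV4.
move: (u 0 0) (u 1 0) (u 2 0) (u 3 0) (v 0 0) (v 1 0) (v 2 0) (v 3 0).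
move=> a0 a1 a2 a3 b0 b1 b2 b3.
have n (a b : R) : - (`|a| * `|b|) <= a * b <= `|a| * `|b|.
  by rewrite -ler_norml normrM.
have p (a b : R) : 0 <= `|a| * `|b| by rewrite mulr_ge0.
move: (n a0 b2) (n a2 b0) (n a1 b3) (n a3 b1) => /andP[? ?] /andP[? ?] /andP[? ?] /andP[? ?].
have := (p a0 b0, p a0 b1, p a0 b3, p a1 b0, p a1 b1, p a1 b2, p a2 b1, p a2 b2,
   p a2 b3, p a3 b0, p a3 b2, p a3 b3).
move=> [[[[[[[[[[[q1 q2] q3] q4] q5] q6] q7] q8] q9] q10] q11] q12].
by rewrite ler_norml; apply/andP; split; clear n p; lra.
Qed.

Lemma const_exp_eq0 (R : realType) (x k M : R) : 0 < k ->
  (forall z, z <= 0 -> `|x| <= M * expR (k * z)) -> x = 0.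
Proof.
move=> k0 H; have := cvg_exp_bounded_ninfty (f := fun=> x) k0 H.
by move=> /(cvg_unique _ (@cvg_cst _ _ _ _ _)) ->.
Qed.

(** * Crossings *)

Lemma omega_cvg_dnbhs (R : realType) (A : R -> 'M[R]_4) (u : R -> 'cV[R]_4)
    (e : 'cV[R]_4) (s : R) : linear_solution A u ->
  omega e (u z) @[z --> s^'] --> omega e (u s).
Proof.
move=> du; apply: cvg_omega; first exact: cvg_cst.
by move=> B /(linear_solution_cvg (z := s) du); rewrite /= !nbhs_simpl /=; exact: nbhs_dnbhs.
Qed.

Lemma omega_quot_cvg (R : realType) (A : R -> 'M[R]_4) (u : R -> 'cV[R]_4)
    (e : 'cV[R]_4) (s : R) : linear_solution A u -> omega e (u s) = 0 ->
  omega e (u z) / (z - s) @[z --> s^'] --> omega e (A s *m u s).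
Proof.
move=> du e0.
have dw : is_derive s 1 (fun z => omega e (u z)) (omega e (A s *m u s)).
  have h := @is_derive_omega R (fun=> e) u 0 (A s *m u s) s.
  have -> : omega e (A s *m u s) = omega 0 (u s) + omega e (A s *m u s).
    by rewrite [omega 0 _]omegaC omega0r oppr0 add0r.
  apply: h => i; last exact: is_derive_entry (du s).
  by rewrite mxE; exact: is_derive_cst.
have := is_derive_cvg_quot dw; rewrite e0.
by under eq_fun do rewrite subr0.
Qed.

Lemma span2_cap_full (R : realType) (a b c d : 'cV[R]_4) :
  indep2 a b -> indep2 c d -> \dim (span2 c d :&: span2 a b) = 2%N ->
  (span2 c d :&: span2 a b)%VS = span2 c d /\
  (span2 c d :&: span2 a b)%VS = span2 a b.
Proof.
by move=> ab cd d2; split; apply/eqP; rewrite eqEdim ?capvSl ?capvSr d2 dim_span2.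
Qed.

Lemma quot_sqr_cvg (R : realType) (a b c d : R -> R) (la lb lc ld s : R) :
  a z / (z - s) @[z --> s^'] --> la -> b z / (z - s) @[z --> s^'] --> lb ->
  c z / (z - s) @[z --> s^'] --> lc -> d z / (z - s) @[z --> s^'] --> ld ->
  (- (a z * b z) + c z * d z) / (z - s) ^+ 2 @[z --> s^'] -->
    - (la * lb) + lc * ld.
Proof.
move=> ha hb hc hd.
have -> : (fun z => (- (a z * b z) + c z * d z) / (z - s) ^+ 2) =
  (fun z => - ((a z / (z - s)) * (b z / (z - s))) +
      (c z / (z - s)) * (d z / (z - s))).
  by apply/funext => z; rewrite expr2 invfM; ring.
by apply: cvgD; [apply: cvgN|]; apply: cvgM.
Qed.

(** For a one-dimensional crossing: one factor of each product, a and d, vanishes at s. In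
    [quot_sqr_cvg] all four do. *)
Lemma quot_cvg (R : realType) (a b c d : R -> R) (la lb lc ld s : R) :
  a z / (z - s) @[z --> s^'] --> la -> b z @[z --> s^'] --> lb ->
  c z @[z --> s^'] --> lc -> d z / (z - s) @[z --> s^'] --> ld ->
  (- (a z * b z) + c z * d z) / (z - s) ^+ 1 @[z --> s^'] -->
    - (la * lb) + lc * ld.
Proof.
move=> ha hb hc hd.
have -> : (fun z => (- (a z * b z) + c z * d z) / (z - s) ^+ 1) =
  (fun z => - ((a z / (z - s)) * b z) + c z * (d z / (z - s))).
  by apply/funext => z; rewrite expr1; ring.
by apply: cvgD; [apply: cvgN|]; apply: cvgM.
Qed.

Lemma singular_2x2 (R : realType) (a b c d : R) : - (a * d) + b * c = 0 ->
  exists p q : R, [/\ (p != 0) || (q != 0), p * a + q * b = 0 & p * c + q * d = 0].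
Proof.
move=> det0; have [b0|b0] := eqVneq b 0; last first.
  by exists b, (- a); split; [rewrite b0|lra|lra].
have [a0|a0] := eqVneq a 0; last first.
  by exists b, (- a); split; [rewrite oppr_eq0 a0 orbT|lra|lra].
have [d0|d0] := eqVneq d 0; last first.
  by exists d, (- c); split; [rewrite d0|rewrite a0 b0; lra|lra].
have [c0|c0] := eqVneq c 0; last first.
  by exists d, (- c); split; [rewrite oppr_eq0 c0 orbT|rewrite a0 b0; lra|lra].
by exists 1, 0; split; [rewrite oner_eq0|rewrite a0; lra|rewrite c0; lra].
Qed.

Lemma polar_crossing_form (R : realType) (A : R -> 'M[R]_4) (z : R)
    (x y : 'cV[R]_4) : polar_form (crossing_form A z) x y =
  (omega x (A z *m y) + omega y (A z *m x)) / 2.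
Proof.
by rewrite /polar_form /crossing_form mulmxDr !(omegaDl, omegaDr); ring.
Qed.

(* For a one-dimensional crossing, both bases are rotated so that their first
   vectors coincide with the crossing direction at z = s. *)
Lemma crossing_asymptotics (R : realType) (A : R -> 'M[R]_4) (c : R)
    (e1 e2 : 'cV[R]_4) (u3 u4 : R -> 'cV[R]_4) (s : R) :
  (forall z u y, omega (A z *m u) y + omega u (A z *m y) = - c * omega u y) ->
  linear_solution A u3 -> linear_solution A u4 ->
  indep2 e1 e2 -> omega e1 e2 = 0 ->
  indep2 (u3 s) (u4 s) -> omega (u3 s) (u4 s) = 0 ->
  let Eu z := span2 (u3 z) (u4 z) in
  let L := span2 e1 e2 in
  (crossing Eu L s -> regular_crossing A Eu L s) ->
  exists2 C, C != 0 &
    (- (omega e1 (u3 z) * omega e2 (u4 z)) + omega e1 (u4 z) * omega e2 (u3 z))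
      / (z - s) ^+ \dim (Eu s :&: L) @[z --> s^'] --> C.
Proof.
move=> HA du3 du4 e12 we u34 wu Eu L reg.
pose beta z := - (omega e1 (u3 z) * omega e2 (u4 z)) + omega e1 (u4 z) * omega e2 (u3 z).
have Llag x y : x \in L -> y \in L -> omega x y = 0.
  move=> /mem_span2[a [b ->]] /mem_span2[a' [b' ->]].
  by rewrite !(omegaDl, omegaDr, omegaZl, omegaZr) !omegaxx (omegaC e2 e1) we; ring.
have Elag x y : x \in Eu s -> y \in Eu s -> omega x y = 0.
  move=> /mem_span2[a [b ->]] /mem_span2[a' [b' ->]].
  by rewrite !(omegaDl, omegaDr, omegaZl, omegaZr) !omegaxx (omegaC (u4 s)) wu; ring.
have e1L : e1 \in L by apply/mem_span2; exists 1, 0; rewrite scale1r scale0r addr0.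
have e2L : e2 \in L by apply/mem_span2; exists 0, 1; rewrite scale1r scale0r add0r.
have u3E : u3 s \in Eu s by apply/mem_span2; exists 1, 0; rewrite scale1r scale0r addr0.
have u4E : u4 s \in Eu s by apply/mem_span2; exists 0, 1; rewrite scale1r scale0r add0r.
have dimE : \dim (Eu s) = 2%N by exact: dim_span2.
have d2 : (\dim (Eu s :&: L) <= 2)%N by rewrite (leq_trans (dimvS (capvSl _ _)))// dimE.
case: (ltngtP (\dim (Eu s :&: L)) 1) => dE.
- have cap0 : (Eu s :&: L)%VS == 0%VS.
    by rewrite -dimv_eq0; move: dE; rewrite ltnS leqn0.
  exists (beta s).
    have := span2_cap_neq0 e12 u34; rewrite -/(Eu s) -/L cap0 /= det4E we.
    by rewrite mul0r sub0r => /esym/negbT.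
  move: cap0; rewrite -dimv_eq0 => /eqP ->.
  have -> : (fun z => (- (omega e1 (u3 z) * omega e2 (u4 z)) +
      omega e1 (u4 z) * omega e2 (u3 z)) / (z - s) ^+ 0) = beta.
    by apply/funext => z; rewrite expr0 divr1.
  by apply: cvgD; [apply: cvgN|]; apply: cvgM; exact: omega_cvg_dnbhs.
(* The two planes coincide, so all four pairings vanish at s, and up to sign the limit is the
   determinant of the matrix omega(e_i, A u_j). A kernel vector of this matrix would give a vector
   in the kernel of the crossing form. *)
- have {}dE : \dim (Eu s :&: L) = 2%N by apply/eqP; rewrite eqn_leq d2.
  rewrite dE.
  have [capE capL] := span2_cap_full e12 u34 dE.
  have u3L : u3 s \in L by rewrite -[L]capL capE.
  have u4L : u4 s \in L by rewrite -[L]capL capE.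
  eexists; last first.
    by apply: quot_sqr_cvg; apply: (@omega_quot_cvg R A) => //; exact: Llag.
  apply/eqP => /singular_2x2[p [q [pq E1 E2]]].
  pose xi := p *: u3 s + q *: u4 s.
  have xiE : xi \in Eu s by apply/mem_span2; exists p, q.
  have xiC : xi \in (Eu s :&: L)%VS by rewrite capE.
  have xi0 : xi = 0.
    apply: reg => //; first by rewrite /crossing -dimv_eq0 dE.
    move=> y yC; rewrite polar_crossing_form.
    have yL : y \in L by rewrite -[L]capL.
    have xiL : xi \in L by rewrite -[L]capL.
    have xy : omega xi y = 0 by exact: Llag.
    have yx : omega y (A s *m xi) = 0.
      have /mem_span2[a [b ->]] := yL.
      rewrite omegaDl !omegaZl /xi mulmxDr -!scalemxAr !omegaDr !omegaZr.
      by rewrite E1 E2; ring.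
    (* The bilinear form omega(x, A y) is symmetric on a Lagrangian plane, by [HA]. *)
    have xay : omega xi (A s *m y) = 0.
      by have := HA s xi y; rewrite omegaC yx oppr0 add0r xy mulr0.
    by rewrite xay yx addr0 mul0r.
  have [p0 q0] := u34 _ _ xi0.
  by move: pq; rewrite p0 q0 eqxx.
- rewrite dE.
  pose xi := vpick (Eu s :&: L)%VS.
  have xi0 : xi != 0 by rewrite vpick0 -dimv_eq0 dE.
  have capE : (Eu s :&: L)%VS = <[xi]>%VS.
    apply/esym/eqP; rewrite eqEdim -memvE memv_pick dE dim_vline.
    by rewrite xi0.
  have := memv_pick (Eu s :&: L)%VS; rewrite -/xi memv_cap => /andP[xiE xiL].
  have Gxi : omega xi (A s *m xi) != 0.
    apply/eqP => G0; move/eqP: xi0; apply; apply: reg.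
    - by rewrite /crossing -dimv_eq0 dE.
    - by rewrite capE memv_line.
    - move=> y; rewrite capE => /vlineP[k ->].
      by rewrite polar_crossing_form -scalemxAr omegaZl omegaZr G0 mulr0 addr0 mul0r.
  have /mem_span2[a [b xiab]] := xiE.
  have /mem_span2[p [q xipq]] := xiL.
  pose U (z : R) : 'cV[R]_4 := a *: u3 z + b *: u4 z.
  pose V (z : R) : 'cV[R]_4 := (- b) *: u3 z + a *: u4 z.
  pose e' : 'cV[R]_4 := (- q) *: e1 + p *: e2.
  have dU : linear_solution A U by exact: linear_solution_lin.
  have dV : linear_solution A V by exact: linear_solution_lin.
  have e'L : e' \in L by apply/mem_span2; exists (- q), p.
  have VE : V s \in Eu s by apply/mem_span2; exists (- b), a.
  have Us : U s = xi by rewrite xiab.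
  (* The two changes of basis have determinants p^2 + q^2 and a^2 + b^2; as beta is alternating in
     e1, e2 and in u3, u4, it gets multiplied by their product. *)
  pose m : R := (p ^+ 2 + q ^+ 2) * (a ^+ 2 + b ^+ 2).
  have sq0 (x y : R) (v w : 'cV[R]_4) : xi = x *: v + y *: w -> x ^+ 2 + y ^+ 2 != 0.
    move=> E; apply/eqP => /eqP; rewrite paddr_eq0 ?sqr_ge0// !sqrf_eq0.
    by move=> /andP[/eqP x0 /eqP y0]; move: xi0; rewrite E x0 y0 !scale0r addr0 eqxx.
  have m0 : m != 0 by rewrite mulf_neq0// (sq0 _ _ _ _ xipq, sq0 _ _ _ _ xiab).
  have ab0 := sq0 _ _ _ _ xiab; have pq0 := sq0 _ _ _ _ xipq.
  have betaE z : beta z / (z - s) ^+ 1 =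
      (- (omega xi (U z) * omega e' (V z)) + omega xi (V z) * omega e' (U z))
        / (z - s) ^+ 1 * m^-1.
    rewrite mulrAC; congr (_ / _); apply: (mulIf m0); rewrite mulfVK//.
    rewrite /beta /U /V /e' xipq /m.
    by rewrite !(omegaDl, omegaDr, omegaZl, omegaZr); ring.
  have xiV : omega xi (V s) = 0 by exact: Elag.
  have xiU : omega xi (U s) = 0 by rewrite Us omegaxx.
  have e'U : omega e' (U s) = 0 by rewrite Us; exact: Llag.
  (* At s the pairings of U with xi and e' and that of V with xi vanish, so only the first of the
     two products has a first-order term. *)
  have lim : beta z / (z - s) ^+ 1 @[z --> s^'] -->
     (- (omega xi (A s *m xi) * omega e' (V s))) / m.
    under eq_fun do rewrite betaE.
    apply: cvgM; last exact: cvg_cst.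
    have := quot_cvg (omega_quot_cvg dU xiU) (@omega_cvg_dnbhs R A V e' s dV)
      (@omega_cvg_dnbhs R A V xi s dV) (omega_quot_cvg dU e'U).
    by rewrite xiV mul0r addr0 Us.
  exists ((- (omega xi (A s *m xi) * omega e' (V s))) / m) => //.
  rewrite mulf_neq0 ?invr_eq0// oppr_eq0 mulf_neq0//.
  (* If this pairing vanished, V(s) would be orthogonal to all of L, hence in L by maximality, hence
     a multiple of xi = U(s), against the independence of u3 and u4. *)
  apply/eqP => e'V.
  have e1V : omega e1 (V s) = 0.
    apply: (mulfI pq0); rewrite mulr0.
    have -> : (p ^+ 2 + q ^+ 2) * omega e1 (V s) =
        p * omega xi (V s) - q * omega e' (V s).
      by rewrite xipq /e' !(omegaDl, omegaZl); ring.
    by rewrite xiV e'V; ring.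
  have e2V : omega e2 (V s) = 0.
    apply: (mulfI pq0); rewrite mulr0.
    have -> : (p ^+ 2 + q ^+ 2) * omega e2 (V s) =
        q * omega xi (V s) + p * omega e' (V s).
      by rewrite xipq /e' !(omegaDl, omegaZl); ring.
    by rewrite xiV e'V; ring.
  have VL : V s \in L by apply/mem_span2; exact: lagrangian_maximal.
  have : V s \in (Eu s :&: L)%VS by rewrite memv_cap VE.
  rewrite capE => /vlineP[k Vk].
  have /u34[k1 k2] : (- b - k * a) *: u3 s + (a - k * b) *: u4 s = 0.
    have : V s - k *: xi = 0 by rewrite Vk subrr.
    rewrite xiab /V scalerDr opprD addrACA !scalerA -!scalerBl.
    by [].
  have : (a ^+ 2 + b ^+ 2) = 0.
    by have : a * (a - k * b) - b * (- b - k * a) = 0; [rewrite k1 k2; ring|clear; lra].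
  by move/eqP; rewrite (negbTE ab0).
Qed.

(** * Transversality *)

(** The evolution equation at time t = 0 is the profile equation: there the x-derivatives are those
    of the profile, and the time derivative is -c times its first derivative. *)
Lemma wave_profile (R : realType) (f g : R -> R) (sigma alpha c : R)
    (uh vh : R -> R) : 0 < sigma -> 0 < alpha ->
  traveling_wave f g sigma alpha c uh vh ->
  let W z := derive1 uh z / sigma in let Y z := derive1 vh z / alpha in
  [/\ forall z : R, is_derive z 1 uh (sigma * W z),
      forall z : R, is_derive z 1 vh (alpha * Y z),
      forall z : R, is_derive z 1 W (- (c * W z) - f (uh z) / sigma + vh z) &
      forall z : R, is_derive z 1 Y (- (c * Y z) - uh z - g (vh z) / alpha)].
Proof.
move=> sigma0 alpha0 [[hu hv eqs] _ _] W Y.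
have sn0 : sigma != 0 by rewrite gt_eqF.
have an0 : alpha != 0 by rewrite gt_eqF.
have E (h : R -> R) : (fun x : R => h (x - c * 0)) = h.
  by apply/funext => x; rewrite mulr0 subr0.
have du (z : R) : is_derive z 1 uh (derive1 uh z).
  by apply: derivable1_is_derive; have [_ + _] := hu z 0; rewrite E.
have dv (z : R) : is_derive z 1 vh (derive1 vh z).
  by apply: derivable1_is_derive; have [_ + _] := hv z 0; rewrite E.
have ddu (z : R) : is_derive z 1 (derive1 uh) (derive1 (derive1 uh) z).
  by apply: derivable1_is_derive; have [_ _] := hu z 0; rewrite E.
have ddv (z : R) : is_derive z 1 (derive1 vh) (derive1 (derive1 vh) z).
  by apply: derivable1_is_derive; have [_ _] := hv z 0; rewrite E.
have dt (h : R -> R) (dh : R -> R) (z : R) : (forall z : R, is_derive z 1 h (dh z)) ->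
    derive1 (fun t : R => h (z - c * t)) 0 = - c * dh z.
  move=> hd; rewrite derive1E.
  have d1 : is_derive (0 : R) 1 (fun t : R => z - c * t) (- c).
    have dd := is_deriveB_fun (is_derive_cst z (0 : R) 1)
      (is_deriveZ_fun c (is_derive_id (0 : R) 1)).
    by apply: (is_derive_eq dd); rewrite sub0r mulr1.
  have d2 : is_derive (z - c * 0) 1 h (dh z) by rewrite mulr0 subr0.
  have d3 := @is_derive1_comp R h (fun t : R => z - c * t) 0 _ _ d2 d1.
  by rewrite mulNr mulrC -mulrN; apply: (@derive_val _ _ _ _ _ _ _ d3).
split.
- by move=> z; rewrite /W mulrCA divff// mulr1.
- by move=> z; rewrite /Y mulrCA divff// mulr1.
- move=> z; have [] := eqs z 0; rewrite (dt _ _ z du) !E mulr0 subr0 => eq1 _.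
  have -> : W = (fun z => sigma^-1 * derive1 uh z) by apply/funext => x; rewrite /W mulrC.
  apply: is_derive_eq (is_deriveZ_fun _ (ddu z)) _.
  have -> : derive1 (derive1 uh) z = - c * derive1 uh z - f (uh z) + sigma * vh z.
    by rewrite eq1; ring.
  by field.
- move=> z; have [_] := eqs z 0; rewrite (dt _ _ z dv) !E mulr0 subr0 => eq1.
  have -> : Y = (fun z => alpha^-1 * derive1 vh z) by apply/funext => x; rewrite /Y mulrC.
  apply: is_derive_eq (is_deriveZ_fun _ (ddv z)) _.
  have -> : derive1 (derive1 vh) z = - c * derive1 vh z - g (vh z) - alpha * uh z.
    by rewrite eq1; ring.
  by field.
Qed.

(* For sg = 1 the vectors a below are tangent to the centre-unstable manifold,
   for sg = -1 to the centre-stable one. The covector Omega(u, _) solves the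
   adjoint equation and, taken at sg z, decays exponentially as z -> -oo. *)
Lemma half_line_functional (R : realType) (f g : R -> R)
    (sigma alpha c sg B k0 M : R) (U V W Y : R -> R) (Ai P Q : 'M[R]_4)
    (mu : 'rV[R]_4) (u : R -> 'cV[R]_4) :
  let F := augmented_field f g sigma alpha in
  let p := colv 5 [:: 0; 0; 0; 0; c] : 'cV[R]_5 in
  let q := colv 5 [:: U 0; V 0; W 0; Y 0; c] : 'cV[R]_5 in
  let A := A0 f g sigma alpha c U V in
  C2 f -> C2 g -> 0 < sigma -> 0 < alpha -> `|sg| = 1 ->
  (forall z : R, is_derive z 1 U (sigma * W z)) ->
  (forall z : R, is_derive z 1 V (alpha * Y z)) ->
  (forall z : R, is_derive z 1 W (- (c * W z) - f (U z) / sigma + V z)) ->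
  (forall z : R, is_derive z 1 Y (- (c * Y z) - U z - g (V z) / alpha)) ->
  (forall z, [/\ `|U z| <= B, `|V z| <= B, `|W z| <= B & `|Y z| <= B]) ->
  (forall e, 0 < e -> exists T, forall z, z <= - T ->
    [/\ `|U (sg * z)| <= e, `|V (sg * z)| <= e, `|W (sg * z)| <= e
      & `|Y (sg * z)| <= e]) ->
  (exists K, forall z, l1 (A z) <= K) ->
  (forall e, 0 < e -> exists2 T, 0 <= T &
     forall z, z <= - T -> l1 (A (sg * z) - Ai) <= e) ->
  P *m Q = 1%:M -> Q *m Ai = diag_mx mu *m Q -> (forall i, mu 0 i != 0) ->
  linear_solution A u -> 0 < k0 -> 0 <= M ->
  (forall z, z <= 0 -> expR (c * (sg * z)) * l1 (u (sg * z)) <= M * expR (k0 * z)) ->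
  exists k, forall a : 'cV[R]_5,
  (forall e, 0 < e -> exists T N, tangent_vector N q a /\
     forall q', N q' -> exists X : R -> 'cV[R]_5, [/\ X 0 = q',
       forall z : R, z <= 0 -> forall i,
         is_derive z 1 (fun x => X x i 0) (sg * F (X z) i 0) &
       forall z, z <= - T -> `|X z - p| <= e]) ->
  omega (u 0) (colv 4 [:: a 0 0; a 1 0; a 2 0; a 3 0]) = a 4 0 * k.
Proof.
move=> F p q A C2f C2g sigma0 alpha0 sg1 dU dV dW dY bd lim0 [K AK] AT PQ QA mu0.
move=> du k00 M0 uM.
pose Ab z := sg *: A (sg * z).
pose r z := sg *: colv 4 [:: 0; 0; W (sg * z); Y (sg * z)].
pose L z v := Omega c (sg * z) (u (sg * z)) v.
have B0 : 0 <= B by have [+ _ _ _] := bd 0; apply: le_trans.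
have K0 : 0 <= K by rewrite (le_trans (l1_ge0 _) (AK 0)).
pose K' : R := K + l1 Ai + 2 * B.
have K'0 : 0 <= K' by rewrite !addr_ge0 ?l1_ge0 ?mulr_ge0.
have rK z : z <= 0 -> l1 (r z) <= K'.
  move=> _; rewrite l1Z sg1 mul1r l1_cV4 !mxE /= normr0.
  by have [_ _] := bd (sg * z); have := l1_ge0 Ai; move: K0; rewrite /K'; clear; lra.
have sgA z : l1 (Ab z - sg *: Ai) = l1 (A (sg * z) - Ai).
  by rewrite -scalerBr l1Z sg1 mul1r.
have sg0 : sg != 0 by rewrite -normr_eq0 sg1 oner_eq0.
have hw : has_weight Ab r k0.
  apply: (@approx_solution_weight R Ab r (sg *: Ai) P Q (sg *: mu) K' k0) => //.
  - rewrite -scalemxAr QA scalemxAl; congr (_ *m _).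
    by apply/matrixP => i j; rewrite !mxE mulrnAr.
  - by move=> i; rewrite mxE mulf_neq0.
  - move=> z _; rewrite sgA (le_trans (l1D _ _))// l1N.
    by have := AK (sg * z); move: B0; rewrite /K'; clear; lra.
  - move=> e e0; have [T T0 HT] := AT e e0; exists T => // z zT.
    by rewrite sgA HT.
have [k Hk] : exists k, forall a d, variational_limit Ab r a d -> L 0 a = d * k.
  apply: variational_limit_line.
  apply: (variational_limit_pairing hw K'0 M0 rK).
  - by move=> z v w D; rewrite /L /Omega omegaDr omegaNr omegaZr; ring.
  - move=> z v z0; rewrite /L /Omega normrM ger0_norm ?expR_ge0//.
    rewrite (le_trans (ler_wpM2l (expR_ge0 _) (omega_le _ _)))// [leLHS]mulrA.
    by rewrite ler_wpM2r ?l1_ge0// uM.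
  - move=> X G z z0 dX; exact: is_derive_Omega.
exists k => a ta.
have := Hk (colv 4 [:: a 0 0; a 1 0; a 2 0; a 3 0]) (a 4 0).
rewrite /L /Omega !mulr0 expR0 mul1r; apply.
exact: (tangent_variational_limit C2f C2g sigma0 alpha0 sg1 dU dV dW dY bd lim0 ta).
Qed.

(** Each covector omega(w, _) is a multiple of dc on both tangent spaces, but possibly with
    different multiples. Two independent covectors leave room to cancel this difference: a
    nontrivial combination plus m5 dc annihilates both spaces, hence all of R^5, which forces m3 w3
    + m4 w4 = 0. *)
Lemma tangents_not_transverse (R : realType) (w3 w4 : 'cV[R]_4)
    (Ta Tb : 'cV[R]_5 -> Prop) (k3 k4 l3 l4 : R) : indep2 w3 w4 ->
  (let low (a : 'cV[R]_5) : 'cV[R]_4 := colv 4 [:: a 0 0; a 1 0; a 2 0; a 3 0] in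
   [/\ forall a, Ta a -> omega w3 (low a) = a 4 0 * k3,
    forall a, Ta a -> omega w4 (low a) = a 4 0 * k4,
    forall b, Tb b -> omega w3 (low b) = b 4 0 * l3 &
    forall b, Tb b -> omega w4 (low b) = b 4 0 * l4]) ->
  ~ (forall v, exists a b, [/\ Ta a, Tb b & v = a + b]).
Proof.
move=> w34 [Ta3 Ta4 Tb3 Tb4] H.
have [m3 [m4 [m5 [m0 E1 E2]]]] : exists m3 m4 m5 : R, [/\ (m3 != 0) || (m4 != 0),
    m3 * k3 + m4 * k4 + m5 = 0 & m3 * l3 + m4 * l4 + m5 = 0].
  have [kl4|kl4] := eqVneq k4 l4; last first.
    exists (k4 - l4), (l3 - k3), (- ((k4 - l4) * k3 + (l3 - k3) * k4)).
    by split; [rewrite subr_eq0 kl4|ring|ring].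
  by exists 0, 1, (- k4); split; [rewrite oner_eq0 orbT|ring|rewrite kl4; ring].
have w0 : m3 *: w3 + m4 *: w4 = 0.
  apply: omega_nondegenerate => x.
  have [a [b [aT bT vE]]] := H (colv 5 [:: x 0 0; x 1 0; x 2 0; x 3 0; 0]).
  pose low (a : 'cV[R]_5) : 'cV[R]_4 := colv 4 [:: a 0 0; a 1 0; a 2 0; a 3 0].
  have xE : x = low a + low b.
    apply/matrixP => i j; rewrite ord1 mxE.
    have vi k : (colv 5 [:: x 0 0; x 1 0; x 2 0; x 3 0; 0]) k 0 = a k 0 + b k 0.
      by rewrite vE mxE.
    have := vi 0; have := vi 1; have := vi 2; have := vi 3; rewrite !mxE /=.
    move=> v3 v2 v1 v0; move: i; apply: ord4_ind => /=;
      by [exact: v0|exact: v1|exact: v2|exact: v3].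
  have ab4 : a 4 0 + b 4 0 = 0.
    have : (colv 5 [:: x 0 0; x 1 0; x 2 0; x 3 0; 0]) 4 0 = a 4 0 + b 4 0.
      by rewrite vE mxE.
    by rewrite mxE /= => <-.
  have b4 : b 4 0 = - a 4 0 by move: ab4; clear; lra.
  rewrite xE omegaDl !omegaZl !omegaDr (Ta3 _ aT) (Ta4 _ aT) (Tb3 _ bT) (Tb4 _ bT).
  rewrite b4.
  have -> : m3 * (a 4 0 * k3 + - a 4 0 * l3) + m4 * (a 4 0 * k4 + - a 4 0 * l4) =
    a 4 0 * ((m3 * k3 + m4 * k4 + m5) - (m3 * l3 + m4 * l4 + m5)) by ring.
  by rewrite E1 E2; ring.
have [m30 m40] := w34 _ _ w0.
by move: m0; rewrite m30 m40 eqxx.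
Qed.

(** * Bounds, Lagrangian property and independence from the behaviour at infinity *)

Lemma A0_bounded (R : realType) (f g : R -> R) (sigma alpha c B : R)
    (U V : R -> R) : C2 f -> C2 g -> 0 < sigma -> 0 < alpha ->
  (forall z, `|U z| <= B) -> (forall z, `|V z| <= B) ->
  exists K, forall z, l1 (A0 f g sigma alpha c U V z) <= K.
Proof.
move=> C2f C2g sigma0 alpha0 UB VB.
have [Kf Kf0 HKf] := C2_taylor B C2f; have [Kg Kg0 HKg] := C2_taylor B C2g.
exists (sigma + alpha + 2 * `|c| + 2 + Kf / sigma + Kg / alpha) => z.
rewrite /l1 !sum_ord4 !mxE /= !normrN !normr0 !normr1 !normrM !normfV.
rewrite (gtr0_norm sigma0) (gtr0_norm alpha0).
have n0 : `|0 : R| <= 1 by rewrite normr0.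
have [f1 _] := HKf _ 0 (UB z) n0; have [g1 _] := HKg _ 0 (VB z) n0.
have u1 : `|derive1 f (U z)| / sigma <= Kf / sigma.
  by rewrite ler_wpM2r// invr_ge0 ltW.
have u2 : `|derive1 g (V z)| / alpha <= Kg / alpha.
  by rewrite ler_wpM2r// invr_ge0 ltW.
by move: u1 u2; clear; lra.
Qed.

(** [Omega] is constant along pairs of solutions and of order exp((c + m + m') z), which tends to 0
    at -oo. *)
Lemma omega_eq0_ninfty (R : realType) (f g : R -> R) (sigma alpha c : R)
    (U V : R -> R) (u v : R -> 'cV[R]_4) (m m' M M' : R) :
  let A := A0 f g sigma alpha c U V in
  linear_solution A u -> linear_solution A v -> 0 < c + m + m' ->
  (forall z, z <= 0 -> l1 (u z) <= M * expR (m * z)) ->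
  (forall z, z <= 0 -> l1 (v z) <= M' * expR (m' * z)) ->
  forall z, omega (u z) (v z) = 0.
Proof.
move=> A du dv mm uM vM z.
suff : Omega c z (u z) (v z) = 0.
  by move=> /eqP; rewrite mulf_eq0 gt_eqF ?expR_gt0//= => /eqP.
apply: (const_exp_eq0 (M := M * M') mm) => x x0.
rewrite (@Omega_const R f g sigma alpha c U V u v z x du dv) /Omega normrM.
rewrite ger0_norm ?expR_ge0//.
have -> : M * M' * expR ((c + m + m') * x) =
    expR (c * x) * ((M * expR (m * x)) * (M' * expR (m' * x))).
  by rewrite !mulrDl !expRD; ring.
rewrite ler_wpM2l ?expR_ge0// (le_trans (omega_le _ _))// ler_pM ?l1_ge0//.
  exact: uM.
exact: vM.
Qed.

Lemma omega_eq0_pinfty (R : realType) (f g : R -> R) (sigma alpha c : R)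
    (U V : R -> R) (u v : R -> 'cV[R]_4) (m m' M M' : R) :
  let A := A0 f g sigma alpha c U V in
  linear_solution A u -> linear_solution A v -> c + m + m' < 0 ->
  (forall z, 0 <= z -> l1 (u z) <= M * expR (m * z)) ->
  (forall z, 0 <= z -> l1 (v z) <= M' * expR (m' * z)) ->
  forall z, omega (u z) (v z) = 0.
Proof.
move=> A du dv mm uM vM z.
suff : Omega c z (u z) (v z) = 0.
  by move=> /eqP; rewrite mulf_eq0 gt_eqF ?expR_gt0//= => /eqP.
have mm' : 0 < - (c + m + m') by rewrite oppr_gt0.
apply: (const_exp_eq0 (M := M * M') mm') => x x0.
rewrite (@Omega_const R f g sigma alpha c U V u v z (- x) du dv) /Omega normrM.
rewrite ger0_norm ?expR_ge0//.
have -> : M * M' * expR (- (c + m + m') * x) =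
    expR (c * - x) * ((M * expR (m * - x)) * (M' * expR (m' * - x))).
  by rewrite mulNr -mulrN !mulrDl !expRD; ring.
have x0' : 0 <= - x by rewrite oppr_ge0.
rewrite ler_wpM2l ?expR_ge0// (le_trans (omega_le _ _))// ler_pM ?l1_ge0//.
  exact: uM.
exact: vM.
Qed.

Lemma det4_swap (R : realType) (a b c d : 'cV[R]_4) : det4 a b c d = det4 c d a b.
Proof.
rewrite !det4E (omegaC c a) (omegaC d b) (omegaC c b) (omegaC d a); ring.
Qed.

Lemma det4_scale (R : realType) (a b c d : 'cV[R]_4) (x y : R) :
  det4 a b (x *: c) (y *: d) = x * y * det4 a b c d.
Proof. by rewrite !det4E !(omegaZl, omegaZr); ring. Qed.

Lemma indep2_det4 (R : realType) (a b c d : 'cV[R]_4) :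
  det4 a b c d != 0 -> indep2 c d.
Proof.
move=> D x y E; apply: contrapT => xy; move/eqP: D; apply.
apply/det4_dependent; exists 0, 0, x, y; rewrite !scale0r !add0r; split=> //.
have [x0|] := eqVneq x 0; last by constructor 3.
have [y0|] := eqVneq y 0; last by constructor 4.
by case: xy.
Qed.

(** A combination that vanishes at one point vanishes everywhere, so the determinant of a, b and the
    rescaled u, v would be identically 0 and could not tend to det(a, b, e, e'). The vectors a, b
    serve to complete e, e' to a basis. *)
Lemma indep2_asymptotics (R : realType) (F : set_system R) {FF : ProperFilter F}
    (A : R -> 'M[R]_4) (K : R) (u v : R -> 'cV[R]_4) (s t : R -> R)
    (a b e e' : 'cV[R]_4) :
  (forall z, l1 (A z) <= K) -> linear_solution A u -> linear_solution A v ->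
  det4 a b e e' != 0 ->
  s z *: u z @[z --> F] --> e -> t z *: v z @[z --> F] --> e' ->
  forall z, indep2 (u z) (v z).
Proof.
move=> AK du dv D ue ve z x y E.
have E' w := linear_solution_eq0 AK (linear_solution_lin x y du dv) E w.
apply: contrapT => xy; move/eqP: D; apply.
have lim : det4 a b (s z *: u z) (t z *: v z) @[z --> F] --> det4 a b e e'.
  by apply: cvg_det4 ue ve; exact: cvg_cst.
have : det4 a b (s z *: u z) (t z *: v z) @[z --> F] --> (0 : R).
  have -> : (fun z => det4 a b (s z *: u z) (t z *: v z)) = (fun=> 0).
    apply/funext => w; rewrite det4_scale.
    suff -> : det4 a b (u w) (v w) = 0 by rewrite mulr0.
    apply/det4_dependent; exists 0, 0, x, y; rewrite !scale0r !add0r E'; split=> //.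
    have [x0|] := eqVneq x 0; last by constructor 3.
    have [y0|] := eqVneq y 0; last by constructor 4.
    by case: xy.
  exact: cvg_cst.
by move=> lim0; exact: (cvg_unique (@Rhausdorff R) lim lim0).
Qed.

Lemma near_ninfty_ex (R : realType) (P : R -> Prop) :
  (\forall z \near -oo, P z) -> exists2 T, 0 <= T & forall z, z <= - T -> P z.
Proof.
move=> [T [_ HT]]; exists (`|T| + 1); first by rewrite addr_ge0.
move=> z zT; apply: HT; have := ler_norm (- T); rewrite normrN; move: zT; clear; lra.
Qed.

Lemma cvg_matrix_ex (R : realType) (A : R -> 'M[R]_4) (Ai : 'M[R]_4) :
  A z @[z --> -oo] --> Ai -> forall e, 0 < e ->
  exists2 T, 0 <= T & forall z, z <= - T -> l1 (A z - Ai) <= e.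
Proof.
move=> /cvgrPdist_le H e e0; apply: near_ninfty_ex.
have e16 : 0 < e / (4 * 4)%:R by rewrite divr_gt0.
have := H _ e16; apply: filterS => z; rewrite distrC => h.
rewrite (le_trans (l1_le_norm _))// mulrC -ler_pdivlMr//.
Qed.

Lemma eigen_basis (R : realType) (Ai : 'M[R]_4) (a b c d : 'cV[R]_4)
    (ma mb mc md : R) :
  eigenvector Ai ma a -> eigenvector Ai mb b -> eigenvector Ai mc c ->
  eigenvector Ai md d -> det4 a b c d != 0 ->
  exists P Q : 'M[R]_4, P *m Q = 1%:M /\
    Q *m Ai = diag_mx (\row_j [:: ma; mb; mc; md]`_j) *m Q.
Proof.
move=> [_ Ea] [_ Eb] [_ Ec] [_ Ed] D.
pose P : 'M[R]_4 := \matrix_(i < 4, j < 4) (nth 0 [:: a; b; c; d] j) i 0.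
have Pu : P \in unitmx by rewrite unitmxE unitfE.
exists P, (invmx P); split; first by rewrite mulmxV.
have AP : Ai *m P = P *m diag_mx (\row_j [:: ma; mb; mc; md]`_j).
  have colP (k : 'I_4) : col k P = nth 0 [:: a; b; c; d] k.
    by apply/matrixP => i j; rewrite ord1 !mxE.
  have H (k : 'I_4) : Ai *m nth 0 [:: a; b; c; d] k =
      [:: ma; mb; mc; md]`_k *: nth 0 [:: a; b; c; d] k.
    by move: k; apply: ord4_ind.
  apply/matrixP => i k; have := H k; rewrite -colP => /matrixP /(_ i 0) E.
  transitivity ((Ai *m col k P) i 0).
    by rewrite [LHS]mxE [RHS]mxE; apply: eq_bigr => j _; rewrite [col k P j 0]mxE.
  by rewrite E mul_mx_diag !mxE mulrC.
by rewrite -[LHS]mulmx1 -(mulmxV Pu) mulmxA -(mulmxA (invmx P)) AP mulmxA mulVmx// mul1mx.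
Qed.

(* If omega(u1, u4) = 0 then E^s = E^u, so both u3 and u4 yield functionals as
   in half_line_functional on both half lines, which contradicts
   transversality. *)
Lemma transverse_pairing_neq0 (R : realType) (f g : R -> R)
    (sigma alpha c k M K m1 m2 m3 m4 : R) (uh vh : R -> R) (Ai P Q : 'M[R]_4)
    (u1 u2 u3 u4 : R -> 'cV[R]_4) :
  let A := A0 f g sigma alpha c uh vh in
  C2 f -> C2 g -> 0 < sigma -> 0 < alpha -> c < 0 ->
  traveling_wave f g sigma alpha c uh vh ->
  transversely_constructed f g sigma alpha c uh vh ->
  m1 < m2 -> m2 < 0 -> 0 < m3 -> m3 < m4 -> m1 + m4 = - c -> m2 + m3 = - c ->
  (A z @[z --> +oo] --> Ai) -> (A z @[z --> -oo] --> Ai) ->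
  P *m Q = 1%:M -> Q *m Ai = diag_mx (\row_j [:: m1; m2; m3; m4]`_j) *m Q ->
  (forall z, l1 (A z) <= K) -> 0 < k -> 0 <= M ->
  (forall z, `|uh z| + `|vh z| <= M * expR (- (k * `|z|))) ->
  linear_solution A u1 -> linear_solution A u2 ->
  linear_solution A u3 -> linear_solution A u4 ->
  u2 = wave_velocity sigma alpha uh vh -> u3 = wave_velocity sigma alpha uh vh ->
  (forall z, 0 <= z -> l1 (u1 z) <= M * expR (m1 * z)) ->
  (forall z, 0 <= z -> l1 (u2 z) <= M * expR (m2 * z)) ->
  (forall z, z <= 0 -> l1 (u3 z) <= M * expR (m3 * z)) ->
  (forall z, z <= 0 -> l1 (u4 z) <= M * expR (m4 * z)) ->
  indep2 (u1 0) (u2 0) -> indep2 (u3 0) (u4 0) ->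
  omega (u1 0) (u2 0) = 0 -> omega (u3 0) (u4 0) = 0 ->
  omega (u1 0) (u4 0) != 0.
Proof.
move=> A C2f C2g sigma0 alpha0 c0 tw trans m12 m20 m30 m34 m14c m23c Ap Am PQ QA AK k0 M0.
move=> wM du1 du2 du3 du4 u2E u3E u1M u2M u3M u4M u12 u34 w12 w34; apply/eqP => w14.
pose W z := derive1 uh z / sigma; pose Y z := derive1 vh z / alpha.
have [dU dV dW dY] : [/\ forall z : R, is_derive z 1 uh (sigma * W z),
      forall z : R, is_derive z 1 vh (alpha * Y z),
      forall z : R, is_derive z 1 W (- (c * W z) - f (uh z) / sigma + vh z) &
      forall z : R, is_derive z 1 Y (- (c * Y z) - uh z - g (vh z) / alpha)].
  exact: wave_profile tw.
have mu0 (i : 'I_4) : (\row_j [:: m1; m2; m3; m4]`_j : 'rV[R]_4) 0 i != 0.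
  rewrite mxE; move: i; apply: ord4_ind => /=.
  - by rewrite lt_eqF// (lt_trans m12).
  - by rewrite lt_eqF.
  - by rewrite gt_eqF.
  - by rewrite gt_eqF// (lt_trans m30).
have u23 : u2 = u3 by rewrite u2E u3E.
(* The vector u4 is orthogonal to u1 by assumption and to u2 = u3 because E^u is Lagrangian, so it
   lies in E^s; uniqueness carries the relation to all z. *)
have [x [y u4E]] : exists x y, u4 0 = x *: u1 0 + y *: u2 0.
  by apply: lagrangian_maximal => //; rewrite u23.
have u4E' z : u4 z = x *: u1 z + y *: u2 z.
  have d := linear_solution_lin 1 (-1) du4 (linear_solution_lin x y du1 du2).
  have := linear_solution_eq0 AK d (z0 := 0) _ z.
  rewrite !scale1r !scaleN1r u4E subrr => /(_ erefl) /eqP.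
  by rewrite subr_eq0 => /eqP.
(* A common decay rate: k for the wave itself, -m2 and m3 for its velocity at the two ends. *)
pose kk : R := Num.min k (Num.min (- m2) m3).
have kk0 : 0 < kk by rewrite !lt_min k0 m30 oppr_gt0 m20.
have kkk : kk <= k by rewrite ge_min lexx.
have kk2 : kk <= - m2 by rewrite !ge_min lexx orbT.
have kk3 : kk <= m3 by rewrite !ge_min lexx !orbT.
have le_exp (a b z : R) : z <= 0 -> b <= a -> expR (a * z) <= expR (b * z).
  move=> z0 ba; rewrite ler_expR -subr_ge0 -mulrBl -mulrNN opprB.
  by rewrite mulr_ge0 ?subr_ge0// oppr_ge0.
pose M' : R := M + M / sigma + M / alpha + M / sigma.
have M'0 : 0 <= M / sigma /\ 0 <= M / alpha by split; rewrite divr_ge0// ltW.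
have vel (z E : R) : l1 (wave_velocity sigma alpha uh vh z) <= M * E ->
    `|W z| <= M / sigma * E /\ `|Y z| <= M / alpha * E.
  move=> h; have hi i := le_trans (ler_l1 (wave_velocity sigma alpha uh vh z) i 0) h.
  have := hi 0; have := hi 1; rewrite !mxE /= => h1 h0.
  rewrite /W /Y !normrM !normfV (gtr0_norm sigma0) (gtr0_norm alpha0).
  by rewrite ![_ / _ * E]mulrAC !ler_wpM2r// invr_ge0 ltW.
have decay sg z : sg = 1 \/ sg = -1 -> z <= 0 ->
    [/\ `|uh (sg * z)| <= M' * expR (kk * z), `|vh (sg * z)| <= M' * expR (kk * z),
        `|W (sg * z)| <= M' * expR (kk * z) & `|Y (sg * z)| <= M' * expR (kk * z)].
  move=> sgE z0; have [Ms Ma] := M'0.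
  have uv : `|uh (sg * z)| + `|vh (sg * z)| <= M * expR (kk * z).
    apply: le_trans (wM _) _; rewrite ler_wpM2l//.
    have -> : `|sg * z| = - z.
      by rewrite normrM [`|z|]ler0_norm//; case: sgE => ->; rewrite ?normrN normr1 mul1r.
    by rewrite mulrN opprK le_exp.
  have wy : `|W (sg * z)| <= M / sigma * expR (kk * z) /\
            `|Y (sg * z)| <= M / alpha * expR (kk * z).
    apply: vel; case: sgE => ->; rewrite ?mul1r ?mulN1r.
      rewrite -u3E (le_trans (u3M z z0))// ler_wpM2l// le_exp//.
    have nz0 : 0 <= - z by rewrite oppr_ge0.
    rewrite -u2E (le_trans (u2M _ nz0))// ler_wpM2l// mulrN -mulNr le_exp//.
  have [wz yz] := wy.
  have e0 := expR_ge0 (kk * z).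
  have Me := mulr_ge0 M0 e0; have Mse := mulr_ge0 Ms e0; have Mae := mulr_ge0 Ma e0.
  have := normr_ge0 (uh (sg * z)); have := normr_ge0 (vh (sg * z)).
  move: uv wz yz Me Mse Mae; rewrite /M'; clear => *; split; lra.
have bd z : [/\ `|uh z| <= M', `|vh z| <= M', `|W z| <= M' & `|Y z| <= M'].
  have M'p : 0 <= M' by have [Ms Ma] := M'0; rewrite /M' !addr_ge0.
  have H sg t : sg = 1 \/ sg = -1 -> t <= 0 -> sg * t = z ->
     [/\ `|uh z| <= M', `|vh z| <= M', `|W z| <= M' & `|Y z| <= M'].
    move=> sgE t0 <-; have [h1 h2 h3 h4] := decay sg t sgE t0.
    have e1 : M' * expR (kk * t) <= M'.
      by rewrite ler_piMr// -expR0 ler_expR pmulr_rle0.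
    by split; apply: le_trans e1.
  have [z0|z0] := lerP z 0; first by apply: (H 1 z); rewrite ?mul1r//; left.
  by apply: (H (-1) (- z)); rewrite ?mulrNN ?mul1r ?oppr_le0 ?ltW//; right.
have lim0 sg : sg = 1 \/ sg = -1 -> forall e, 0 < e -> exists T, forall z, z <= - T ->
    [/\ `|uh (sg * z)| <= e, `|vh (sg * z)| <= e, `|W (sg * z)| <= e
      & `|Y (sg * z)| <= e].
  move=> sgE e e0.
  have lim := cvg_exp_bounded_ninfty (f := fun z => M' * expR (kk * z)) kk0.
  have [|T T0 HT] := @near_ninfty_ex R (fun z => M' * expR (kk * z) <= e).
    have : M' * expR (kk * z) @[z --> -oo] --> (0 : R).
      by apply: (lim `|M'|) => z _; rewrite normrM [`|expR _|]ger0_norm ?expR_ge0.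
    move=> /cvgrPdist_le /(_ e e0); apply: filterS => z.
    by rewrite sub0r normrN; apply: le_trans; exact: ler_norm.
  exists T => z zT; have z0 : z <= 0 by rewrite (le_trans zT)// oppr_le0.
  have [h1 h2 h3 h4] := decay sg z sgE z0; have He := HT z zT.
  by split; apply: le_trans He.
have AT sg : sg = 1 \/ sg = -1 -> forall e, 0 < e -> exists2 T, 0 <= T &
     forall z, z <= - T -> l1 (A (sg * z) - Ai) <= e.
  move=> sgE; apply: (@cvg_matrix_ex R (fun z => A (sg * z))).
  case: sgE => ->.
    by have -> : (fun z => A (1 * z)) = A by apply/funext => z; rewrite mul1r.
  have -> : (fun z => A (-1 * z)) = A \o -%R by apply/funext => z /=; rewrite mulN1r.
  by apply: cvg_comp Ap; rewrite ninftyN.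
have sgn sg : sg = 1 \/ sg = -1 -> `|sg| = 1 :> R.
  by case=> ->; rewrite ?normrN normr1.
pose F := augmented_field f g sigma alpha.
pose p := colv 5 [:: 0; 0; 0; 0; c] : 'cV[R]_5.
pose q := colv 5 [:: uh 0; vh 0; W 0; Y 0; c] : 'cV[R]_5.
have key sg k1 N u : sg = 1 \/ sg = -1 -> linear_solution A u -> 0 < k1 -> 0 <= N ->
  (forall z, z <= 0 -> expR (c * (sg * z)) * l1 (u (sg * z)) <= N * expR (k1 * z)) ->
  exists l, forall a : 'cV[R]_5,
  (forall e, 0 < e -> exists T S, tangent_vector S q a /\
     forall q', S q' -> exists X : R -> 'cV[R]_5, [/\ X 0 = q',
       forall z : R, z <= 0 -> forall i,
         is_derive z 1 (fun x => X x i 0) (sg * F (X z) i 0) &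
       forall z, z <= - T -> `|X z - p| <= e]) ->
  omega (u 0) (colv 4 [:: a 0 0; a 1 0; a 2 0; a 3 0]) = a 4 0 * l.
  move=> sgE du k10 N0 uN.
  exact: (half_line_functional C2f C2g sigma0 alpha0 (sgn _ sgE) dU dV dW dY bd
    (lim0 _ sgE) (ex_intro _ K AK) (AT _ sgE) PQ QA mu0 du k10 N0 uN).
(* The covector exp(c z) omega(u, _) has the exponent c + m3 = -m2 > 0 for u3 and c + m4 = -m1 > 0
   for u4 at -oo, and c + m2 = -m3 < 0 at +oo, so it decays at both ends. *)
have cm3 : 0 < c + m3 by move: m23c m20; clear; lra.
have cm4 : 0 < c + m4 by move: cm3 m34; clear; lra.
have cm2 : 0 < - (c + m2) by move: m23c m30; clear; lra.
have left1 : (1 : R) = 1 \/ (1 : R) = -1 by left.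
have right1 : (-1 : R) = 1 \/ (-1 : R) = -1 by right.
have bwd (u : R -> 'cV[R]_4) m z : l1 (u z) <= M * expR (m * z) ->
    expR (c * (1 * z)) * l1 (u (1 * z)) <= M * expR ((c + m) * z).
  move=> h; rewrite mul1r mulrDl expRD [leRHS]mulrCA.
  by rewrite ler_wpM2l ?expR_ge0.
have fwd (u : R -> 'cV[R]_4) N z : l1 (u (- z)) <= N * expR (m2 * - z) ->
    expR (c * (-1 * z)) * l1 (u (-1 * z)) <= N * expR (- (c + m2) * z).
  move=> h; rewrite mulN1r mulNr -mulrN mulrDl expRD [leRHS]mulrCA.
  by rewrite ler_wpM2l ?expR_ge0.
have [k3 Hk3] := key 1 (c + m3) M u3 left1 du3 cm3 M0 (fun z z0 => bwd _ _ _ (u3M z z0)).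
have [k4 Hk4] := key 1 (c + m4) M u4 left1 du4 cm4 M0 (fun z z0 => bwd _ _ _ (u4M z z0)).
have [l3 Hl3] : exists l, forall a : 'cV[R]_5,
  (forall e, 0 < e -> exists T S, tangent_vector S q a /\
     forall q', S q' -> exists X : R -> 'cV[R]_5, [/\ X 0 = q',
       forall z : R, z <= 0 -> forall i,
         is_derive z 1 (fun x => X x i 0) (-1 * F (X z) i 0) &
       forall z, z <= - T -> `|X z - p| <= e]) ->
  omega (u3 0) (colv 4 [:: a 0 0; a 1 0; a 2 0; a 3 0]) = a 4 0 * l.
  apply: (key (-1) (- (c + m2)) M) => // z z0; apply: fwd.
  by rewrite -u23 u2M// oppr_ge0.
have [l4 Hl4] : exists l, forall a : 'cV[R]_5,
  (forall e, 0 < e -> exists T S, tangent_vector S q a /\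
     forall q', S q' -> exists X : R -> 'cV[R]_5, [/\ X 0 = q',
       forall z : R, z <= 0 -> forall i,
         is_derive z 1 (fun x => X x i 0) (-1 * F (X z) i 0) &
       forall z, z <= - T -> `|X z - p| <= e]) ->
  omega (u4 0) (colv 4 [:: a 0 0; a 1 0; a 2 0; a 3 0]) = a 4 0 * l.
  (* Forward in time u4 is a combination of u1 and u2, and m2 is the slower of their rates. *)
  apply: (key (-1) (- (c + m2)) ((`|x| + `|y|) * M)) => //.
    by rewrite mulr_ge0// addr_ge0.
  move=> z z0; apply: fwd; have nz0 : 0 <= - z by rewrite oppr_ge0.
  rewrite u4E' (le_trans (l1D _ _))// !l1Z -mulrA [leRHS]mulrDl lerD// ler_wpM2l//.
    rewrite (le_trans (u1M _ nz0))// ler_wpM2l// !mulrN -!mulNr le_exp//.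
    by rewrite lerN2 ltW.
  exact: u2M.
have cuT a : cu_tangent F p q a -> forall e, 0 < e -> exists T S, tangent_vector S q a /\
     forall q', S q' -> exists X : R -> 'cV[R]_5, [/\ X 0 = q',
       forall z : R, z <= 0 -> forall i,
         is_derive z 1 (fun x => X x i 0) (1 * F (X z) i 0) &
       forall z, z <= - T -> `|X z - p| <= e].
  move=> cu e e0; have [T tv] := cu e e0.
  exists T, (cu_manifold F p e T); split=> // q' [X [X0 dX Xp]].
  by exists X; split=> // z z0 i; rewrite mul1r; exact: is_derive_entry (dX z z0).
have csT a : cs_tangent F p q a -> forall e, 0 < e -> exists T S, tangent_vector S q a /\
     forall q', S q' -> exists X : R -> 'cV[R]_5, [/\ X 0 = q',
       forall z : R, z <= 0 -> forall i,
         is_derive z 1 (fun x => X x i 0) (-1 * F (X z) i 0) &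
       forall z, z <= - T -> `|X z - p| <= e].
  move=> cs e e0; have [T tv] := cs e e0.
  exists T, (cs_manifold F p e T); split=> // q' [X [X0 dX Xp]].
  (* Time reversal turns forward orbits into backward orbits of the reversed field. *)
  exists (fun z => X (-1 * z)); split; first by rewrite mulr0.
    move=> z z0 i; apply: (is_derive_mulx (f := fun x => X x i 0)).
    by apply: is_derive_entry; apply: dX; rewrite mulN1r oppr_ge0.
  by move=> z zT; apply: Xp; rewrite mulN1r lerNr.
apply: (@tangents_not_transverse R (u3 0) (u4 0) (cu_tangent F p q) (cs_tangent F p q)
  k3 k4 l3 l4 u34).
  split=> a at_; [apply: Hk3|apply: Hk4|apply: Hl3|apply: Hl4];
    by [exact: cuT|exact: csT].
move=> v; have [a [b [ta tb vE]]] := trans 0 v.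
by exists a, b.
Qed.

(** * The Maslov index *)

(** Evaluates the contribution n_+ of the last crossing: on a line the index is 1 for a positive
    form and 0 for a negative one. *)
Lemma pos_index_line (R : realType) (Q : 'cV[R]_4 -> R) (x : 'cV[R]_4) :
  (forall k y, Q (k *: y) = k ^+ 2 * Q y) -> x != 0 -> Q x != 0 ->
  (-1 : R) ^ (pos_index Q <[x]>%VS)%:Z = - Num.sg (Q x).
Proof.
move=> QZ x0 Qx.
have pos (Q' : 'cV[R]_4 -> R) : (forall k y, Q' (k *: y) = k ^+ 2 * Q' y) ->
    0 < Q' x -> forall y, y \in <[x]>%VS -> y != 0 -> 0 < Q' y.
  move=> Q'Z Q'x y /vlineP[k ->]; rewrite scaler_eq0 negb_or => /andP[k0 _].
  by rewrite Q'Z mulr_gt0// exprn_even_gt0.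
have [Qp|Qn] := ltrP 0 (Q x).
  have [-> _] := pos_index_definite (pos Q QZ Qp).
  by rewrite dim_vline x0 gtr0_sg.
have {}Qn : Q x < 0 by rewrite lt_neqAle Qx.
have [|_] := @pos_index_definite R _ (fun y => - Q y) <[x]>%VS.
  by apply: pos; [move=> k y; rewrite QZ mulrN|rewrite oppr_gt0].
rewrite /neg_index (_ : (fun y => - - Q y) = Q); last first.
  by apply/funext => y; rewrite opprK.
by move=> ->; rewrite expr0z ltr0_sg// opprK.
Qed.

(** As nu2 < 0, the square root exceeds |c| = -c, which gives mu2 and mu3 their signs. *)
Lemma decay_rates (R : realType) (c nu1 nu2 : R) :
  c < 0 -> nu1 < nu2 -> nu2 < 0 ->
  [/\ mu_minus c nu1 < mu_minus c nu2, mu_minus c nu2 < 0,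
      0 < mu_plus c nu2 & mu_plus c nu2 < mu_plus c nu1] /\
  (mu_minus c nu1 + mu_plus c nu1 = - c /\ mu_minus c nu2 + mu_plus c nu2 = - c).
Proof.
move=> c0 n12 n20; rewrite /mu_minus /mu_plus.
have c2 := sqr_ge0 c.
have s12 : Num.sqrt (c ^+ 2 - 4 * nu2) < Num.sqrt (c ^+ 2 - 4 * nu1).
  by rewrite ltr_sqrt; lra.
have s2 : - c < Num.sqrt (c ^+ 2 - 4 * nu2).
  by rewrite -(ltr0_norm c0) -sqrtr_sqr ltr_sqrt; lra.
by split; split; lra.
Qed.

Lemma continuous_pos_ray (R : realType) (h : R -> R) (a : R) : continuous h ->
  (forall x, a <= x -> h x != 0) -> (\forall x \near +oo, 0 < h x) -> 0 < h a.
Proof.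
move=> ch h0 hp; rewrite ltNge; apply/negP => ha.
have [x [ax hx]] : exists x, a <= x /\ 0 < h x.
  near (pinfty_nbhs R) => x; exists x; split; last by near: x.
  by near: x; exact: (nbhs_pinfty_ge (num_real a)).
have [||y] := @IVT R h a x 0 ax.
- by apply: continuous_subspaceT => y; exact: ch.
- by rewrite ge_min ha le_max (ltW hx) orbT.
rewrite in_itv /= => /andP[ay _] hy.
by have := h0 y ay; rewrite hy eqxx.
Unshelve. all: by end_near. Qed.

Theorem mainTheorem2 (R : realType) (f g : R -> R) (sigma alpha c : R)
    (uh vh : R -> R) (nu1 nu2 : R) (Ainf : 'M[R]_4)
    (eta1 eta2 eta3 eta4 : 'cV[R]_4) (u1 u2 u3 u4 : R -> 'cV[R]_4) (tau : R)
    (mu1 := mu_minus c nu1) (mu2 := mu_minus c nu2)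
    (mu3 := mu_plus c nu2) (mu4 := mu_plus c nu1)
    (phi := wave_orbit sigma alpha uh vh)
    (A := A0 f g sigma alpha c uh vh)
    (Es := fun z => span2 (u1 z) (u2 z))
    (Eu := fun z => span2 (u3 z) (u4 z))
    (Vu := span2 eta3 eta4) :
  C2 f -> C2 g ->
  0 < sigma -> 0 < alpha ->
  f 0 = 0 -> g 0 = 0 ->
  derive1 f 0 + derive1 g 0 < 0 ->
  0 < derive1 f 0 * derive1 g 0 + sigma * alpha ->
  traveling_wave f g sigma alpha c uh vh ->
  c < 0 ->
  (* two distinct eigenvalues of a 2 x 2 matrix are simple *)
  eigenvalue (reaction_matrix f g sigma alpha) nu1 ->
  eigenvalue (reaction_matrix f g sigma alpha) nu2 ->
  nu1 < nu2 -> nu2 < 0 ->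
  (* exact exponential decay rates of the wave *)
  (ln `|phi z| / z @[z --> +oo] --> mu2) ->
  (ln `|phi z| / z @[z --> -oo] --> mu3) ->
  transversely_constructed f g sigma alpha c uh vh ->
  (* the linearized system and the solutions u_i *)
  (A z @[z --> +oo] --> Ainf) ->
  (A z @[z --> -oo] --> Ainf) ->
  eigenvector Ainf mu1 eta1 -> eigenvector Ainf mu2 eta2 ->
  eigenvector Ainf mu3 eta3 -> eigenvector Ainf mu4 eta4 ->
  linear_solution A u1 -> linear_solution A u2 ->
  linear_solution A u3 -> linear_solution A u4 ->
  (expR (- (mu1 * z)) *: u1 z @[z --> +oo] --> eta1) ->
  (expR (- (mu2 * z)) *: u2 z @[z --> +oo] --> eta2) ->
  (expR (- (mu3 * z)) *: u3 z @[z --> -oo] --> eta3) ->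
  (expR (- (mu4 * z)) *: u4 z @[z --> -oo] --> eta4) ->
  u2 = wave_velocity sigma alpha uh vh ->
  u3 = wave_velocity sigma alpha uh vh ->
  0 < det4 eta1 eta2 eta3 eta4 ->
  (* the reference time *)
  (forall tau', tau <= tau' -> (Vu :&: Es tau')%VS = 0%VS) ->
  (forall z, z <= tau -> crossing Eu (Es tau) z ->
     regular_crossing A Eu (Es tau) z) ->
  forall z, (-1 : R) ^ maslov A Eu (Es tau) tau =
            Num.sg (Omega c z (u1 z) (u4 z)).

Proof.
move=> C2f C2g sigma0 alpha0 _ _ _ _ tw c0 _ _ n12 n20 _ _ trans Ap Am.
move=> eig1 eig2 eig3 eig4 du1 du2 du3 du4 lim1 lim2 lim3 lim4 u2E u3E det_pos.
move=> cap0 reg z.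
have [[m12 m20 m30 m34] [m14c m23c]] := decay_rates c0 n12 n20.
rewrite -/mu1 -/mu2 -/mu3 -/mu4 in m12 m20 m30 m34 m14c m23c.
have det_neq0 : det4 eta1 eta2 eta3 eta4 != 0 by rewrite gt_eqF.
have [P [Q [PQ QA]]] := eigen_basis eig1 eig2 eig3 eig4 det_neq0.
have [_ _ [C [k [k0 wC]]]] := tw.
have uv_le x : `|uh x| + `|vh x| <= `|C|.
  apply: le_trans (wC x) _; apply: le_trans (_ : `|C| * 1 <= _); last by rewrite mulr1.
  rewrite (le_trans (ler_wpM2r (expR_ge0 _) (ler_norm C)))// ler_wpM2l//.
  by rewrite -expR0 ler_expR oppr_le0 mulr_ge0// ltW.
have [K AK] : exists K, forall z, l1 (A z) <= K.
  by apply: (@A0_bounded R f g sigma alpha c `|C| uh vh) => // x; apply: le_trans (uv_le x);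
    rewrite ?lerDl ?lerDr.
have cu1 : continuous u1 by move=> x; exact: linear_solution_cvg du1.
have cu2 : continuous u2 by move=> x; exact: linear_solution_cvg du2.
have cu3 : continuous u3 by move=> x; exact: linear_solution_cvg du3.
have cu4 : continuous u4 by move=> x; exact: linear_solution_cvg du4.
have [M1 M10 HM1] := bounded_exp_pinfty cu1 lim1.
have [M2 M20 HM2] := bounded_exp_pinfty cu2 lim2.
have [M3 M30 HM3] := bounded_exp_ninfty cu3 lim3.
have [M4 M40 HM4] := bounded_exp_ninfty cu4 lim4.
have i12 x : indep2 (u1 x) (u2 x).
  have det_neq0' : det4 eta3 eta4 eta1 eta2 != 0 by rewrite det4_swap.
  exact: (indep2_asymptotics AK du1 du2 det_neq0' lim1 lim2).
have i34 x : indep2 (u3 x) (u4 x).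
  exact: (indep2_asymptotics AK du3 du4 det_neq0 lim3 lim4).
have ie34 : indep2 eta3 eta4 by exact: indep2_det4 det_neq0.
(* Both planes are Lagrangian because c + mu1 + mu2 < 0 < c + mu3 + mu4. *)
have w12 x : omega (u1 x) (u2 x) = 0.
  apply: (omega_eq0_pinfty du1 du2 _ HM1 HM2).
  by move: c0 m12 m20; clear; lra.
have w34 x : omega (u3 x) (u4 x) = 0.
  apply: (omega_eq0_ninfty du3 du4 _ HM3 HM4).
  by move: m23c m20 m30 m34; clear; lra.
have u23 : u2 = u3 by rewrite u2E u3E.
(* Transversality yields this at z = 0, and constancy of [Omega] carries it to tau; M is a common
   constant for all the exponential bounds. *)
have w14 : omega (u1 tau) (u4 tau) != 0.
  pose M : R := `|C| + M1 + M2 + M3 + M4.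
  have C0 := normr_ge0 C.
  have M0 : 0 <= M by rewrite !addr_ge0.
  have up (N E x : R) : N <= M -> 0 <= E -> x <= N * E -> x <= M * E.
    by move=> NM E0 xN; rewrite (le_trans xN)// ler_wpM2r.
  have : omega (u1 0) (u4 0) != 0.
    apply: (@transverse_pairing_neq0 R f g sigma alpha c k M K mu1 mu2 mu3 mu4
      uh vh Ainf P Q u1 u2 u3 u4) => //.
    - move=> x; apply: up (wC x); last exact: expR_ge0.
      by rewrite /M; have := ler_norm C; move: M10 M20 M30 M40; clear; lra.
    - move=> x x0; apply: up (HM1 x x0); last exact: expR_ge0.
      by rewrite /M; move: C0 M10 M20 M30 M40; clear; lra.
    - move=> x x0; apply: up (HM2 x x0); last exact: expR_ge0.
      by rewrite /M; move: C0 M10 M20 M30 M40; clear; lra.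
    - move=> x x0; apply: up (HM3 x x0); last exact: expR_ge0.
      by rewrite /M; move: C0 M10 M20 M30 M40; clear; lra.
    - move=> x x0; apply: up (HM4 x x0); last exact: expR_ge0.
      by rewrite /M; move: C0 M10 M20 M30 M40; clear; lra.
  apply: contra_neq => w0.
  have := @Omega_const R f g sigma alpha c uh vh u1 u4 tau 0 du1 du4.
  rewrite /Omega w0 mulr0 => /esym /eqP; rewrite mulf_eq0 (gt_eqF (expR_gt0 _)) /=.
  by move=> /eqP.
pose beta (x : R) : R := - (omega (u1 tau) (u3 x) * omega (u2 tau) (u4 x)) +
  omega (u1 tau) (u4 x) * omega (u2 tau) (u3 x).
have betaE x : beta x = det4 (u1 tau) (u2 tau) (u3 x) (u4 x).
  by rewrite det4E w12 mul0r sub0r.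
have limit_pos : 0 < det4 (u1 tau) (u2 tau) eta3 eta4.
  apply: (@continuous_pos_ray R (fun x => det4 (u1 x) (u2 x) eta3 eta4)).
  - by move=> x; apply: cvg_det4; [exact: cu1|exact: cu2|exact: cvg_cst|exact: cvg_cst].
  - move=> x /cap0 cap; rewrite -(span2_cap_neq0 (i12 x) ie34).
    by rewrite negbK; apply/eqP.
  - have lim : det4 (expR (- (mu1 * x)) *: u1 x) (expR (- (mu2 * x)) *: u2 x) eta3 eta4
        @[x --> +oo] --> det4 eta1 eta2 eta3 eta4.
      by apply: cvg_det4 => //; exact: cvg_cst.
    have : \forall x \near +oo, 0 < det4 (expR (- (mu1 * x)) *: u1 x)
        (expR (- (mu2 * x)) *: u2 x) eta3 eta4 by exact: cvgr_gt lim _ det_pos.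
    apply: filterS => x; rewrite det4_swap det4_scale pmulr_rgt0 ?mulr_gt0 ?expR_gt0//.
    by rewrite det4_swap.
have [a0 a0pos] : exists a0, forall x, x <= a0 -> 0 < beta x.
  have lim : det4 (u1 tau) (u2 tau) (expR (- (mu3 * x)) *: u3 x)
      (expR (- (mu4 * x)) *: u4 x) @[x --> -oo] --> det4 (u1 tau) (u2 tau) eta3 eta4.
    by apply: cvg_det4 => //; exact: cvg_cst.
  have near_pos : \forall x \near -oo, 0 < det4 (u1 tau) (u2 tau)
      (expR (- (mu3 * x)) *: u3 x) (expR (- (mu4 * x)) *: u4 x).
    by exact: cvgr_gt lim _ limit_pos.
  have [T _ HT] := near_ninfty_ex near_pos.
  exists (- T) => x /HT; rewrite det4_scale betaE pmulr_rgt0//.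
  by rewrite mulr_gt0 ?expR_gt0.
have crossE x : crossing Eu (Es tau) x <-> beta x = 0.
  rewrite /crossing betaE /Eu /Es span2_cap_neq0//; split=> [/eqP|/eqP] //.
have local s : s <= tau -> exists2 C, C != 0 &
    beta x / (x - s) ^+ \dim (Eu s :&: Es tau) @[x --> s^'] --> C.
  move=> st; apply: (@crossing_asymptotics R A c) => //.
    by move=> x u y; exact: omega_A0.
  exact: reg.
have sign_local s : s <= tau -> crossing Eu (Es tau) s ->
    (-1 : R) ^ Defs.form_sign (crossing_form A s) (Eu s :&: Es tau)%VS =
    (-1) ^+ \dim (Eu s :&: Es tau)%VS.
  move=> st cs.
  apply: (@form_sign_parity R _ (fun x y => omega x (A s *m y))).
  - by move=> *; rewrite omegaDl.
  - by move=> *; rewrite mulmxDr omegaDr.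
  - by move=> *; rewrite omegaZl.
  - by move=> *; rewrite -scalemxAr omegaZr.
  - exact: reg.
  - by rewrite (leq_trans (dimvS (capvSl _ _)))// (leq_trans (dim_span _)).
pose a : R := Num.min a0 tau.
have a_tau : a <= tau by rewrite ge_min lexx orbT.
have a_a0 : a <= a0 by rewrite ge_min lexx.
have [e e0 count] : exists2 e, 0 < e & forall x, tau - e < x < tau ->
    Num.sg (beta x) = (-1 : R) ^ (\sum_(z \in [set z | z < tau /\ crossing Eu (Es tau) z])
      Defs.form_sign (crossing_form A z) (Eu z :&: Es tau)%VS).
  apply: (sign_crossing_count a_tau).
    move=> x xa; have b0 := a0pos x (le_trans xa a_a0); split=> //.
    by move=> /crossE b1; rewrite b1 ltxx in b0.
  move=> s /andP[_ st]; have [C' C'0 limC] := local s st.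
  have [e e0 He] := sg_near_zero C'0 limC.
  exists e => // x y xs ys; have [bx by_ sy sx] := He x y xs ys.
  split.
  - by move=> /crossE b0; rewrite b0 eqxx in bx.
  - by move=> /crossE b0; rewrite b0 eqxx in by_.
  (* By parity the factor (-1) to the signature is (-1)^d, which cancels the sign (-1)^d that [beta]
     has to the left of s. *)
  - by move=> cs; rewrite sign_local// sx mulrA -expr2 sqrr_sign mul1r.
  - move=> ncs; rewrite sy sx.
    suff -> : \dim (Eu s :&: Es tau) = 0%N by rewrite expr0 mul1r.
    by apply/eqP; rewrite dimv_eq0; apply/negPn/negP.
have E1 : omega (u1 tau) (u3 tau) = 0 by rewrite -u23 w12.
have E2 : omega (u2 tau) (u3 tau) = 0 by rewrite u23 omegaxx.
have E3 : omega (u2 tau) (u4 tau) = 0 by rewrite u23 w34.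
pose G : R := crossing_form A tau (u3 tau).
have u30 : u3 tau != 0.
  apply/eqP => u0; have [] := i34 tau 1 0; first by rewrite u0 scaler0 scale0r addr0.
  by move=> /eqP; rewrite oner_eq0.
(* A vector x u3 + y u4 of E^s(tau) pairs to 0 with u1, and this pairing is y omega(u1, u4), so y =
   0: the crossing at tau is one-dimensional. *)
have capE : (Eu tau :&: Es tau)%VS = <[u3 tau]>%VS.
  apply/vspaceP => v; rewrite memv_cap; apply/andP/vlineP.
    move=> [/mem_span2[x [y vE]] /mem_span2[x' [y' vE']]].
    have : omega (u1 tau) v = 0.
      by rewrite vE' omegaDr !omegaZr omegaxx w12 !mulr0 addr0.
    rewrite vE omegaDr !omegaZr E1 mulr0 add0r => /eqP.
    by rewrite mulf_eq0 (negbTE w14) orbF => /eqP ->; exists x; rewrite scale0r addr0.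
  move=> [x ->]; split; apply/mem_span2.
    by exists x, 0; rewrite scale0r addr0.
  by exists 0, x; rewrite scale0r add0r u23.
have cross_tau : crossing Eu (Es tau) tau.
  by rewrite /crossing capE -dimv_eq0 dim_vline u30.
have QZ x y : crossing_form A tau (x *: y) = x ^+ 2 * crossing_form A tau y.
  by rewrite /crossing_form -scalemxAr omegaZl omegaZr mulrA.
have G0 : G != 0.
  apply/eqP => G0; move/eqP: u30; apply; apply: (reg tau (lexx _) cross_tau).
    by rewrite capE memv_line.
  move=> y; rewrite capE => /vlineP[x ->].
  rewrite polar_crossing_form -scalemxAr omegaZl omegaZr.
  by rewrite /G /crossing_form in G0; rewrite G0 mulr0 addr0 mul0r.
(* As omega(u2, u4) = omega(u3, u4) = 0 at tau, the first product drops out; the second yields the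
   crossing form because u2 = u3. *)
have lim_tau : beta x / (x - tau) ^+ 1 @[x --> tau^'] --> omega (u1 tau) (u4 tau) * G.
  have := quot_cvg (omega_quot_cvg du3 E1) (@omega_cvg_dnbhs R A u4 (u2 tau) tau du4)
    (@omega_cvg_dnbhs R A u4 (u1 tau) tau du4) (omega_quot_cvg du3 E2).
  have GE : omega (u2 tau) (A tau *m u3 tau) = G by rewrite u23.
  by rewrite E3 mulr0 oppr0 add0r GE.
have [e' e'0 He'] := sg_near_zero (mulf_neq0 w14 G0) lim_tau.
pose d : R := Num.min e e'.
have d0 : 0 < d by rewrite lt_min e0.
have de : d <= e by rewrite ge_min lexx.
have de' : d <= e' by rewrite ge_min lexx orbT.
have x_in : tau - e < tau - d / 2 < tau by apply/andP; split; move: d0 de; clear; lra.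
have x_in' : tau - e' < tau - d / 2 < tau by apply/andP; split; move: d0 de'; clear; lra.
have y_in' : tau < tau + e' / 2 < tau + e' by apply/andP; split; move: e'0; clear; lra.
(* Just before tau the sign of [beta] is -sg(omega(u1, u4)) sg(G), and n_+ contributes -sg(G); in
   the product the sign of G squares away. *)
have [_ _ _ sgb] := He' _ _ x_in' y_in'.
rewrite /maslov expfzDr ?oppr_eq0 ?oner_eq0// -(count _ x_in) sgb capE.
rewrite (pos_index_line QZ u30 G0) expr1 -/G mulN1r mulrNN sgrM -mulrA -expr2.
rewrite sqr_sg G0 mulr1.
rewrite (@Omega_const R f g sigma alpha c uh vh u1 u4 z tau du1 du4) /Omega sgrM.
by rewrite (gtr0_sg (expR_gt0 _)) mul1r.
Qed.
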